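(* Let $h=(h_i)_{i\ge 0}$ be a probability distribution on $\{0,1,2,\dots\}$ with $0<m_h:=\sum_{k\ge 1} k h_k<1$, and suppose that there exists $c>0$ such that $\sum_{l\ge k} h_l\le \exp\{-ck\}$ for each $k\in\mathbb{N}$. Let $\nu$ be a probability distribution on $(1,\infty)$ whose support is contained in $[q,Q]$ for some $Q>q>1$. Then, for each $\epsilon>0$, $$\mathbb{P}_{h,\nu,u}\left(\frac{\mathbb{E}^{\phi}_{T,\beta,\mathcal{DE}}(H_\phi)}{2\omega_* p_{\rm de}^{-1}}\in(1-\epsilon,1+\epsilon)\right)\to 1\qquad\text{as } u\to\infty,$$ and, for all $t>0$, $$\Big(\mathbb{P}_{h,\nu,u}\times\mathbb{P}^{\phi}_{T,\beta,\mathcal{DE}}\Big)\left(\frac{H_\phi}{2\omega_* p_{\rm de}^{-1}}>t\right)\to \exp\{-t\}\qquad\text{as } u\to\infty .$$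
   Context: Trees: let $\mathcal{U}=\bigcup_{n\ge 0}\mathbb{N}^n$ with $\mathbb{N}=\{1,2,\dots\}$ and $\mathbb{N}^0=\{\emptyset\}$. A finite rooted ordered tree $T$ is a finite subset of $\mathcal{U}$ that contains $\emptyset$ (the root, denoted $\phi$), contains $u_1\dots u_{n-1}$ (the parent) whenever it contains $u_1\dots u_n$ with $n\ge1$, and is such that each $u\in T$ has an integer $k_u\ge 0$ with $uj\in T$ if and only if $1\le j\le k_u$ (these $uj$ are the offspring of $u$). Edges join each non-root vertex to its parent. The tree is weighted if each edge $e$ carries a bias $\beta_e>1$. For $v\in V(T)$, $\omega(v)$ is the product of the biases along the simple path from $\phi$ to $v$ (so $\omega(\phi)=1$), and $\omega(T)=\sum_{v\in V(T)}\omega(v)$. The vertex $v_{\rm base}$ is the lexicographically minimal vertex among those at maximal distance from $\phi$. The vertex $v_{\rm child}$ is the neighbour of $\phi$ on the path from $\phi$ to $v_{\rm base}$; $T_{v_{\rm child}}$ is the descendent tree of $v_{\rm child}$ (the subgraph induced by $v_{\rm child}$ and all its descendents, rooted at $v_{\rm child}$); and $\omega_*=\sum_{v\in V(T_{v_{\rm child}})}\omega_{v_{\rm child}}(v)$, where $\omega_{v_{\rm child}}(v)$ is the product of the biases along the path from $v_{\rm child}$ to $v$. Laws: $\mathbb{P}_{h,\nu}$ is the law of a Galton-Watson tree with offspring distribution $h$, with edge biases that, given the tree, are i.i.d. with law $\nu$. For $u>0$, $\mathbb{P}_{h,\nu,u}=\mathbb{P}_{h,\nu}(\,\cdot\mid\omega(T)>u)$.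 Walk: given a weighted tree $T$, the $\beta$-biased walk $(X_n)$ is the Markov chain on $V(T)$ with the following transitions. From $v\ne\phi$ with offspring $v_1,\dots,v_k$, it jumps to the parent of $v$ with probability $\frac{1}{1+\sum_{i}\beta_{v,v_i}}$ and to $v_j$ with probability $\frac{\beta_{v,v_j}}{1+\sum_{i}\beta_{v,v_i}}$. From $\phi$ with offspring $\phi_1,\dots,\phi_k$, it jumps to $\phi_j$ with probability $\frac{\beta_{\phi,\phi_j}}{\sum_i\beta_{\phi,\phi_i}}$. $\mathbb{P}^v_{T,\beta}$, $\mathbb{E}^v_{T,\beta}$ denote law and expectation for the walk started at $v$. Set $H_\phi=\inf\{n\ge1:X_n=\phi\}$, $H_{v_{\rm base}}=\inf\{n\ge0:X_n=v_{\rm base}\}$, and let $\mathcal{DE}=\{H_{v_{\rm base}}<H_\phi\}$ be the deep excursion event. Put $p_{\rm de}=\mathbb{P}^{v_{\rm child}}_{T,\beta}(\mathcal{DE})$ and $\mathbb{P}^{\phi}_{T,\beta,\mathcal{DE}}=\mathbb{P}^\phi_{T,\beta}(\,\cdot\mid\mathcal{DE})$, with expectation $\mathbb{E}^\phi_{T,\beta,\mathcal{DE}}$. The notation $\mathbb{P}_{h,\nu,u}\times\mathbb{P}^{\phi}_{T,\beta,\mathcal{DE}}$ denotes the joint law obtained by sampling the weighted tree under $\mathbb{P}_{h,\nu,u}$ and then, given the tree, running the walk under $\mathbb{P}^{\phi}_{T,\beta,\mathcal{DE}}$. (For $u\ge 1$ the condition $\omega(T)>u$ forces $T$ to have at least one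 edge, so these objects are defined.) *)

(* Defs.v *)
From HB Require Import structures.
From mathcomp Require Export all_boot all_order all_algebra.
From mathcomp Require Export all_classical all_reals all_analysis.
From mathcomp Require Export finmap.

Set Implicit Arguments.
Unset Strict Implicit.
Unset Printing Implicit Defensive.

Import Order.TTheory GRing.Theory Num.Theory.
Import numFieldNormedType.Exports.

Local Open Scope classical_set_scope.
Local Open Scope ring_scope.

(* A vertex is an element of the Ulam-Harris set, i.e. a finite sequence of
   labels; the labels of the vertices of a plane tree start at 1. The parent of
   the root [::] is, by convention, [::] itself. *)
Notation vertex := (seq nat).

Definition parent (v : vertex) : vertex := take (size v).-1 v.

Definition is_plane_tree (t : {fset vertex}) : Prop :=
  [/\ [::] \in t,
      forall u j, rcons u j \in t -> u \in t &
      forall u, u \in t ->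
        exists k : nat, forall j, (rcons u j \in t) = (1 <= j <= k)%N].

Definition offspring (t : {fset vertex}) (v : vertex) : {fset vertex} :=
  [fset w in t | (w != [::]) && (parent w == v)]%fset.

(* The edge joining v != [::] to its parent carries the bias [b v]; the value
   [b [::]] and the values of b outside of t are never used. *)
Definition is_weighted_tree (R : realType) (t : {fset vertex})
    (b : vertex -> R) : Prop :=
  is_plane_tree t /\ (forall v, v \in t -> v != [::] -> 1 < b v).

(* Product of the biases along the path from a vertex x down to its descendent
   v: the vertices of this path, x excluded, are the prefixes of v of length
   size x + 1, ..., size v. *)
Definition path_weight (R : realType) (b : vertex -> R) (x v : vertex) : R :=
  \prod_(size x <= i < size v) b (take i.+1 v).

Definition tree_weight (R : realType) (t : {fset vertex}) (b : vertex -> R) : R :=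
  \sum_(v <- t) path_weight b [::] v.

Definition height (t : {fset vertex}) : nat := \max_(v <- t) size v.

Definition vbase (t : {fset vertex}) : vertex :=
  head [::] (sort (fun u v : seqlexi nat => (u <= v)%O)
                  [fset v in t | size v == height t]%fset).

Definition vchild (t : {fset vertex}) : vertex := take 1 (vbase t).

Definition descendent_tree (t : {fset vertex}) (x : vertex) : {fset vertex} :=
  [fset v in t | prefix x v]%fset.

Definition omega_star (R : realType) (t : {fset vertex}) (b : vertex -> R) : R :=
  \sum_(v <- descendent_tree t (vchild t)) path_weight b (vchild t) v.

Definition walk_kernel (R : realType) (t : {fset vertex}) (b : vertex -> R)
    (v w : vertex) : R :=
  let Z := \sum_(x <- offspring t v) b x in
  if v == [::] then (if w \in offspring t v then b w / Z else 0)
  else if w == parent v then (1 + Z)^-1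
  else if w \in offspring t v then b w / (1 + Z)
  else 0.

(* [Pw t b v] is the quenched law of the b-biased walk on t started at v, for
   the process X on the sample space S: for every weighted tree with at least
   one edge, X is a Markov chain under [Pw t b v]. *)
Definition is_biased_walk (R : realType) (d : measure_display)
    (S : measurableType d) (X : nat -> S -> vertex)
    (Pw : {fset vertex} -> (vertex -> R) -> vertex -> probability S R) : Prop :=
  (forall n v, measurable (X n @^-1` [set v])) /\
  (forall t b v, is_weighted_tree t b -> (1 < #|` t|)%N -> v \in t ->
     forall (n : nat) (x : nat -> vertex),
       Pw t b v [set s | forall i, (i <= n)%N -> X i s = x i] =
       ((x 0%N == v)%:R * \prod_(i < n) walk_kernel t b (x i) (x i.+1))%:E).

Definition traj (S : Type) (X : nat -> S -> vertex) (s : S) : nat -> vertex :=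
  fun n => X n s.

(* Hitting times, with value +oo when the vertex is never visited. *)
Definition hit_root (R : realType) (x : nat -> vertex) : \bar R :=
  ereal_inf [set (n%:R)%:E | n in [set n | (1 <= n)%N /\ x n = [::]]].

Definition hit_base (R : realType) (t : {fset vertex}) (x : nat -> vertex) :
    \bar R :=
  ereal_inf [set (n%:R)%:E | n in [set n | x n = vbase t]].

Definition deep_excursion (R : realType) (S : Type) (X : nat -> S -> vertex)
    (t : {fset vertex}) : set S :=
  [set s | (hit_base R t (traj X s) < hit_root R (traj X s))%E].

(* P(A | D) and E(f | D) for an event D of positive probability. *)
Definition cond_prob (R : realType) (d : measure_display) (W : measurableType d)
    (P : probability W R) (D A : set W) : \bar R :=
  (P (A `&` D) * ((fine (P D))^-1)%:E)%E.

Definition cond_expect (R : realType) (d : measure_display)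
    (W : measurableType d) (P : probability W R) (D : set W) (f : W -> \bar R) :
    \bar R :=
  ((\int[P]_(w in D) f w) * ((fine (P D))^-1)%:E)%E.

Definition p_de (R : realType) (d : measure_display) (S : measurableType d)
    (X : nat -> S -> vertex)
    (Pw : {fset vertex} -> (vertex -> R) -> vertex -> probability S R)
    (t : {fset vertex}) (b : vertex -> R) : R :=
  fine (Pw t b (vchild t) (deep_excursion R X t)).

(* The tree in which each vertex u has k u offspring. *)
Definition gw_vertices (k : vertex -> nat) : set vertex :=
  [set u | forall i, (i < size u)%N -> (1 <= nth 0%N u i <= k (take i u))%N].

(* When [gw_vertices k] is infinite, [gw_tree k] is the empty set, which is not
   a plane tree and whose weight is 0. *)
Definition gw_tree (k : vertex -> nat) : {fset vertex} :=
  fset_set (gw_vertices k).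

Definition rand_tree (W : Type) (K : vertex -> W -> nat) (w : W) :
    {fset vertex} :=
  gw_tree (fun u => K u w).

Definition rand_bias (R : realType) (W : Type) (B : vertex -> W -> R) (w : W) :
    vertex -> R :=
  fun v => B v w.

Definition iid_offspring (R : realType) (d : measure_display)
    (W : measurableType d) (P : probability W R) (h : nat -> R)
    (K : vertex -> W -> nat) : Prop :=
  forall (s : seq vertex) (k : vertex -> nat), uniq s ->
    P [set w | forall v, v \in s -> K v w = k v] = (\prod_(v <- s) h (k v))%:E.

(* Given the tree, the biases of its edges are i.i.d. with law nu. *)
Definition cond_iid_bias (R : realType) (d : measure_display)
    (W : measurableType d) (P : probability W R)
    (nu : probability (measurableTypeR R) R)
    (T : W -> {fset vertex}) (B : vertex -> W -> R) : Prop :=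
  forall (t : {fset vertex}) (A : vertex -> set (measurableTypeR R)),
    (forall v, measurable (A v)) ->
    P [set w | T w = t /\ (forall v, v \in t -> v != [::] -> A v (B v w))] =
    (P [set w | T w = t] * \prod_(v <- t | v != [::]) nu (A v))%E.

(* Under P, the tree [rand_tree K] with biases [rand_bias B] has the law of the
   Galton-Watson tree with offspring distribution h and i.i.d. edge biases of
   law nu. *)
Definition is_weighted_gw (R : realType) (d : measure_display)
    (W : measurableType d) (P : probability W R) (h : nat -> R)
    (nu : probability (measurableTypeR R) R)
    (K : vertex -> W -> nat) (B : vertex -> W -> R) : Prop :=
  [/\ forall v, measurable_fun [set: W] (K v),
      forall v, measurable_fun [set: W] (B v : W -> measurableTypeR R),
      iid_offspring P h K,
      cond_iid_bias P nu (rand_tree K) B &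
      forall w v, v \in rand_tree K w -> v != [::] -> 1 < B v w].

(* The topological support of nu. *)
Definition msupport (R : realType) (nu : probability (measurableTypeR R) R) :
    set R :=
  [set x | forall U : set R, open U -> U x -> (0 < nu U)%E].

Definition heavier (R : realType) (W : Type) (K : vertex -> W -> nat)
    (B : vertex -> W -> R) (u : R) : set W :=
  [set w | u < tree_weight (rand_tree K w) (rand_bias B w)].

(* The normalisation 2 omega_* / p_de. *)
Definition de_scale (R : realType) (d : measure_display) (S : measurableType d)
    (X : nat -> S -> vertex)
    (Pw : {fset vertex} -> (vertex -> R) -> vertex -> probability S R)
    (t : {fset vertex}) (b : vertex -> R) : R :=
  2 * omega_star t b * (p_de X Pw t b)^-1.

Definition de_mean_ratio (R : realType) (d : measure_display)
    (S : measurableType d) (X : nat -> S -> vertex)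
    (Pw : {fset vertex} -> (vertex -> R) -> vertex -> probability S R)
    (t : {fset vertex}) (b : vertex -> R) : \bar R :=
  (cond_expect (Pw t b [::]) (deep_excursion R X t)
     (fun s => hit_root R (traj X s)) * ((de_scale X Pw t b)^-1)%:E)%E.

Definition de_tail (R : realType) (d : measure_display)
    (S : measurableType d) (X : nat -> S -> vertex)
    (Pw : {fset vertex} -> (vertex -> R) -> vertex -> probability S R)
    (a : R) (t : {fset vertex}) (b : vertex -> R) : \bar R :=
  cond_prob (Pw t b [::]) (deep_excursion R X t)
    [set s | (a%:E < hit_root R (traj X s) * ((de_scale X Pw t b)^-1)%:E)%E].

(* Main.v *)
From HB Require Import structures.
Require Import Defs.
From mathcomp Require Import measurable_realfun ring lra zify.

(** The quenched part concerns a fixed weighted tree. Stopped at the root, the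
    biased walk has explicit potentials, all given by their increments along
    the edges: the mean time [hit_time] to return to the root, whose
    increments are twice the weight of a subtree minus one; the resistance
    [resist], harmonic away from the deepest leaf, which yields [p_de] as the
    inverse of the resistance of the spine; and the Green function [green] of
    the walk started at the deepest leaf, the reversible measure times
    [resist], whose total mass A is the mean time to reach the root from the
    leaf. Let F(n) be the probability that the walk from the deepest leaf has
    not reached the root at time n, and I(n) the average of the survival
    probabilities under the normalised Green function. Then I(n+1) = I(n) -
    F(n)/A. If A is much larger than the time needed to reach either the leaf
    or the root, then F and I nearly agree, so that both are close to
    (1-1/A)^n: survival is geometric, hence asymptotically exponential
    ([surv_geom]). Both this relaxation time and the difference between A and
    the commute time 2 omega_star / p_de are at most a constant times the
    weight [total_loss] which hangs off the spine, the path from [vchild] to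
    the deepest leaf. Thus both conclusions hold, up to epsilon, on every tree
    on which [total_loss] is a small proportion of [omega_star]
    ([excursion_limits]).

    It remains to prove that a tree conditioned to have a large weight is such
    a tree with high probability. Weights of subtrees decay geometrically
    along the spine, so only the losses at the first few spine vertices count
    ([total_loss_le]). A tree of weight more than u / q gives one of weight
    more than u when it is grafted above a first child, at bounded cost;
    therefore the tail of the weight decays at most polynomially
    ([mass_growth]). A root that loses a positive proportion of its weight has
    a child off the spine whose subtree has weight of order u, which costs a
    polynomial of the degree times the probability that the whole tree is
    heavy; at the same time the subtree of its spine child, which is
    independent, is tall, and this has small probability. All moments of the
    offspring law are finite, so the sum over the degree converges and such a
    loss is negligible ([negl_lossy0]). Heavy trees that are short are
    negligible by induction on the height ([negl_height]), and losses at the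
    next vertices of the spine are reduced to losses at the root of a subtree
    which is itself heavy ([negl_lossy]).

    Events of the random tree are handled shape by shape: there are countably
    many finite plane trees, the law of the shape is a finite product of
    offspring probabilities, and given the shape the biases of a subtree have
    the law of the biases of a tree with the shape of that subtree
    ([subtree_bias]). *)

Set Implicit Arguments.
Unset Strict Implicit.
Unset Printing Implicit Defensive.

Import Order.TTheory GRing.Theory Num.Theory.
Import numFieldNormedType.Exports.

Local Open Scope classical_set_scope.
Local Open Scope ring_scope.

(** * Survival of a chain killed outside of a finite set *)

(** The kernel [k] is substochastic on [V], and its defect is the probability
    of being killed. For the biased walk, [V] is the set of vertices other
    than the root, the killing is the visit of the root, and [base] is the
    deepest leaf. *)
Section KilledChain.
Context {R : realType} {T : eqType}.
Variables (V : seq T) (k : T -> T -> R) (base : T).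
Hypothesis k_ge0 : forall v w, v \in V -> 0 <= k v w.
Hypothesis k_le1 : forall v, v \in V -> \sum_(w <- V) k v w <= 1.
Hypothesis baseV : base \in V.

Definition kstep (f : T -> R) (v : T) : R := \sum_(w <- V) k v w * f w.

Lemma kstep_le (f f' : T -> R) v : v \in V ->
  (forall w, w \in V -> f w <= f' w) -> kstep f v <= kstep f' v.
Proof.
move=> vV ff'; rewrite /kstep big_seq [leRHS]big_seq.
by apply: ler_sum => w wV; rewrite ler_wpM2l ?k_ge0 ?ff'.
Qed.

Lemma kstepD f f' v : kstep (fun w => f w + f' w) v = kstep f v + kstep f' v.
Proof. by rewrite /kstep -big_split; apply: eq_bigr => w _; rewrite mulrDr. Qed.

Lemma kstepB f f' v : kstep (fun w => f w - f' w) v = kstep f v - kstep f' v.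
Proof. by rewrite /kstep -sumrB; apply: eq_bigr => w _; rewrite mulrBr. Qed.

Lemma kstepZ c f v : kstep (fun w => c * f w) v = c * kstep f v.
Proof. by rewrite /kstep mulr_sumr; apply: eq_bigr => w _; rewrite mulrCA. Qed.

Lemma kstep_ge0 f v : v \in V ->
  (forall w, w \in V -> 0 <= f w) -> 0 <= kstep f v.
Proof.
move=> vV f0; rewrite /kstep big_seq.
by apply: sumr_ge0 => w wV; rewrite mulr_ge0 ?k_ge0 ?f0.
Qed.

Lemma kstep_cst c v : 0 <= c -> v \in V -> kstep (fun=> c) v <= c.
Proof.
by move=> c0 vV; rewrite /kstep -mulr_suml -[leRHS]mul1r ler_wpM2r ?k_le1.
Qed.

(** The probability that the chain from [v] is neither killed nor at [base] at
    the times 0, ..., [n]. *)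
Fixpoint avoid (n : nat) (v : T) : R :=
  if v == base then 0 else if n is n'.+1 then kstep (avoid n') v else 1.

Lemma avoid_base n : avoid n base = 0.
Proof. by case: n => [|n] /=; rewrite eqxx. Qed.

Lemma avoidS n v : v != base -> avoid n.+1 v = kstep (avoid n) v.
Proof. by move=> /negbTE /= ->. Qed.

Lemma avoid_le n v : v \in V -> avoid n.+1 v <= avoid n v.
Proof.
elim: n v => [|n IH] v vV; have [->|vb] := eqVneq v base; rewrite ?avoid_base//.
  rewrite avoidS// /= (negbTE vb); apply: le_trans (kstep_cst ler01 vV).
  by apply: kstep_le => // w wV; case: ifP.
by rewrite avoidS// (avoidS n)//; apply: kstep_le.
Qed.

Lemma avoid_nincr m n v : v \in V -> (m <= n)%N -> avoid n v <= avoid m v.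
Proof.
move=> vV /subnK <-; elim: (n - m)%N => [|p IH]; first by rewrite add0n.
exact: le_trans (avoid_le _ vV) IH.
Qed.

Variables (h : T -> R).
Hypothesis h_ge0 : forall v, v \in V -> 0 <= h v.
Hypothesis h_super : forall v, v \in V -> v != base -> 1 + kstep h v <= h v.

(** The hypothesis on [h] says that each step before [base] or the killing
    costs one unit, so [h] dominates the mean time of the first of these two
    events. *)
Lemma sum_avoid n v : v \in V -> \sum_(i < n) avoid i v <= h v.
Proof.
elim: n v => [|n IH] v vV; first by rewrite big_ord0 h_ge0.
have [->|vb] := eqVneq v base.
  by rewrite big1 ?h_ge0// => i _; rewrite avoid_base.
apply: le_trans (h_super vV vb); rewrite big_ord_recl /= (negbTE vb) lerD2l.
rewrite /kstep exchange_big /= big_seq [leRHS]big_seq ler_sum// => w wV.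
by rewrite -mulr_sumr ler_wpM2l ?k_ge0 ?IH.
Qed.

Lemma avoid_leh n v : v \in V -> n%:R * avoid n v <= h v.
Proof.
move=> vV; apply: le_trans (sum_avoid n vV).
rewrite -[n in n%:R]card_ord -sumr_const mulr_suml ler_sum// => i _.
by rewrite mul1r avoid_nincr// ltnW.
Qed.

(** The difference of the two functions is at most the probability of avoiding
    both [base] and the killing for [n] steps, which tends to zero. *)
Lemma harmonic_le (f f' : T -> R) v : v \in V ->
  (forall w, w \in V -> 0 <= f' w) -> (forall w, w \in V -> f w <= 1) ->
  f base = f' base ->
  (forall w, w \in V -> w != base -> kstep f w = f w) ->
  (forall w, w \in V -> w != base -> kstep f' w = f' w) -> f v <= f' v.
Proof.
move=> vV f'0 f1 fb harm harm'.
have H n : forall w, w \in V -> f w - f' w <= avoid n w.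
  elim: n => [|n IH] w wV; have [->|wb] := eqVneq w base.
  - by rewrite avoid_base fb subrr.
  - by rewrite /= (negbTE wb) lerBlDr (le_trans (f1 _ wV))// lerDl f'0.
  - by rewrite avoid_base fb subrr.
  - by rewrite avoidS// -harm// -harm'// -kstepB; apply: kstep_le.
rewrite -subr_le0 leNgt; apply/negP => d0.
have := avoid_leh (Num.bound (h v / (f v - f' v))) vV; apply/negP; rewrite -ltNge.
apply: (@lt_le_trans _ _ ((Num.bound (h v / (f v - f' v)))%:R * (f v - f' v))); last first.
  by rewrite ler_wpM2l ?ler0n ?H.
rewrite -ltr_pdivrMr//; apply: le_lt_trans (archi_boundP _); first by [].
by rewrite divr_ge0 ?h_ge0// ltW.
Qed.

(** Here [u n v] is the probability that the chain from [v] survives [n]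
    steps, [g v] the probability that it visits [base] before being killed,
    and [a n v] the probability of both; they enter only through the
    recursions given by the Markov property. *)
Variables (u a : nat -> T -> R) (g : T -> R).
Hypothesis u0 : forall v, v \in V -> u 0 v = 1.
Hypothesis uS : forall n v, v \in V -> u n.+1 v = kstep (u n) v.
Hypothesis g_base : g base = 1.
Hypothesis g_ge0 : forall v, v \in V -> 0 <= g v.
Hypothesis g_le1 : forall v, v \in V -> g v <= 1.
Hypothesis g_harm : forall v, v \in V -> v != base -> kstep g v = g v.

Let F n := u n base.

Lemma surv_ge0 n v : v \in V -> 0 <= u n v.
Proof.
by elim: n v => [|n IH] v vV; rewrite ?u0 ?ler01// uS// kstep_ge0.
Qed.

Lemma surv_le n v : v \in V -> u n.+1 v <= u n v.
Proof.
elim: n v => [|n IH] v vV.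
  by rewrite uS// u0//; apply: le_trans (kstep_cst ler01 vV); apply: kstep_le => // w wV; rewrite u0.
by rewrite uS// (uS n)// kstep_le.
Qed.

Lemma surv_le1 n v : v \in V -> u n v <= 1.
Proof.
move=> vV; elim: n => [|n IH]; first by rewrite u0.
exact: le_trans (surv_le n vV) IH.
Qed.

Lemma surv_nincr m n v : v \in V -> (m <= n)%N -> u n v <= u m v.
Proof.
move=> vV /subnK <-; elim: (n - m)%N => [|p IH]; first by rewrite add0n.
exact: le_trans (surv_le _ vV) IH.
Qed.

(** If the chain survives and does not avoid [base] for [s] steps, then it
    survives [n] further steps after some visit of [base]. *)
Lemma surv_upper s n v : v \in V -> u (s + n) v <= avoid s v + F n.
Proof.
elim: s v => [|s IH] v vV; have [->|vb] := eqVneq v base.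
- by rewrite avoid_base add0r.
- by rewrite /= (negbTE vb) (le_trans (surv_le1 _ vV))// lerDl surv_ge0.
- by rewrite avoid_base add0r surv_nincr// leq_addl.
- rewrite addSn uS// avoidS//.
  apply: (@le_trans _ _ (kstep (fun w => avoid s w + F n) v)); first exact: kstep_le.
  by rewrite kstepD lerD2l kstep_cst ?surv_ge0.
Qed.

(** The chain visits [base] with probability [g v], and survives [n] further
    steps from there. *)
Lemma surv_lower n v : v \in V -> g v * F n <= u n v.
Proof.
elim: n v => [|n IH] v vV; first by rewrite /F !u0// mulr1 g_le1.
have [->|vb] := eqVneq v base; first by rewrite g_base mul1r.
rewrite uS//; apply: (@le_trans _ _ (kstep (fun w => F n * g w) v)).
  by rewrite kstepZ g_harm// mulrC ler_wpM2r ?g_ge0// surv_le.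
by apply: kstep_le => // w wV; rewrite mulrC IH.
Qed.

Hypothesis a0 : forall v, v \in V -> a 0 v = g v.
Hypothesis a_base : forall n, a n base = u n base.
Hypothesis aS : forall n v, v \in V -> v != base -> a n.+1 v = kstep (a n) v.

Lemma deep_lower n v : v \in V -> g v * F n <= a n v.
Proof.
elim: n v => [|n IH] v vV; first by rewrite /F u0// a0// mulr1.
have [->|vb] := eqVneq v base; first by rewrite g_base mul1r a_base.
rewrite aS//; apply: (@le_trans _ _ (kstep (fun w => F n * g w) v)).
  by rewrite kstepZ g_harm// mulrC ler_wpM2r ?g_ge0// surv_le.
by apply: kstep_le => // w wV; rewrite mulrC IH.
Qed.

Lemma deep_le1 n v : v \in V -> a n v <= 1.
Proof.
elim: n v => [|n IH] v vV; first by rewrite a0// g_le1.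
have [->|vb] := eqVneq v base; first by rewrite a_base surv_le1.
rewrite aS//; apply: le_trans (kstep_cst ler01 vV); exact: kstep_le.
Qed.

Lemma deep_upper s n v : v \in V -> a (s + n) v <= avoid s v + g v * F n.
Proof.
elim: s v => [|s IH] v vV; have [->|vb] := eqVneq v base.
- by rewrite avoid_base add0r a_base g_base mul1r.
- by rewrite /= (negbTE vb) (le_trans (deep_le1 _ vV))// lerDl mulr_ge0 ?g_ge0 ?surv_ge0.
- by rewrite avoid_base add0r a_base g_base mul1r surv_nincr// leq_addl.
- rewrite addSn aS// avoidS//.
  apply: (@le_trans _ _ (kstep (fun w => avoid s w + F n * g w) v)).
    by apply: kstep_le => // w wV; rewrite [F n * _]mulrC IH.
  by rewrite kstepD lerD2l kstepZ g_harm// mulrC.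
Qed.

(** The excess comes from the time spent before the first visit of [base];
    after it, survival is that of the chain started at [base]. *)
Lemma sum_deep_excess n v : v \in V ->
  \sum_(i < n) (a i v - g v * F i) <= h v.
Proof.
elim: n v => [|n IH] v vV; first by rewrite big_ord0 h_ge0.
have [->|vb] := eqVneq v base.
  by rewrite big1 ?h_ge0// => i _; rewrite a_base g_base mul1r subrr.
apply: le_trans (h_super vV vb); rewrite big_ord_recl /= a0// /F u0// mulr1 subrr add0r.
rewrite (eq_bigr (fun i : 'I_n => kstep (fun w => a i w - g w * F i) v + g v * (F i - F i.+1))); last first.
  move=> i _; rewrite /bump /= add1n aS// kstepB.
  rewrite (_ : kstep (fun w => g w * F i) v = g v * F i).
    by rewrite mulrBr addrA subrK.
  rewrite -[in RHS]g_harm// [RHS]mulrC -kstepZ.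
  by apply: eq_bigr => w _; rewrite [g w * _]mulrC.
rewrite big_split /= addrC; apply: lerD.
  rewrite -mulr_sumr -(big_mkord xpredT (fun i => F i - F i.+1)).
  rewrite (_ : \sum_(0 <= i < n) _ = F 0 - F n); last first.
    elim: n {IH} => [|n IH]; first by rewrite big_geq ?subrr.
    by rewrite big_nat_recr //= IH addrA subrK.
  rewrite /F u0//; apply: le_trans (g_le1 vV).
  by rewrite ler_piMr ?g_ge0// lerBlDr lerDl surv_ge0.
rewrite /kstep exchange_big /= big_seq [leRHS]big_seq ler_sum// => w wV.
by rewrite -mulr_sumr ler_wpM2l ?k_ge0 ?IH.
Qed.

(** Up to normalisation, [G] is the Green function of the killed chain started
    at [base]; it is used through its duality with the kernel. *)
Variable G : T -> R.
Hypothesis G_ge0 : forall v, v \in V -> 0 <= G v.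
Hypothesis G_green : forall f : T -> R,
  \sum_(v <- V) G v * (f v - kstep f v) = f base.

Let A := \sum_(v <- V) G v.
Hypothesis A_gt1 : 1 < A.
(** Averaging the survival probabilities under [G] turns their evolution into
    a scalar recursion, because [G] is invariant up to a source at [base]. *)
Let I n := (\sum_(v <- V) G v * u n v) / A.

Let A_gt0 : 0 < A. Proof. exact: lt_trans A_gt1. Qed.

Lemma green_surv0 : I 0 = 1.
Proof.
rewrite /I (_ : \sum_(v <- V) _ = A) ?divff ?gt_eqF//.
by rewrite /A big_seq [RHS]big_seq; apply: eq_bigr => v vV; rewrite u0// mulr1.
Qed.

Lemma green_survS n : I n.+1 = I n - F n / A.
Proof.
rewrite /I -mulrBl; congr (_ / _); rewrite /F -(G_green (u n)) -sumrB.
rewrite big_seq [RHS]big_seq; apply: eq_bigr => v vV.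
by rewrite uS// -mulrBr opprB addrC subrK.
Qed.

Lemma green_surv_ge0 n : 0 <= I n.
Proof.
rewrite /I divr_ge0 ?(ltW A_gt0)// big_seq sumr_ge0// => v vV.
by rewrite mulr_ge0 ?G_ge0 ?surv_ge0.
Qed.

Lemma sum_surv n : \sum_(i < n) F i = A * (1 - I n).
Proof.
elim: n => [|n IH]; first by rewrite big_ord0 green_surv0 subrr mulr0.
rewrite big_ord_recr /= IH green_survS.
have A0 : A != 0 by rewrite gt_eqF.
move: (A) A0 (I n) (F n) => A' A0 In Fn; field.
by [].
Qed.

(** [k1] bounds the mass that [G] gives to the failure to visit [base], [H]
    the mean time before [base] or the killing, and [s] is an intermediate
    time, large compared with [H] and small compared with [A]. *)
Variables (k1 H : R) (s : nat).
Hypothesis s_gt0 : (0 < s)%N.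
Hypothesis k1P : A - \sum_(v <- V) G v * g v <= k1 * A.
Hypothesis HP : forall v, v \in V -> G v != 0 -> h v <= H.
Let eta := k1 + s%:R / A + H / s%:R.

Let H_ge0 : 0 <= H.
Proof.
have : A != 0 by rewrite gt_eqF.
apply: contraNT; rewrite -ltNge => H0; rewrite /A big_seq big1// => v vV.
apply/eqP/negP => /negP Gv; have := HP vV Gv.
by move=> /le_lt_trans/(_ H0); rewrite ltNge h_ge0.
Qed.

Let sumG_le f c : 0 <= c -> (forall v, v \in V -> G v != 0 -> f v <= c) ->
  (\sum_(v <- V) G v * f v) / A <= c.
Proof.
move=> c0 fc; rewrite ler_pdivrMr// /A mulr_sumr big_seq [leRHS]big_seq.
apply: ler_sum => v vV; have [->|Gv] := eqVneq (G v) 0; first by rewrite mul0r mulr0.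
by rewrite mulrC ler_wpM2r ?G_ge0 ?fc.
Qed.

(** Started from [G], the chain visits [base] except with probability [k1],
    and from there it survives as [F]. *)
Lemma green_surv_lower n : F n - k1 <= I n.
Proof.
have IL : F n * ((\sum_(v <- V) G v * g v) / A) <= I n.
  rewrite /I mulrA ler_wpM2r ?invr_ge0 ?(ltW A_gt0)// mulr_sumr big_seq [leRHS]big_seq.
  by apply: ler_sum => v vV; rewrite mulrCA ler_wpM2l ?G_ge0// mulrC surv_lower.
apply: le_trans IL.
have k1' : 1 - (\sum_(v <- V) G v * g v) / A <= k1.
  by rewrite -(ler_pM2r A_gt0) mulrBl mul1r divfK ?gt_eqF.
have k10 : 0 <= 1 - (\sum_(v <- V) G v * g v) / A.
  by rewrite subr_ge0 sumG_le// => v vV _; apply: g_le1.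
have F0 : 0 <= F n := surv_ge0 n baseV.
have F1 : F n <= 1 := surv_le1 n baseV.
rewrite lerBlDr -lerBlDl -[X in X - _]mulr1 -mulrBr.
by apply: le_trans k1'; rewrite ler_piMl.
Qed.

(** Once the time [s] has elapsed, the chain has visited [base] or has been
    killed, except with probability [H / s]. *)
Lemma green_surv_upper n : I (s + n) <= F n + H / s%:R.
Proof.
have s0 : 0 < s%:R :> R by rewrite ltr0n.
rewrite /I; apply: sumG_le => [|v vV Gv].
  by rewrite addr_ge0 ?surv_ge0// divr_ge0 ?(ltW s0).
apply: (le_trans (surv_upper s n vV)); rewrite addrC lerD2l ler_pdivlMr// mulrC.
exact: le_trans (avoid_leh s vV) (HP vV Gv).
Qed.

Lemma green_surv_shift n m : I n - m%:R / A <= I (m + n).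
Proof.
elim: m => [|m IH]; first by rewrite mul0r subr0.
rewrite addSn green_survS -natr1 mulrDl opprD addrA lerB//.
by rewrite ler_wpM2r ?invr_ge0 ?(ltW A_gt0)// surv_le1.
Qed.

Lemma k1_ge0 : 0 <= k1.
Proof.
rewrite -(pmulr_lge0 _ A_gt0); apply: le_trans k1P.
rewrite subr_ge0 /A big_seq [leRHS]big_seq ler_sum// => v vV.
by rewrite ler_piMr ?G_ge0 ?g_le1.
Qed.

Lemma surv_green_close n : `|F n - I n| <= eta.
Proof.
have L := green_surv_lower n.
have U : I n - s%:R / A <= F n + H / s%:R.
  exact: le_trans (green_surv_shift n s) (green_surv_upper n).
have s0 : 0 < s%:R :> R by rewrite ltr0n.
have t1 : 0 <= s%:R / A by rewrite divr_ge0 ?(ltW A_gt0)// ltW.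
have t2 : 0 <= H / s%:R by rewrite divr_ge0 ?(ltW s0).
have t3 := k1_ge0.
by rewrite ler_norml /eta; apply/andP; split; lra.
Qed.

Lemma eta_ge0 : 0 <= eta.
Proof. exact: le_trans (surv_green_close 0). Qed.

(** Replacing [F n] by [I n] in the recursion of [I] contributes an error [eta
    / A] at each step, and these errors are contracted by the factor [1 -
    1/A]. *)
Lemma green_surv_geom n : `|I n - (1 - A^-1) ^+ n| <= eta.
Proof.
have A1 : 0 <= A^-1 by rewrite invr_ge0 ltW.
have A2 : 0 <= 1 - A^-1 by rewrite subr_ge0 invf_le1 ?ltW.
elim: n => [|n IH]; first by rewrite green_surv0 subrr normr0 eta_ge0.
have -> : I n.+1 - (1 - A^-1) ^+ n.+1
    = (1 - A^-1) * (I n - (1 - A^-1) ^+ n) - (F n - I n) / A.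
  by rewrite green_survS exprS; ring.
apply: le_trans (ler_normB _ _) _; rewrite !normrM (ger0_norm A2) (ger0_norm A1).
have E := surv_green_close n.
apply: (@le_trans _ _ ((1 - A^-1) * eta + eta * A^-1)); last by rewrite le_eqVlt; apply/orP; left; apply/eqP; ring.
by apply: lerD; [apply: ler_wpM2l|apply: ler_wpM2r].
Qed.

Lemma surv_geom n : `|F n - (1 - A^-1) ^+ n| <= 2 * eta.
Proof.
rewrite -(subrKA (I n)); apply: le_trans (ler_normD _ _) _.
by rewrite mulr_natl mulr2n lerD ?surv_green_close ?green_surv_geom.
Qed.

Lemma deep_geom_lower n v : v \in V ->
  g v * ((1 - A^-1) ^+ n - 2 * eta) <= a n v.
Proof.
move=> vV; apply: le_trans (deep_lower n vV); rewrite ler_wpM2l ?g_ge0//.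
by have := surv_geom n; rewrite ler_norml => /andP[? _]; lra.
Qed.

Lemma deep_geom_upper n v : v \in V -> h v <= H ->
  a (s + n) v <= H / s%:R + g v * ((1 - A^-1) ^+ n + 2 * eta).
Proof.
move=> vV hH; apply: le_trans (deep_upper s n vV) _; apply: lerD.
  by rewrite ler_pdivlMr ?ltr0n// mulrC (le_trans (avoid_leh s vV)).
rewrite ler_wpM2l ?g_ge0//.
by have := surv_geom n; rewrite ler_norml => /andP[_ ?]; lra.
Qed.

Lemma sum_deep_lower n v : v \in V ->
  g v * (A * (1 - eta - (1 - A^-1) ^+ n)) <= \sum_(i < n) a i v.
Proof.
move=> vV; apply: (@le_trans _ _ (g v * \sum_(i < n) F i)).
  rewrite ler_wpM2l ?g_ge0// sum_surv ler_wpM2l ?(ltW A_gt0)//.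
  by have := green_surv_geom n; rewrite ler_norml => /andP[_ ?]; lra.
by rewrite mulr_sumr ler_sum// => i _; exact: deep_lower.
Qed.

Lemma sum_deep_upper n v : v \in V -> \sum_(i < n) a i v <= g v * A + h v.
Proof.
move=> vV; have := sum_deep_excess n vV; rewrite sumrB -mulr_sumr => E.
have : g v * \sum_(i < n) F i <= g v * A.
  rewrite ler_wpM2l ?g_ge0// sum_surv ler_piMr ?(ltW A_gt0)//.
  by rewrite gerBl green_surv_ge0.
by move: E => /[swap] ? ?; lra.
Qed.

End KilledChain.

(** * Plane trees, weights and the deepest leaf *)

Section TreeCombinatorics.
Context {R : realType}.
Implicit Types (t : {fset vertex}) (b : vertex -> R) (u v w z : vertex).

Lemma parent_rcons v j : parent (rcons v j) = v.
Proof. by rewrite /parent size_rcons /= -cats1 take_size_cat. Qed.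

Lemma rcons_parent v : v != [::] -> exists j, v = rcons (parent v) j.
Proof. by case/lastP: v => // v j _; exists j; rewrite parent_rcons. Qed.

Lemma rcons_neq0 v j : rcons v j != [::].
Proof. by case: v. Qed.

Lemma size_parent v : size (parent v) = (size v).-1.
Proof. by rewrite /parent size_take; case: v => //= x v; rewrite leqnn. Qed.

Lemma size_gt0P v : (0 < size v)%N = (v != [::]).
Proof. by case: v. Qed.

Lemma offspringP t v w :
  reflect [/\ w \in t, w != [::] & parent w = v] (w \in offspring t v).
Proof.
rewrite /offspring !inE /=; apply: (iffP idP).
  by move=> /andP[wt /andP[w0 /eqP pw]]; split.
by move=> [-> -> <-]; rewrite eqxx.
Qed.

Lemma offspring_rcons t v j : (rcons v j \in offspring t v) = (rcons v j \in t).
Proof.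
apply/offspringP/idP => [[]//|H].
by split; rewrite ?rcons_neq0 ?parent_rcons.
Qed.

Lemma offspring_sub t v : {subset offspring t v <= t}.
Proof. by move=> w /offspringP[]. Qed.

Lemma offspring_neq0 t v w : w \in offspring t v -> w != [::].
Proof. by case/offspringP. Qed.

Lemma offspring_size t v w : w \in offspring t v -> size w = (size v).+1.
Proof.
by case/offspringP => _ w0 <-; rewrite size_parent prednK// size_gt0P.
Qed.

Lemma parent_notin_offspring t v : parent v \notin offspring t v.
Proof.
apply/negP => /offspring_size; rewrite size_parent; have := leq_pred (size v).
by move=> /[swap] ->; rewrite ltnn.
Qed.

Lemma sum_fsubset (A B : {fset vertex}) (F : vertex -> R) : {subset B <= A} ->
  \sum_(w <- A | w \in B) F w = \sum_(w <- B) F w.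
Proof.
move=> BA; rewrite -big_filter; apply: perm_big; apply: uniq_perm.
- by rewrite filter_uniq ?fset_uniq.
- exact: fset_uniq.
by move=> w; rewrite mem_filter; case: (boolP (w \in B)) => //= /BA.
Qed.

Lemma sum_fsetD1 t (F : vertex -> R) : [::] \in t ->
  \sum_(v <- t) F v = F [::] + \sum_(v <- t | v != [::]) F v.
Proof. by move=> r; rewrite (bigD1_seq [::])// fset_uniq. Qed.

Section PlaneTree.
Variables (t : {fset vertex}).
Hypothesis tP : is_plane_tree t.

Lemma root_in : [::] \in t. Proof. by case: tP. Qed.

Lemma take_in v i : v \in t -> take i v \in t.
Proof.
case: tP => _ cl _; elim/last_ind: v => // v j IH vt.
have [ij|ij] := leqP i (size v).
  by rewrite -cats1 takel_cat//; exact/IH/(cl _ j).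
by rewrite take_oversize// size_rcons.
Qed.

Lemma parent_in v : v \in t -> parent v \in t.
Proof. exact: take_in. Qed.

Lemma sum_offspring (F : vertex -> vertex -> R) (P : pred vertex) :
  \sum_(v <- t | P v) \sum_(w <- offspring t v) F v w
  = \sum_(w <- t | (w != [::]) && P (parent w)) F (parent w) w.
Proof.
under eq_bigr => v _ do rewrite -(@sum_fsubset t _ _ (@offspring_sub t v)).
rewrite (exchange_big_dep predT)//= big_seq_cond [RHS]big_mkcond /= -big_seq_cond.
rewrite [in RHS]big_seq big_seq; apply: eq_bigr => w wt.
have [->|w0] /= := eqVneq w [::].
  by rewrite big1// => v /andP[_ /offspringP[]].
rewrite -big_filter; case: ifP => Pw; last first.
  rewrite big_filter big1// => v /andP[Pv] /offspringP[_ _ pw].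
  by move: Pw; rewrite pw Pv.
rewrite (perm_big [:: parent w]) ?big_seq1//; apply: uniq_perm => //.
  by rewrite filter_uniq ?fset_uniq.
move=> v; rewrite mem_filter mem_seq1; apply/idP/eqP => /=.
  by move=> /andP[/andP[_ /offspringP[_ _ ->]] _].
move=> ->; rewrite Pw parent_in// andbT /=.
exact/offspringP.
Qed.

Lemma sum_descendents z (F : vertex -> R) : z \in t ->
  \sum_(v <- t | prefix z v) F v
  = F z + \sum_(w <- offspring t z) \sum_(v <- t | prefix w v) F v.
Proof.
move=> zt; rewrite big_mkcond (bigD1_seq z) ?fset_uniq//= prefix_refl -big_mkcondr /=.
congr (_ + _).
rewrite (exchange_big_dep predT)//= big_mkcond [LHS]big_seq [RHS]big_seq.
apply: eq_bigr => v vt.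
case: ifP => [/andP[vz zv]|Hn]; last first.
  rewrite big_seq_cond big1// => w /andP[/offspringP[wt w0 pw] wv].
  have [j jE] := rcons_parent w0; rewrite pw in jE.
  have zw : prefix z w by rewrite jE prefix_rcons.
  suff: (v != z) && prefix z v by rewrite Hn.
  rewrite (prefix_trans zw wv) andbT.
  apply: contraTneq wv => ->; apply/negP => /size_prefix.
  by rewrite jE size_rcons ltnn.
set w := take (size z).+1 v.
have szv : (size z < size v)%N.
  rewrite ltn_neqAle size_prefix// andbT; apply: contraNneq vz => e.
  by move: zv; rewrite prefixE e take_size eq_sym => /eqP ->.
have wz : w = rcons z (nth 0%N v (size z)).
  by rewrite /w (take_nth 0%N)//; move: zv; rewrite prefixE => /eqP ->.
have woff : w \in offspring t z.
  by rewrite wz offspring_rcons -wz /w take_in.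
rewrite -big_filter (perm_big [:: w]) ?big_seq1//; apply: uniq_perm => //.
  by rewrite filter_uniq ?fset_uniq.
move=> x; rewrite mem_filter mem_seq1; apply/andP/eqP.
  move=> [xv xo]; have := offspring_size xo => sx.
  by move: xv; rewrite prefixE sx => /eqP <-.
by move=> ->; split => //; rewrite /w prefix_take.
Qed.

End PlaneTree.

Section PathWeight.
Variable b : vertex -> R.

Lemma path_weightxx v : path_weight b v v = 1.
Proof. by rewrite /path_weight big_geq. Qed.

Lemma path_weight_rcons x v j : (size x <= size v)%N ->
  path_weight b x (rcons v j) = path_weight b x v * b (rcons v j).
Proof.
move=> xv; rewrite /path_weight size_rcons big_nat_recr//=.
rewrite [take (size v).+1 _]take_oversize ?size_rcons//; congr (_ * _).
by apply: eq_big_nat => i /andP[_ iv]; rewrite -cats1 takel_cat.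
Qed.

Lemma path_weight_parent x v : (size x < size v)%N ->
  path_weight b x v = path_weight b x (parent v) * b v.
Proof.
case/lastP: v => // v j; rewrite size_rcons ltnS parent_rcons.
exact: path_weight_rcons.
Qed.

Lemma path_weight_trans x y v : (size x <= size y)%N -> prefix y v ->
  path_weight b x v = path_weight b x y * path_weight b y v.
Proof.
move=> xy yv; have syv := size_prefix yv.
rewrite /path_weight (big_cat_nat (n := size y))//=; congr (_ * _).
apply: eq_big_nat => i /andP[_ iy]; congr (b _).
by move: yv; rewrite prefixE => /eqP <-; rewrite take_takel.
Qed.

Lemma path_weight_cons i x v :
  path_weight b (i :: x) (i :: v) = path_weight (b \o cons i) x v.
Proof. by rewrite /path_weight /= big_add1. Qed.

Lemma path_weight_gt0 x v :
  (forall i, (size x <= i < size v)%N -> 0 < b (take i.+1 v)) -> 0 < path_weight b x v.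
Proof.
by move=> b0; rewrite /path_weight big_nat prodr_gt0// => i /b0.
Qed.

End PathWeight.

(** Path weights are counted from [z], so that the root yields [tree_weight]
    and [vchild t] yields [omega_star]. *)
Definition sub_weight t b z : R := \sum_(v <- t | prefix z v) path_weight b z v.

Lemma sum_descendent_tree t z (F : vertex -> R) :
  \sum_(v <- descendent_tree t z) F v = \sum_(v <- t | prefix z v) F v.
Proof.
rewrite -(@sum_fsubset t); last by move=> w; rewrite !inE /= => /andP[].
rewrite big_seq_cond [RHS]big_seq_cond; apply: eq_bigl => v.
by rewrite !inE; case: (v \in t).
Qed.

Lemma omega_starE t b : omega_star t b = sub_weight t b (vchild t).
Proof. exact: sum_descendent_tree. Qed.

Lemma tree_weightE t b : tree_weight t b = sub_weight t b [::].
Proof. by apply: eq_bigl => v; rewrite prefix0s. Qed.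

Lemma sub_weight_rec t b z : is_plane_tree t -> z \in t ->
  sub_weight t b z = 1 + \sum_(w <- offspring t z) b w * sub_weight t b w.
Proof.
move=> tP zt; rewrite /sub_weight sum_descendents// path_weightxx; congr (_ + _).
rewrite big_seq [RHS]big_seq; apply: eq_bigr => w wo.
rewrite mulr_sumr; apply: eq_bigr => v wv.
have [wt w0 pw] := offspringP _ _ _ wo; have sw := offspring_size wo.
rewrite (@path_weight_trans b z w v) ?sw ?leqnSn//.
by rewrite path_weight_parent ?sw// pw path_weightxx mul1r.
Qed.

(** Mean hitting times and resistances are determined by their increments
    along the edges; the edge between [v] and its parent is designated by [v]. *)
Definition path_sum (D : vertex -> R) v : R := \sum_(i < size v) D (take i.+1 v).

Lemma path_sum0 D : path_sum D [::] = 0.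
Proof. by rewrite /path_sum big_ord0. Qed.

Lemma path_sum_rcons D v j :
  path_sum D (rcons v j) = path_sum D v + D (rcons v j).
Proof.
rewrite /path_sum size_rcons big_ord_recr /=; congr (_ + D _).
  by apply: eq_bigr => i _; rewrite -cats1 takel_cat.
by rewrite take_oversize ?size_rcons.
Qed.

Lemma path_sum_parent D v : v != [::] ->
  path_sum D v = path_sum D (parent v) + D v.
Proof. by case/lastP: v => // v j _; rewrite path_sum_rcons parent_rcons. Qed.

Lemma path_sum_offspring D t v w : w \in offspring t v ->
  path_sum D w = path_sum D v + D w.
Proof. by case/offspringP => _ w0 <-; exact: path_sum_parent. Qed.

Lemma height_geq t v : v \in t -> (size v <= height t)%N.
Proof. by move=> vt; rewrite /height (big_rem v)//= leq_maxl. Qed.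

Lemma vbase_spec t : [::] \in t ->
  [/\ vbase t \in t, size (vbase t) = height t &
   forall v, v \in t -> size v = height t -> (vbase t : seqlexi nat) <= v]%O.
Proof.
move=> rt.
pose A := [fset v in t | size v == height t]%fset.
have [v0 v0A] : exists v, v \in A.
  have : exists2 v, v \in t & size v = height t.
    rewrite /height.
    have : forall s : seq vertex, s != [::] ->
        exists2 v, v \in s & size v = (\max_(v <- s) size v)%N.
      elim=> // x s IH _; have [->|s0] := eqVneq s [::].
        by exists x; rewrite ?big_seq1 ?mem_head.
      have [v vs vE] := IH s0; rewrite big_cons.
      case: (leqP (size x) (\max_(v <- s) size v)%N) => H.
        by exists v; rewrite ?inE ?vs ?orbT// vE; apply/esym/maxn_idPr.
      by exists x; rewrite ?mem_head//; apply/esym/maxn_idPl/ltnW.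
    apply; apply/eqP => t0; have : [::] \in enum_fset t by exact: rt.
    by rewrite t0.
  by move=> [v vt sv]; exists v; rewrite !inE vt sv eqxx.
pose s := sort (fun u v : seqlexi nat => (u <= v)%O) A.
have ss : sorted (fun u v : seqlexi nat => (u <= v)%O) s.
  by apply: sort_sorted; exact: le_total.
have : v0 \in s by rewrite mem_sort.
rewrite /vbase -/A -/s.
have sA v : v \in s -> v \in A by rewrite mem_sort.
have As v : v \in A -> v \in s by rewrite mem_sort.
case: s ss sA As => // x s ss sA As _ /=.
have : x \in A by apply: sA; rewrite mem_head.
rewrite !inE /= => /andP[xt /eqP sx]; split=> // v vt sv.
have : v \in x :: s by apply: As; rewrite !inE vt sv eqxx.
rewrite inE => /predU1P[->//|vs].
have /allP := order_path_min le_trans ss.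
exact.
Qed.

Lemma vbase_in t : [::] \in t -> vbase t \in t.
Proof. by case/vbase_spec. Qed.

Lemma size_vbase t : [::] \in t -> size (vbase t) = height t.
Proof. by case/vbase_spec. Qed.

End TreeCombinatorics.

(** * Potential theory of the biased walk *)

Section TreePotential.
Context {R : realType}.
Variables (t : {fset vertex}) (b : vertex -> R) (q : R).
Hypothesis tP : is_plane_tree t.
Hypothesis q_gt1 : 1 < q.
Hypothesis b_geq : forall v, v \in t -> v != [::] -> q <= b v.
Hypothesis t_gt1 : (0 < height t)%N.

Definition nonroot (t0 : {fset vertex}) : {fset vertex} :=
  [fset v in t0 | v != [::]]%fset.

Lemma nonrootP t0 v : (v \in nonroot t0) = (v \in t0) && (v != [::]).
Proof. by rewrite !inE. Qed.

Lemma sum_nonroot t0 (F : vertex -> R) :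
  \sum_(v <- nonroot t0) F v = \sum_(v <- t0 | v != [::]) F v.
Proof.
rewrite -(@sum_fsubset _ t0); last by move=> w; rewrite nonrootP => /andP[].
rewrite big_seq_cond [RHS]big_seq_cond; apply: eq_bigl => v.
by rewrite nonrootP; case: (v \in t0).
Qed.

Local Notation base := (vbase t).
Local Notation vc := (vchild t).
Local Notation V := (nonroot t).
Let rt : [::] \in t := root_in tP.

Let q0 : 0 < q. Proof. exact: lt_trans q_gt1. Qed.

Lemma bias_gt0 v : v \in t -> v != [::] -> 0 < b v.
Proof. by move=> vt v0; exact: lt_le_trans q0 (b_geq vt v0). Qed.

Lemma base_in : base \in t. Proof. exact: vbase_in. Qed.

Lemma size_base_gt0 : (0 < size base)%N. Proof. by rewrite size_vbase. Qed.

Lemma base_neq0 : base != [::]. Proof. by rewrite -size_gt0P size_base_gt0. Qed.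

Lemma vchild_in : vc \in t. Proof. exact/take_in/base_in. Qed.

Lemma size_vchild : size vc = 1%N.
Proof. by rewrite /vchild size_takel ?size_base_gt0. Qed.

Lemma vchild_neq0 : vc != [::]. Proof. by rewrite -size_gt0P size_vchild. Qed.

Lemma prefix_vchild_base : prefix vc base. Proof. exact: prefix_take. Qed.

Lemma take1_vchild v : prefix vc v -> take 1 v = vc.
Proof. by rewrite prefixE size_vchild => /eqP. Qed.

Lemma take1_ancestor v : v != [::] -> prefix v base -> take 1 v = vc.
Proof.
rewrite -size_gt0P prefixE => v0 /eqP <-.
by rewrite take_takel.
Qed.

(** The conductance of the edge below [v], normalised separately in each
    subtree of the root; this is consistent because the walk is killed at the
    root. *)
Definition conduct v : R := path_weight b (take 1 v) v.

Definition child_bias v : R := \sum_(x <- offspring t v) b x.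

Lemma child_bias_ge0 v : 0 <= child_bias v.
Proof.
rewrite /child_bias big_seq sumr_ge0// => x /offspringP[xt x0 _].
exact: ltW (bias_gt0 xt x0).
Qed.

Lemma path_weight_pos x v : v \in t -> 0 < path_weight b x v.
Proof.
move=> vt; apply: path_weight_gt0 => i /andP[_ iv].
by rewrite bias_gt0 ?take_in// -size_gt0P size_take; case: ifP => //; case: v iv {vt}.
Qed.

Lemma conduct_gt0 v : v \in t -> 0 < conduct v.
Proof. exact: path_weight_pos. Qed.

Lemma conduct_offspring v w : v != [::] -> w \in offspring t v ->
  conduct w = conduct v * b w.
Proof.
move=> v0 /offspringP[_ w0 pw]; have [j jE] := rcons_parent w0.
rewrite pw in jE; rewrite /conduct jE -[in take 1 (rcons _ _)]cats1 takel_cat ?size_gt0P//.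
by rewrite path_weight_rcons// size_take_min geq_minr.
Qed.

Lemma conduct_vchild : conduct vc = 1.
Proof. by rewrite /conduct take_oversize ?size_vchild// path_weightxx. Qed.

Let kQ := kstep V (walk_kernel t b).

Lemma kernel_ge0 v w : v \in t -> 0 <= walk_kernel t b v w.
Proof.
move=> vt; rewrite /walk_kernel; have Z0 := child_bias_ge0 v.
have bw : w \in offspring t v -> 0 <= b w.
  by move=> /offspringP[wt w0 _]; exact: ltW (bias_gt0 wt w0).
case: ifP => _; case: ifP => [H|_]//; rewrite ?divr_ge0 ?bw ?invr_ge0 ?addr_ge0//.
by case: ifP => [H2|_]//; rewrite divr_ge0 ?bw ?addr_ge0.
Qed.

Lemma kstep_walk (f : vertex -> R) v : v \in V ->
  (1 + child_bias v) * kQ f v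
  = (if parent v == [::] then 0 else f (parent v))
    + \sum_(w <- offspring t v) b w * f w.
Proof.
rewrite nonrootP => /andP[vt v0]; have Z0 := child_bias_ge0 v.
have Zn : 1 + child_bias v != 0 by rewrite gt_eqF// ltr_wpDr.
rewrite /kQ /kstep mulr_sumr.
under eq_bigr => w _.
  rewrite (_ : _ * _ = (if w == parent v then f w else 0)
                       + (if w \in offspring t v then b w * f w else 0)); last first.
    rewrite /walk_kernel (negbTE v0) -/(child_bias v).
    case: eqVneq => [->|_]; first by rewrite (negbTE (parent_notin_offspring _ _)) addr0 mulVKf.
    case: ifP; rewrite ?mul0r ?mulr0 ?addr0// add0r => _; field.
    exact: Zn.
  over.
rewrite big_split /= -!big_mkcond /=; congr (_ + _); last first.
  by rewrite sum_fsubset// => w /offspringP[wt w0 _]; rewrite nonrootP wt.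
case: ifP => [/eqP ->|p0].
  by rewrite big_seq_cond big1// => w /andP[]; rewrite nonrootP => /andP[_ /negbTE ->].
rewrite -big_filter (perm_big [:: parent v]) ?big_seq1//; apply: uniq_perm => //.
  by rewrite filter_uniq ?fset_uniq.
move=> w; rewrite mem_filter mem_seq1; case: eqVneq => //= ->.
by rewrite nonrootP parent_in// p0.
Qed.

(** Only the edges incident to [v] contribute, because the increments along
    the other edges of the path cancel. *)
Lemma kstep_path_sum D v : v \in V ->
  (1 + child_bias v) * (path_sum D v - kQ (path_sum D) v)
  = D v - \sum_(w <- offspring t v) b w * D w.
Proof.
move=> vV; rewrite mulrBr kstep_walk//.
rewrite (_ : (if _ then _ else _) = path_sum D (parent v)); last first.
  by case: ifP => // /eqP ->; rewrite path_sum0.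
have -> : \sum_(w <- offspring t v) b w * path_sum D w
  = child_bias v * path_sum D v + \sum_(w <- offspring t v) b w * D w.
  rewrite /child_bias mulr_suml -big_split big_seq [RHS]big_seq.
  by apply: eq_bigr => w wo; rewrite (path_sum_offspring _ wo) mulrDr.
have v0 : v != [::] by move: vV; rewrite nonrootP => /andP[].
rewrite [in X in X - _](path_sum_parent _ v0) [in X in _ - (_ + (X + _))](path_sum_parent _ v0).
ring.
Qed.

(** The mean time for the walk to go from a vertex to its parent is twice the
    weight of its subtree minus one; [hit_time v] is thus the mean time to
    reach the root from [v]. *)
Definition dtime v : R := 2 * sub_weight t b v - 1.
Definition hit_time := path_sum dtime.

(** Edges off the spine carry no current, so that [resist v] is the resistance
    between the root and the last common ancestor of [v] and of the deepest
    leaf. *)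
Definition dresist v : R := (prefix v base)%:R / conduct v.
Definition resist := path_sum dresist.

Lemma kstep_hit_time v : v \in V -> kQ hit_time v = hit_time v - 1.
Proof.
move=> vV; have Z0 := child_bias_ge0 v.
have Zp : 0 < 1 + child_bias v by rewrite ltr_wpDr.
apply: (@mulfI _ (1 + child_bias v)); first by rewrite gt_eqF.
have := kstep_path_sum dtime vV; rewrite -/hit_time.
rewrite (_ : \sum_(w <- _) _ = 2 * (sub_weight t b v - 1) - child_bias v).
  rewrite /dtime mulrBr => E; lra.
have vt : v \in t by move: vV; rewrite nonrootP => /andP[].
rewrite (sub_weight_rec b tP vt) [1 + _]addrC addrK mulr_sumr /child_bias -sumrB.
by apply: eq_bigr => w _; rewrite /dtime; ring.
Qed.

Lemma prefix_base_rec v : v \in t -> (prefix v base)%:R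
  = (v == base)%:R + \sum_(w <- offspring t v) (prefix w base)%:R :> R.
Proof.
have E z : \sum_(v <- t | prefix z v) (v == base)%:R = (prefix z base)%:R :> R.
  rewrite big_mkcond (bigD1_seq base) ?fset_uniq ?base_in//= eqxx big1 ?addr0.
    by case: ifP.
  by move=> w /negbTE ->; rewrite if_same.
move=> vt; rewrite -E sum_descendents//; congr (_ + _).
by apply: eq_bigr => w _; rewrite E.
Qed.

(** The gradient of [resist] times the conductance is a unit current along the
    spine; it has no source between the root and the deepest leaf. *)
Lemma kstep_resist v : v \in V -> v != base -> kQ resist v = resist v.
Proof.
move=> vV vb; have Z0 := child_bias_ge0 v.
have Zp : 0 < 1 + child_bias v by rewrite ltr_wpDr.
apply/esym/eqP; rewrite -subr_eq0 -(mulrI_eq0 _ (mulfI (lt0r_neq0 Zp))).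
rewrite kstep_path_sum//; move: vV; rewrite nonrootP => /andP[vt v0].
rewrite /dresist prefix_base_rec// (negbTE vb) add0r mulr_suml -sumrB.
rewrite big_seq big1// => w wo; rewrite (conduct_offspring v0 wo).
have [wt w0 _] := offspringP _ _ _ wo.
have bw := bias_gt0 wt w0; have cv := conduct_gt0 vt.
by field; rewrite !gt_eqF.
Qed.

Lemma sum_ancestors x (F : vertex -> R) : x \in t ->
  path_sum F x = \sum_(v <- t | (v != [::]) && prefix v x) F v.
Proof.
move=> xt; rewrite /path_sum -(big_mkord xpredT (fun i => F (take i.+1 x))) /index_iota subn0.
rewrite -[LHS](big_map (fun i => take i.+1 x) xpredT) -[RHS]big_filter.
apply: perm_big; apply: uniq_perm.
- rewrite map_inj_in_uniq ?iota_uniq// => i j; rewrite !mem_iota !add0n /= => il jl.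
  by move=> /(congr1 size); rewrite !size_takel// => -[].
- by rewrite filter_uniq ?fset_uniq.
move=> v; rewrite mem_filter; apply/mapP/andP => [[i il ->]|[/andP[v0 vx] vt]].
  rewrite mem_iota add0n /= in il; rewrite prefix_take take_in//.
  by rewrite -size_gt0P size_takel.
exists (size v).-1; last by rewrite prednK ?size_gt0P//; move: vx; rewrite prefixE => /eqP.
by rewrite mem_iota add0n /= prednK ?size_gt0P// size_prefix.
Qed.

(** The common ancestors of [x] and of the deepest leaf are among the
    ancestors of the latter. *)
Lemma path_sum_meet_le x (F : vertex -> R) : x \in t ->
  (forall v, v \in t -> v != [::] -> prefix v base -> 0 <= F v) ->
  path_sum (fun v => (prefix v base)%:R * F v) x <= path_sum F base.
Proof.
move=> xt F0; rewrite !sum_ancestors ?base_in//.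
rewrite big_mkcond [leRHS]big_mkcond big_seq [leRHS]big_seq ler_sum// => v vt.
have [->|v0] //= := eqVneq v [::]; case: (boolP (prefix v base)) => vb.
  by case: ifP => _; rewrite ?mul1r// F0.
by rewrite mul0r if_same.
Qed.

Lemma path_sum_ge0 x (F : vertex -> R) : x \in t ->
  (forall v, v \in t -> v != [::] -> 0 <= F v) -> 0 <= path_sum F x.
Proof.
move=> xt F0; rewrite sum_ancestors// big_seq_cond sumr_ge0// => v.
by move=> /andP[vt /andP[v0 _]]; exact: F0.
Qed.

Lemma eq_path_sum x (F F' : vertex -> R) : x \in t ->
  (forall v, v \in t -> v != [::] -> prefix v x -> F v = F' v) ->
  path_sum F x = path_sum F' x.
Proof.
move=> xt FF'; rewrite !sum_ancestors// big_seq_cond [RHS]big_seq_cond.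
by apply: eq_bigr => v /andP[vt /andP[v0 vx]]; exact: FF'.
Qed.

Lemma path_sum_lin (c1 c2 : R) (F F' : vertex -> R) x :
  path_sum (fun v => c1 * F v + c2 * F' v) x = c1 * path_sum F x + c2 * path_sum F' x.
Proof. by rewrite /path_sum big_split /= !mulr_sumr. Qed.

Lemma resist_ge0 v : v \in t -> 0 <= resist v.
Proof.
move=> vt; apply: path_sum_ge0 => // x xt x0.
by rewrite divr_ge0 ?ler0n ?(ltW (conduct_gt0 xt)).
Qed.

Lemma resist_base : resist base = path_sum (fun v => (conduct v)^-1) base.
Proof.
by apply: eq_path_sum; rewrite ?base_in// => v _ _ vb; rewrite /dresist vb mul1r.
Qed.

Lemma resist_le v : v \in t -> resist v <= resist base.
Proof.
move=> vt; rewrite resist_base; apply: path_sum_meet_le => // x xt _ _.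
by rewrite invr_ge0 ltW ?conduct_gt0.
Qed.

Lemma resist_vchild : resist vc = 1.
Proof.
rewrite /resist /path_sum size_vchild big_ord1 /= /dresist take_oversize ?size_vchild//.
by rewrite prefix_vchild_base conduct_vchild divr1.
Qed.

Lemma resist_ge1 : 1 <= resist base.
Proof. by rewrite -resist_vchild resist_le ?vchild_in. Qed.

Lemma resist_out v : v \in t -> ~~ prefix vc v -> resist v = 0.
Proof.
move=> vt vcv; rewrite /resist sum_ancestors// big_seq_cond big1// => x.
move=> /andP[xt /andP[x0 xv]]; rewrite /dresist.
case: (boolP (prefix x base)) => xb; last by rewrite mul0r.
case/negP: vcv; apply: prefix_trans xv; rewrite -(take1_ancestor x0 xb).
exact: prefix_take.
Qed.

(** By reversibility, the Green function from the deepest leaf is the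
    reversible measure [conduct v * (1 + child_bias v)] times the potential
    that is harmonic away from the leaf and zero at the root. *)
Definition green v : R := conduct v * (1 + child_bias v) * resist v.

Lemma green_ge0 v : v \in V -> 0 <= green v.
Proof.
rewrite nonrootP => /andP[vt _]; rewrite /green !mulr_ge0 ?resist_ge0//.
  by rewrite ltW ?conduct_gt0.
by rewrite addr_ge0 ?child_bias_ge0.
Qed.

(** Summation by parts along the edges: the current of [resist] is one on the
    spine and zero elsewhere, so the gradients of [f] telescope along the
    spine. *)
Lemma green_identity (f : vertex -> R) :
  \sum_(v <- V) green v * (f v - kQ f v) = f base.
Proof.
pose f0 v := if v == [::] then 0 else f v.
pose phi w := conduct w * (f0 w - f0 (parent w)).
have -> : \sum_(v <- V) green v * (f v - kQ f v)
  = \sum_(v <- V) (resist v * phi v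
      - \sum_(w <- offspring t v) resist (parent w) * phi w).
  rewrite big_seq [RHS]big_seq; apply: eq_bigr => v vV.
  rewrite (_ : green v * _ = resist v * (conduct v
    * ((1 + child_bias v) * f v - (1 + child_bias v) * kQ f v))); last by rewrite /green; ring.
  rewrite kstep_walk//.
  have [vt v0] : v \in t /\ v != [::] by move: vV; rewrite nonrootP => /andP[].
  have -> : \sum_(w <- offspring t v) resist (parent w) * phi w
    = resist v * (conduct v * (\sum_(w <- offspring t v) b w * f w - child_bias v * f v)).
    have -> : child_bias v * f v = \sum_(w <- offspring t v) b w * f v by exact: mulr_suml.
    rewrite -sumrB !mulr_sumr big_seq [RHS]big_seq.
    apply: eq_bigr => w wo; have [_ w0 pw] := offspringP _ _ _ wo.
    by rewrite /phi pw (conduct_offspring v0 wo) /f0 (negbTE w0) (negbTE v0); ring.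
  rewrite /phi -/(f0 (parent v)) [in RHS]/f0 (negbTE v0) /f0; ring.
rewrite sumrB !sum_nonroot sum_offspring//.
have -> : \sum_(w <- t | (w != [::]) && (parent w != [::])) resist (parent w) * phi w
  = \sum_(w <- t | w != [::]) resist (parent w) * phi w.
  rewrite [RHS](bigID (fun w => parent w == [::]))/= [X in _ = X + _]big1 ?add0r//.
  by move=> w /andP[_ /eqP ->]; rewrite /resist path_sum0 mul0r.
rewrite -sumrB.
have -> : \sum_(w <- t | w != [::]) (resist w * phi w - resist (parent w) * phi w)
  = \sum_(w <- t | (w != [::]) && prefix w base) (f0 w - f0 (parent w)).
  rewrite big_mkcondr big_seq_cond [RHS]big_seq_cond; apply: eq_bigr => w /andP[wt w0].
  rewrite -mulrBl /resist (path_sum_parent _ w0) addrC addKr /dresist /phi.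
  have cw := conduct_gt0 wt; case: (prefix w base); last by rewrite !mul0r.
  by rewrite mul1r mulKf ?gt_eqF.
rewrite -sum_ancestors ?base_in//.
have E x : path_sum (fun v => f0 v - f0 (parent v)) x = f0 x.
  elim/last_ind: x => [|x j IH]; first by rewrite path_sum0.
  by rewrite path_sum_rcons IH parent_rcons addrC subrK.
by rewrite E /f0 (negbTE base_neq0).
Qed.

Lemma sum_green : \sum_(v <- V) green v = hit_time base.
Proof.
rewrite -(green_identity hit_time) big_seq [RHS]big_seq; apply: eq_bigr => v vV.
by rewrite kstep_hit_time// opprB addrC subrK mulr1.
Qed.

Local Notation omega := (omega_star t b).

Lemma omega_gt0 : 0 < omega.
Proof.
rewrite omega_starE (sub_weight_rec b tP vchild_in) ltr_wpDr// big_seq sumr_ge0// => w.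
move=> /offspringP[wt w0 _]; rewrite mulr_ge0 ?(ltW (bias_gt0 wt w0))//.
by rewrite /sub_weight big_seq_cond sumr_ge0// => v /andP[vt _]; rewrite ltW ?path_weight_pos.
Qed.

Lemma sub_weight_ge0 z : 0 <= sub_weight t b z.
Proof.
by rewrite /sub_weight big_seq_cond sumr_ge0// => v /andP[vt _]; rewrite ltW ?path_weight_pos.
Qed.

Lemma sub_weight_ge1 z : z \in t -> 1 <= sub_weight t b z.
Proof.
move=> zt; rewrite (sub_weight_rec b tP zt) lerDl big_seq sumr_ge0// => w.
by move=> /offspringP[wt w0 _]; rewrite mulr_ge0 ?(ltW (bias_gt0 wt w0))// sub_weight_ge0.
Qed.

(** Each edge of the subtree of [vc] is counted at most once from each of its
    ends. *)
Lemma sum_conduct_le :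
  \sum_(v <- V | prefix vc v) conduct v * (1 + child_bias v) <= 2 * omega.
Proof.
have cE v : prefix vc v -> conduct v = path_weight b vc v.
  by move=> vcv; rewrite /conduct take1_vchild.
have vc0 v : prefix vc v -> v != [::].
  by move=> /size_prefix; rewrite size_vchild size_gt0P.
have step (F : vertex -> R) : \sum_(v <- V | prefix vc v) F v = \sum_(v <- t | prefix vc v) F v.
  rewrite -big_filter -[RHS]big_filter; apply: perm_big; apply: uniq_perm.
  - by rewrite filter_uniq ?fset_uniq.
  - by rewrite filter_uniq ?fset_uniq.
  move=> v; rewrite !mem_filter nonrootP; case: (boolP (prefix vc v)) => // /vc0 ->.
  by rewrite andbT.
rewrite step.
under eq_bigr => v vcv do rewrite mulrDr mulr1 /child_bias mulr_sumr.
rewrite big_split /= mulr_natl mulr2n omega_starE; apply: lerD.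
  by rewrite le_eqVlt; apply/orP; left; apply/eqP; apply: eq_bigr => v /cE.
rewrite (_ : \sum_(v <- t | _) _ = \sum_(v <- t | prefix vc v) \sum_(w <- offspring t v) conduct w).
  rewrite sum_offspring// /sub_weight big_mkcond [leRHS]big_mkcond big_seq [leRHS]big_seq.
  apply: ler_sum => w wt; case: ifP => [/andP[w0 pw]|_].
    have vcw : prefix vc w.
      have [j ->] := rcons_parent w0.
      by apply: (prefix_trans pw); exact: prefix_rcons.
    by rewrite vcw cE.
  by case: ifP => // _; rewrite ltW// path_weight_pos.
apply: eq_bigr => v vcv; rewrite big_seq [RHS]big_seq; apply: eq_bigr => w wo.
by rewrite (conduct_offspring (vc0 _ vcv) wo).
Qed.

End TreePotential.

(** * Weight lost along the spine and mean crossing times *)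

(** Summing the recursion over [i], the sum of [e] appears with the factor [q]
    on one side and with the factor one on the other. *)
Lemma geometric_recursion {R : realFieldType} (q : R) (e s : nat -> R) n :
  1 < q -> e 0%N = 0 -> (forall i, (i <= n)%N -> 0 <= e i /\ 0 <= s i) ->
  (forall i, (i < n)%N -> q * e i.+1 <= e i + s i) ->
  (q - 1) * \sum_(i < n.+1) e i <= \sum_(i < n.+1) s i.
Proof.
move=> q1 e0 pos rec.
have H : forall m, (m <= n)%N ->
    (q - 1) * \sum_(i < m.+1) e i + e m <= \sum_(i < m) s i.
  elim=> [|m IH] mn; first by rewrite big_ord1 big_ord0 e0 mulr0 addr0.
  rewrite big_ord_recr [leRHS]big_ord_recr /= mulrDr.
  have := IH (ltnW mn); have := rec m mn => H1 H2.
  by lra.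
have := H n (leqnn n); have [en sn] := pos n (leqnn n).
rewrite [X in _ -> _ <= X]big_ord_recr /= => H1; lra.
Qed.

Section SpineBounds.
Context {R : realType}.
Variables (t : {fset vertex}) (b : vertex -> R) (q : R).
Hypothesis tP : is_plane_tree t.
Hypothesis q_gt1 : 1 < q.
Hypothesis b_geq : forall v, v \in t -> v != [::] -> q <= b v.
Hypothesis t_gt1 : (0 < height t)%N.

Local Notation base := (vbase t).
Local Notation vc := (vchild t).
Local Notation V := (nonroot t).
Local Notation omega := (omega_star t b).
Local Notation W := (sub_weight t b).
Let rt : [::] \in t := root_in tP.
Let bint : base \in t := vbase_in rt.
Let q0 : 0 < q. Proof. exact: lt_trans q_gt1. Qed.
Let bgt0 := bias_gt0 q_gt1 b_geq.
Let Wge0 := sub_weight_ge0 tP q_gt1 b_geq.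
Let Wge1 := sub_weight_ge1 tP q_gt1 b_geq.
Let cgt0 := conduct_gt0 tP q_gt1 b_geq.

(** The mean time to reach the deepest leaf from [v] for the walk confined to
    the root and the subtree of [vc]. For the walk killed at the root it is
    only a superharmonic majorant ([base_time_super]). *)
Definition base_time v : R :=
  hit_time t b v - hit_time t b base + 2 * omega * (resist t b base - resist t b v).

(** By the commute time identity, the mean times to cross the edge below [v]
    downwards and upwards add up to [2 * omega / conduct b v]; [climb] is the
    time of the crossing towards the deepest leaf. *)
Definition climb v : R := 2 * omega / conduct b v - dtime t b v.

Lemma base_timeE v : v \in t -> base_time v
  = path_sum (fun z => (~~ prefix z base)%:R * dtime t b z) v
    + path_sum climb base - path_sum (fun z => (prefix z base)%:R * climb z) v.
Proof.
move=> vt; rewrite /base_time.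
have -> : path_sum climb base = 2 * omega * resist t b base - hit_time t b base.
  rewrite (resist_base b tP)//.
  rewrite -[hit_time t b base]mul1r -mulNr /hit_time -path_sum_lin.
  by apply: (eq_path_sum tP) => // z _ _ _; rewrite /climb; ring.
have -> : path_sum (fun z => (prefix z base)%:R * climb z) v
  = 2 * omega * resist t b v - path_sum (fun z => (prefix z base)%:R * dtime t b z) v.
  rewrite -[X in _ - X]mul1r -mulNr -path_sum_lin; apply: (eq_path_sum tP) => // z _ _ _.
  by rewrite /climb /dresist; ring.
have -> : hit_time t b v = path_sum (fun z => (~~ prefix z base)%:R * dtime t b z) v
   + path_sum (fun z => (prefix z base)%:R * dtime t b z) v.
  rewrite -[X in X + _]mul1r -[X in _ + X]mul1r -path_sum_lin; apply: (eq_path_sum tP) => // z _ _ _.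
  by case: (prefix z base); rewrite ?mul0r ?mul1r ?mulr0 ?addr0 ?add0r.
ring.
Qed.

Lemma dtime_ge0 z : z \in t -> 0 <= dtime t b z.
Proof. by move=> zt; have := Wge1 zt; rewrite /dtime => ?; lra. Qed.

Lemma conduct_sub_weight_le z : z \in t -> z != [::] -> prefix z base ->
  conduct b z * W z <= omega.
Proof.
move=> zt z0 zb; rewrite omega_starE /conduct (take1_ancestor z0 zb) /sub_weight mulr_sumr.
rewrite big_mkcond [leRHS]big_mkcond big_seq [leRHS]big_seq ler_sum// => v vt.
have vcz : prefix vc z by rewrite -(take1_ancestor z0 zb) prefix_take.
case: ifP => zv; last by case: ifP => _//; rewrite ltW// (path_weight_pos tP q_gt1 b_geq).
by rewrite (prefix_trans vcz zv) -path_weight_trans// size_prefix.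
Qed.

Lemma climb_ge1 z : z \in t -> z != [::] -> prefix z base -> 1 <= climb z.
Proof.
move=> zt z0 zb; rewrite /climb /dtime.
have H : W z <= omega / conduct b z.
  by rewrite ler_pdivlMr ?cgt0// mulrC conduct_sub_weight_le.
by rewrite -mulrA; lra.
Qed.

Lemma base_time_ge0 v : v \in t -> 0 <= base_time v.
Proof.
move=> vt; rewrite base_timeE// subr_ge0; apply: ler_wpDl.
  by apply: (path_sum_ge0 tP) => // x xt x0; rewrite mulr_ge0 ?ler0n ?dtime_ge0.
apply: (path_sum_meet_le tP) => // x xt x0 xb.
exact: le_trans ler01 (climb_ge1 _ _ _).
Qed.

Lemma base_time_super v : v \in V -> v != base ->
  1 + kstep V (walk_kernel t b) base_time v <= base_time v.
Proof.
move=> vV vb; have Z0 := child_bias_ge0 q_gt1 b_geq v.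
have Zp : 0 < 1 + child_bias t b v by rewrite ltr_wpDr.
have [vt v0] : v \in t /\ v != [::] by move: vV; rewrite nonrootP => /andP[].
pose c := 2 * omega * resist t b base - hit_time t b base.
pose f := path_sum (fun z => 1 * dtime t b z + (- (2 * omega)) * dresist t b z).
have fE z : base_time z = c + f z.
  by rewrite /base_time /c /f path_sum_lin /hit_time /resist; ring.
have c0 : 0 <= c.
  by have := base_time_ge0 rt; rewrite fE /f path_sum0 addr0.
have K : kstep V (walk_kernel t b) base_time v <= c + kstep V (walk_kernel t b) f v.
  rewrite (_ : kstep _ _ base_time v = kstep V (walk_kernel t b) (fun=> c) v + kstep V (walk_kernel t b) f v).
    rewrite lerD2r -(ler_pM2l Zp) (kstep_walk tP q_gt1 b_geq)//.
    rewrite -mulr_suml -/(child_bias t b v) mulrDl mul1r lerD2r.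
    by case: ifP.
  by rewrite -kstepD; apply: eq_bigr => w _; rewrite fE.
rewrite fE; apply: le_trans (_ : 1 + (c + kstep V (walk_kernel t b) f v) <= _).
  by rewrite lerD2l.
rewrite addrCA lerD2l.
have E1 : f v = hit_time t b v - 2 * omega * resist t b v.
  by rewrite /f path_sum_lin mul1r mulNr.
have E2 : kstep V (walk_kernel t b) f v = (hit_time t b v - 1) - 2 * omega * resist t b v.
  rewrite -(kstep_hit_time tP q_gt1 b_geq)// -(kstep_resist tP q_gt1 b_geq vV vb).
  rewrite -kstepZ -kstepB; apply: eq_bigr => w _.
  by rewrite /f path_sum_lin mul1r mulNr.
by rewrite E1 E2; lra.
Qed.

(** The weight above [z] that is not above the next vertex of the spine. It
    contains the vertex [z] itself. *)
Definition spine_loss z : R :=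
  W z - \sum_(w <- offspring t z | prefix w base) b w * W w.

Lemma spine_lossE z : z \in t -> spine_loss z
  = 1 + \sum_(w <- offspring t z | ~~ prefix w base) b w * W w.
Proof.
move=> zt; rewrite /spine_loss sub_weight_rec// (bigID (fun w => prefix w base)) /=.
ring.
Qed.

Lemma bW_ge0 z w : w \in offspring t z -> 0 <= b w * W w.
Proof. by move=> /offspringP[wt w0 _]; rewrite mulr_ge0 ?Wge0// ltW ?bgt0. Qed.

Lemma spine_loss_ge1 z : z \in t -> 1 <= spine_loss z.
Proof.
move=> zt; rewrite spine_lossE// lerDl big_seq_cond sumr_ge0// => w /andP[wo _].
exact: bW_ge0 wo.
Qed.

Lemma spine_loss_le z : z \in t -> spine_loss z <= W z.
Proof.
move=> zt; rewrite /spine_loss gerBl big_seq_cond sumr_ge0// => w /andP[wo _].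
exact: bW_ge0 wo.
Qed.

Lemma sub_weight_off_spine v : v \in t -> v != [::] -> ~~ prefix v base ->
  q * W v <= spine_loss (parent v).
Proof.
move=> vt v0 vb; have vo : v \in offspring t (parent v) by apply/offspringP.
rewrite spine_lossE ?(parent_in tP)// -big_filter.
have vf : v \in [seq w <- offspring t (parent v) | ~~ prefix w base] by rewrite mem_filter vb.
rewrite (bigD1_seq v) ?filter_uniq ?fset_uniq//= addrA ler_wpDr//.
  rewrite big_seq_cond sumr_ge0// => w /andP[]; rewrite mem_filter => /andP[_ wo] _.
  exact: bW_ge0 wo.
by rewrite ler_wpDl// ler_wpM2r ?Wge0 ?b_geq.
Qed.

Lemma sub_weight_child v : v \in t -> v != [::] -> q * W v <= W (parent v).
Proof.
move=> vt v0; have vo : v \in offspring t (parent v) by apply/offspringP.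
rewrite [leRHS]sub_weight_rec ?(parent_in tP)// (bigD1_seq v) ?fset_uniq//= addrCA ler_wpDr//.
  rewrite addr_ge0// big_seq_cond sumr_ge0// => w /andP[wo _]; exact: bW_ge0 wo.
by rewrite ler_wpM2r ?Wge0 ?b_geq.
Qed.

Definition total_loss : R := path_sum spine_loss base.

Lemma sum_spine_offspring i (F : vertex -> R) : (i < size base)%N ->
  \sum_(w <- offspring t (take i base) | prefix w base) F w = F (take i.+1 base).
Proof.
move=> ib; rewrite -big_filter (perm_big [:: take i.+1 base]) ?big_seq1//.
apply: uniq_perm => //; first by rewrite filter_uniq ?fset_uniq.
move=> w; rewrite mem_filter mem_seq1; apply/andP/eqP => [[wb wo]|->].
  have := offspring_size wo; rewrite size_takel ?(ltnW ib)// => sw.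
  by move: wb; rewrite prefixE sw => /eqP.
rewrite prefix_take; split=> //; rewrite (take_nth 0%N)// offspring_rcons -take_nth//.
exact: (take_in tP).
Qed.

(** Going up the spine, the crossing times satisfy a recursion which is
    contracted by the bias, at least [q], and fed by the losses. *)
Lemma climb_spine : (q - 1) * \sum_(i < size base) (climb (take i.+1 base) - 1)
  <= 2 * total_loss.
Proof.
have sb := size_base_gt0 tP t_gt1.
rewrite /total_loss /path_sum -(prednK sb) [2 * _]mulr_sumr.
have tk i : (i < size base)%N -> [/\ take i.+1 base \in t, take i.+1 base != [::] & prefix (take i.+1 base) base].
  by move=> ib; rewrite (take_in tP) ?prefix_take// -size_gt0P size_takel.
apply: (@geometric_recursion _ q (fun i => climb (take i.+1 base) - 1) (fun i => 2 * spine_loss (take i.+1 base))) => //.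
- by rewrite /climb /dtime -/vc (conduct_vchild b tP t_gt1) omega_starE divr1; ring.
- move=> i ib; have ib' : (i < size base)%N by rewrite -(prednK sb) ltnS.
  have [vt v0 vb] := tk i ib'.
  by rewrite subr_ge0 climb_ge1// mulr_ge0// (le_trans ler01)// spine_loss_ge1.
move=> i ib; have ib' : (i.+1 < size base)%N by rewrite -(prednK sb) ltnS.
have [vt v0 vb] := tk i (ltnW ib'); have [wt w0 wb] := tk i.+1 ib'.
have wo : take i.+2 base \in offspring t (take i.+1 base).
  by rewrite (take_nth 0%N)// offspring_rcons -take_nth.
have bw := bgt0 wt w0; have cv := cgt0 vt.
apply: (@le_trans _ _ (b (take i.+2 base) * (climb (take i.+2 base) - 1))).
  by rewrite ler_wpM2r ?b_geq// subr_ge0 climb_ge1.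
rewrite /spine_loss sum_spine_offspring// /climb /dtime (conduct_offspring b v0 wo).
rewrite le_eqVlt; apply/orP; left; apply/eqP; field.
by rewrite !gt_eqF.
Qed.

Lemma total_loss_size : (size base)%:R <= total_loss.
Proof.
rewrite /total_loss /path_sum -[X in X%:R]card_ord -sumr_const ler_sum// => i _.
by rewrite spine_loss_ge1// (take_in tP).
Qed.

Lemma path_climb_le : path_sum climb base <= (1 + 2 / (q - 1)) * total_loss.
Proof.
have q10 : 0 < q - 1 by rewrite subr_gt0.
have H := climb_spine; have H2 := total_loss_size.
rewrite sumrB sumr_const card_ord -/(path_sum climb base) in H.
have : path_sum climb base - (size base)%:R <= 2 / (q - 1) * total_loss.
  by rewrite mulrAC ler_pdivlMr// mulrC.
by rewrite mulrDl mul1r; lra.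
Qed.

Lemma spine_loss_total z : z \in t -> z != [::] -> prefix z base -> spine_loss z <= total_loss.
Proof.
move=> zt z0 zb; rewrite /total_loss (sum_ancestors tP)// -big_filter.
rewrite (bigD1_seq z) ?filter_uniq ?fset_uniq//= ?mem_filter ?z0 ?zb//.
rewrite lerDl big_seq_cond sumr_ge0// => w /andP[]; rewrite mem_filter => /andP[_ wt] _.
exact: le_trans ler01 (spine_loss_ge1 wt).
Qed.

(** Along a path that leaves the spine, the time accumulated so far plus a
    multiple [C] of the weight that remains above does not increase, since
    this weight is divided by at least [q] at each step; the constant solves
    [2 + C = q * C]. *)
Lemma bush_time_le v : v \in t -> prefix vc v ->
  path_sum (fun z => (~~ prefix z base)%:R * dtime t b z) v <= 2 / (q - 1) * total_loss.
Proof.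
have q10 : 0 < q - 1 by rewrite subr_gt0.
have S0 : 0 <= total_loss by rewrite (le_trans _ total_loss_size).
pose C := 2 / (q - 1).
have C0 : 0 <= C by rewrite divr_ge0// ltW.
have CE : (2 + C) = q * C by rewrite /C; field; rewrite gt_eqF.
pose off := path_sum (fun z => (~~ prefix z base)%:R * dtime t b z).
have off0 v' : v' \in t -> prefix v' base -> off v' = 0.
  move=> vt' vb; rewrite /off (@eq_path_sum _ _ tP _ _ (fun=> 0)) ?/path_sum ?big1//.
  by move=> x xt x0 xv; rewrite (prefix_trans xv vb) mul0r.
suff H : v \in t -> prefix vc v -> if prefix v base then off v = 0 else off v + C * W v <= C * total_loss.
  move=> vt vcv; rewrite -/(off v); have := H vt vcv; case: ifP => [_ ->|_]; first by rewrite mulr_ge0.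
  by apply: le_trans; rewrite lerDl mulr_ge0 ?Wge0.
elim/last_ind: v => [|v j IH] vt vcv.
  by move: (size_prefix vcv); rewrite (size_vchild tP t_gt1).
case: ifP => vb; first exact: off0.
have vt' : v \in t by case: tP => _ cl _; exact: cl vt.
have WS := sub_weight_child vt (rcons_neq0 v j); rewrite parent_rcons in WS.
have offE : off (rcons v j) = off v + dtime t b (rcons v j).
  by rewrite /off path_sum_rcons vb mul1r.
have vcv' : prefix vc v.
  have v0 : (0 < size v)%N.
    rewrite lt0n; apply: contraFneq vb => /size0nil v0.
    move: vcv; rewrite v0 prefixE (size_vchild tP t_gt1) /= => /eqP ->.
    exact: prefix_take.
  by move: vcv; rewrite !prefixE (size_vchild tP t_gt1) -cats1 takel_cat.
have W0 := Wge0 (rcons v j).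
have W1 : (2 + C) * W (rcons v j) <= C * (q * W (rcons v j)).
  by rewrite CE [q * C]mulrC mulrA.
have := IH vt' vcv'; case: ifP => vb' H.
  rewrite offE H add0r /dtime.
  have := sub_weight_off_spine vt (rcons_neq0 v j); rewrite vb parent_rcons => /(_ isT) WS'.
  have SS : spine_loss v <= total_loss.
    by apply: spine_loss_total => //; rewrite -size_gt0P -(size_vchild tP t_gt1) size_prefix.
  have : C * (q * W (rcons v j)) <= C * total_loss.
    by rewrite ler_wpM2l// (le_trans WS').
  by move=> ?; rewrite mulrDl in W1; lra.
rewrite offE /dtime.
have : C * (q * W (rcons v j)) <= C * W v by rewrite ler_wpM2l.
by move=> ?; rewrite mulrDl in W1; lra.
Qed.

Lemma base_time_le v : v \in t -> prefix vc v \/ v = [::] ->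
  base_time v <= (1 + 4 / (q - 1)) * total_loss.
Proof.
move=> vt vcv; rewrite base_timeE//.
have q10 : 0 < q - 1 by rewrite subr_gt0.
have S0 : 0 <= total_loss by rewrite (le_trans _ total_loss_size).
have P1 : path_sum (fun z => (~~ prefix z base)%:R * dtime t b z) v <= 2 / (q - 1) * total_loss.
  case: vcv => [vcv|->]; first exact: bush_time_le.
  by rewrite path_sum0 mulr_ge0// divr_ge0// ltW.
have P2 := path_climb_le.
have P3 : 0 <= path_sum (fun z => (prefix z base)%:R * climb z) v.
  apply: (path_sum_ge0 tP) => // x xt x0; case: (boolP (prefix x base)) => xb; last by rewrite mul0r.
  by rewrite mul1r (le_trans ler01)// climb_ge1.
have -> : 4 / (q - 1) = 2 / (q - 1) + 2 / (q - 1) by rewrite -mulrDl; congr (_ / _); ring.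
by rewrite !mulrDl mul1r in P2 *; lra.
Qed.

Lemma conduct_spine_geq i : (i < size base)%N -> q ^+ i <= conduct b (take i.+1 base).
Proof.
have tk j : (j < size base)%N -> take j.+1 base \in t /\ take j.+1 base != [::].
  by move=> jb; rewrite (take_in tP)// -size_gt0P size_takel.
elim: i => [|i IH] ib; first by rewrite expr0 -/vc (conduct_vchild b tP t_gt1).
have [wt w0] := tk _ ib; have [vt v0] := tk _ (ltnW ib).
have wo : take i.+2 base \in offspring t (take i.+1 base).
  by rewrite (take_nth 0%N)// offspring_rcons -take_nth.
rewrite (conduct_offspring b v0 wo) exprSr ler_pM ?IH ?b_geq//; last exact: ltnW.
  by rewrite exprn_ge0// ltW.
exact: ltW.
Qed.

(** Along the spine the conductances grow at least as the powers of [q], so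
    the resistances form a convergent series. *)
Lemma resist_base_le : resist t b base <= q / (q - 1).
Proof.
have q10 : 0 < q - 1 by rewrite subr_gt0.
rewrite (resist_base b tP)// /path_sum.
apply: (@le_trans _ _ (\sum_(i < size base) q^-1 ^+ i)).
  apply: ler_sum => i _; rewrite exprVn lef_pV2 ?posrE ?conduct_spine_geq// ?exprn_gt0//.
  by rewrite cgt0// (take_in tP).
have : forall n, (q - 1) * \sum_(i < n) q^-1 ^+ i <= q.
  move=> n; have H : (q - 1) * \sum_(i < n) q^-1 ^+ i = q * (1 - q^-1 ^+ n).
    elim: n => [|n IH]; first by rewrite big_ord0 expr0 subrr !mulr0.
    rewrite big_ord_recr /= mulrDr IH exprS; field.
    by rewrite gt_eqF.
  by rewrite H ler_piMr ?(ltW q0)// gerBl exprn_ge0// invr_ge0 ltW.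
by move=> /(_ (size base)); rewrite mulrC -ler_pdivlMr.
Qed.

Lemma sub_weight_spine_le i : (i < size base)%N ->
  W (take i.+1 base) <= q^-1 ^+ i * omega.
Proof.
move=> ib; rewrite exprVn mulrC ler_pdivlMr ?exprn_gt0//.
have tt : take i.+1 base \in t by rewrite (take_in tP).
have t0 : take i.+1 base != [::] by rewrite -size_gt0P size_takel.
apply: le_trans (conduct_sub_weight_le tt t0 (prefix_take _ _)).
by rewrite mulrC ler_wpM2r ?Wge0 ?conduct_spine_geq.
Qed.

End SpineBounds.

(** * Trajectories and hitting times *)

(** Trajectories must form a pointed type in order to carry the sigma-algebra
    generated by the cylinders. *)
HB.instance Definition _ := isPointed.Build (seq nat) [::].

Definition cylinder (n : nat) (x : nat -> vertex) : set (nat -> vertex) :=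
  [set y | forall i, (i <= n)%N -> y i = x i].

(** Two cylinders are disjoint or nested; with the empty set they form a pi-
    system, on which probability measures are determined. *)
Definition cylinders : set (set (nat -> vertex)) :=
  [set A | A = set0 \/ exists n x, A = cylinder n x].

Definition traj_event (A : set (nat -> vertex)) := <<s cylinders >> A.

Lemma cylinders_setI : setI_closed cylinders.
Proof.
move=> A B [->|[n [x ->]]]; first by left; rewrite set0I.
move=> [->|[m [y ->]]]; first by left; rewrite setI0.
wlog mn : n x m y / (m <= n)%N.
  move=> H; have [mn|/ltnW nm] := leqP m n; first exact: H.
  by rewrite setIC; exact: H.
have [xy|xy] := pselect (forall i, (i <= m)%N -> x i = y i).
  right; exists n, x; apply/seteqP; split=> z /=; first by case.
  by move=> zx; split=> // i im; rewrite zx ?xy// (leq_trans im).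
left; apply/seteqP; split=> z //= -[zx zy]; apply: xy => i im.
by rewrite -zy// zx// (leq_trans im).
Qed.

Lemma traj_event_setI A B : traj_event A -> traj_event B -> traj_event (A `&` B).
Proof. exact: (@measurableI _ (g_sigma_algebraType cylinders)). Qed.

Lemma traj_event_setC A : traj_event A -> traj_event (~` A).
Proof. exact: (@measurableC _ (g_sigma_algebraType cylinders)). Qed.

Lemma traj_event_bigcup (F : nat -> set (nat -> vertex)) :
  (forall n, traj_event (F n)) -> traj_event (\bigcup_n F n).
Proof. exact: (@bigcupT_measurable _ (g_sigma_algebraType cylinders)). Qed.

Lemma traj_event_coord n v : traj_event [set x | x n = v].
Proof.
rewrite (_ : [set x | x n = v] = \bigcup_(s : seq vertex)
   (if nth [::] s n == v then cylinder n (nth [::] s) else set0)).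
  apply: (@countable_bigcupT_measurable _ (g_sigma_algebraType cylinders)) => //.
  move=> s; apply: sub_gen_smallest; case: ifP => _; last by left.
  by right; exists n, (nth [::] s).
apply/seteqP; split=> x /=.
  move=> xn; exists (mkseq x n.+1) => //; rewrite nth_mkseq// xn eqxx => i lin.
  by rewrite nth_mkseq.
by move=> [s _]; case: ifP => [/eqP <-|//] H; exact: H.
Qed.

Definition surviving (n : nat) : set (nat -> vertex) :=
  [set x | forall i, (1 <= i <= n)%N -> x i != [::]].

Lemma surviving0 : surviving 0 = setT.
Proof. by apply/seteqP; split=> // x _ i; case: i. Qed.

Lemma survivingS n :
  surviving n.+1 = [set x | x 1%N != [::] /\ surviving n (fun i => x i.+1)].
Proof.
apply/seteqP; split=> x /=.
  move=> H; split; first exact: H.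
  by move=> i /andP[i1 lin]; apply: H.
move=> [x1 H] [//|[//|i]] /= lin; exact: (H i.+1).
Qed.

Lemma surviving_le m n : (m <= n)%N -> surviving n `<=` surviving m.
Proof. by move=> mn x H i /andP[i1 im]; apply: H; rewrite i1 (leq_trans im). Qed.

Lemma traj_event_neq i v : traj_event [set x | x i != v].
Proof.
rewrite (_ : mkset _ = ~` [set x | x i = v]); first by apply: traj_event_setC; exact: traj_event_coord.
by apply/seteqP; split=> x /= /eqP.
Qed.

Lemma traj_event_surviving n : traj_event (surviving n).
Proof.
elim: n => [|n IH].
  by rewrite surviving0; exact: (@measurableT _ (g_sigma_algebraType cylinders)).
rewrite (_ : surviving n.+1 = surviving n `&` [set x | x n.+1 != [::]]).
  by apply: traj_event_setI => //; exact: traj_event_neq.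
apply/seteqP; split=> x /=.
  move=> H; split; last by apply: H; rewrite ltnS leqnn.
  exact: (surviving_le (leqnSn n)) H.
move=> [H xn] i /andP[i1]; rewrite leq_eqVlt => /orP[/eqP ->//|lin].
by apply: H; rewrite i1.
Qed.

Definition reach_before (v : vertex) : set (nat -> vertex) :=
  \bigcup_m ([set x | x m = v] `&` surviving m).

Lemma traj_event_reach v : traj_event (reach_before v).
Proof.
apply: traj_event_bigcup => m; apply: traj_event_setI.
  exact: traj_event_coord.
exact: traj_event_surviving.
Qed.

Section HittingTimes.
Context {R : realType}.

Lemma hit_root_gt (x : nat -> vertex) n :
  ((n%:R)%:E < hit_root R x)%E <-> surviving n x.
Proof.
split=> [lt i /andP[i1 lin]|S].
  apply/negP => /eqP xi; move: lt; rewrite ltNge => /negP; apply.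
  apply: (@le_trans _ _ (i%:R)%:E); last by rewrite lee_fin ler_nat.
  by apply: ereal_inf_lbound; exists i.
apply: (@lt_le_trans _ _ (n.+1%:R)%:E); first by rewrite lte_fin ltr_nat.
apply: le_ereal_inf_tmp => _ [k [k1 xk] <-]; rewrite lee_fin ler_nat ltnNge.
apply/negP => kn; have := S k; rewrite k1 kn => /(_ isT).
by rewrite xk.
Qed.

Lemma hit_root_gt_real (x : nat -> vertex) (y : R) : 0 <= y ->
  (y%:E < hit_root R x)%E <-> surviving (Num.trunc y) x.
Proof.
move=> y0; have /andP[ty yt] := truncn_itv y0; split=> [lt|S].
  by apply/hit_root_gt; apply: le_lt_trans lt; rewrite lee_fin.
apply: (@lt_le_trans _ _ ((Num.trunc y).+1%:R)%:E); first by rewrite lte_fin.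
apply: le_ereal_inf_tmp => _ [k [k1 xk] <-]; rewrite lee_fin ler_nat ltnNge.
apply/negP => kn; have := S k; rewrite k1 kn => /(_ isT).
by rewrite xk.
Qed.

(** Writing the time as a sum of survival indicators turns its conditional
    mean into a series of survival probabilities. *)
Lemma hit_root_sum (x : nat -> vertex) :
  hit_root R x = (\sum_(0 <= n <oo) (\1_(surviving n) x)%:E)%E.
Proof.
have [[m [m1 xm]]|nohit] := pselect (exists m, (1 <= m)%N /\ x m = [::]); last first.
  have S n : surviving n x.
    by move=> i /andP[i1 _]; apply/eqP => xi; apply: nohit; exists i.
  have -> : hit_root R x = +oo%E.
    apply/eqyP => A A0; apply/ltW; apply: lt_trans (_ : (Num.bound A)%:R%:E < _)%E.
      by rewrite lte_fin archi_boundP// ltW.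
    exact/hit_root_gt.
  apply/esym/eqyP => A A0.
  apply: le_trans (_ : (\sum_(0 <= n < Num.bound A) (\1_(surviving n) x)%:E <= _)%E); last first.
    by apply: nneseries_lim_ge => n _; rewrite lee_fin.
  rewrite (eq_bigr (fun=> 1%:E)); last by move=> n _; rewrite indicE mem_set.
  by rewrite sumEFin sumr_const_nat subn0 lee_fin ltW// archi_boundP// ltW.
pose p := [pred m | (1 <= m)%N && (x m == [::])].
have ex : exists m, p m by exists m; rewrite /= m1 xm /=.
case: (ex_minnP ex) => {m m1 xm} m /andP[m1 /eqP xm] mmin.
have S n : surviving n x <-> (n < m)%N.
  split=> [Sn|nm i /andP[i1 lin]].
    by rewrite ltnNge; apply/negP => mn; have := Sn m; rewrite m1 mn xm => /(_ isT).
  apply/negP => xi; have := mmin i; rewrite /= i1 xi => /(_ isT) mi.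
  by have := leq_trans nm mi; rewrite ltnNge lin.
have -> : hit_root R x = m%:R%:E.
  apply/eqP; rewrite eq_le; apply/andP; split.
    by apply: ereal_inf_lbound; exists m.
  case: m m1 xm mmin S => // m _ _ _ S.
  apply: le_ereal_inf_tmp => _ [k [k1 xk] <-]; rewrite lee_fin ler_nat ltnNge.
  apply/negP => km; have /(_ k) := (S m).2 (ltnSn m); rewrite k1 /=.
  by rewrite km xk => /(_ isT).
rewrite (nneseries_split 0 m); last by move=> n _; rewrite lee_fin.
rewrite add0n eseries0 ?adde0; last first.
  move=> n mn _; rewrite indicE memNset//.
  by move=> /S; rewrite ltnNge mn.
rewrite big_nat (eq_bigr (fun=> 1%:E)); last first.
  by move=> n /andP[_ nm]; rewrite indicE mem_set//; exact/S.
by rewrite -big_nat sumEFin sumr_const_nat subn0.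
Qed.

Lemma deep_traj t (x : nat -> vertex) :
  (hit_base R t x < hit_root R x)%E <-> reach_before (vbase t) x.
Proof.
split=> [/ereal_inf_lt[_ [m xm <-] /hit_root_gt S]|[m _ [xm /hit_root_gt S]]].
  by exists m.
by apply: le_lt_trans S; apply: ereal_inf_lbound; exists m.
Qed.

End HittingTimes.

(** * The Markov property and the law of deep excursions *)

Section WalkLaw.
Context {R : realType} {d' : measure_display} {S : measurableType d'}.
Variables (X : nat -> S -> vertex)
  (Pw : {fset vertex} -> (vertex -> R) -> vertex -> probability S R).
Hypothesis walk : is_biased_walk X Pw.
Variables (t : {fset vertex}) (b : vertex -> R).
Hypothesis wt : is_weighted_tree t b.
Hypothesis t_gt1 : (0 < height t)%N.

Let tP : is_plane_tree t. Proof. by case: wt. Qed.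

Lemma height_card : (0 < height t)%N -> (1 < #|` t|)%N.
Proof.
move=> h0; have rt := root_in tP; have bt := vbase_in rt.
have b0 : vbase t != [::] by rewrite -size_gt0P size_vbase.
have -> : (1 < #|` t|)%N = (#|` [fset [::]; vbase t]%fset| <= #|` t|)%N.
  by rewrite cardfs2 eq_sym b0.
by apply: fsubset_leq_card; apply/fsubsetP => x; rewrite !inE => /orP[] /eqP ->.
Qed.

(** The potential theory above requires a bound on the biases which is uniform
    and larger than one; a finite tree has one. *)
Lemma min_bias : exists2 q : R, 1 < q & forall v, v \in t -> v != [::] -> q <= b v.
Proof.
have b1 : forall v, v \in t -> v != [::] -> 1 < b v by case: wt.
have H (s : seq vertex) : (forall v, v \in s -> v != [::] -> 1 < b v) ->
    exists2 q : R, 1 < q & forall v, v \in s -> v != [::] -> q <= b v.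
  elim: s => [|x s IH] b1s; first by exists 2; rewrite ?ltr1n.
  have [|q q1 qs] := IH; first by move=> v vs; apply: b1s; rewrite inE vs orbT.
  have [x0|x0] := eqVneq x [::].
    exists q => // v; rewrite inE x0 => /predU1P[->//|]; exact: qs.
  exists (Num.min q (b x)); first by rewrite lt_min q1 b1s ?mem_head.
  move=> v; rewrite inE => /predU1P[->|vs] v0; first by rewrite ge_min lexx orbT.
  by rewrite ge_min qs.
exact: H.
Qed.

Local Notation V := (nonroot t).
Local Notation ker := (walk_kernel t b).
Local Notation base := (vbase t).
Local Notation vc := (vchild t).

Lemma kernel_out v w : v \in t -> w \notin t -> ker v w = 0.
Proof.
move=> vt wt'; rewrite /walk_kernel.
have -> : (w \in offspring t v) = false by apply/negbTE; apply: contra wt' => /offspringP[].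
case: ifP => // _; case: eqVneq => // e; case/negP: wt'; rewrite e; exact: parent_in.
Qed.

Lemma kernel_root w : w != [::] -> w != vc -> w \in t ->
  ~~ prefix vc w \/ ker [::] w = 0.
Proof.
move=> w0 wvc wt'; rewrite /walk_kernel eqxx.
case: ifP => [/offspring_size sw|_]; last by right.
left; apply: contra wvc => vw; rewrite -(take1_vchild tP t_gt1 vw).
by rewrite take_oversize ?sw.
Qed.

Lemma sum_kernel v : v \in t -> \sum_(w <- t) ker v w = 1.
Proof.
have [q q1 bq] := min_bias.
move=> vt; rewrite sum_fsetD1 ?(root_in tP)// -sum_nonroot.
have [->|v0] := eqVneq v [::].
  rewrite /walk_kernel eqxx.
  have -> : ([::] \in offspring t [::]) = false by apply/negP => /offspring_neq0.
  rewrite add0r -big_mkcond /= sum_fsubset; last first.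
    by move=> w /offspringP[wt' w0 _]; rewrite nonrootP wt'.
  rewrite -mulr_suml mulfV// gt_eqF//.
  have vo : vc \in offspring t [::].
    by apply/offspringP; rewrite vchild_in// vchild_neq0// /parent (size_vchild tP t_gt1) take0.
  rewrite (bigD1_seq vc) ?fset_uniq//= ltr_pwDl//.
    by rewrite (bias_gt0 q1 bq) ?vchild_in ?vchild_neq0.
  rewrite big_seq_cond sumr_ge0// => x /andP[/offspringP[xt x0 _] _].
  exact: ltW (bias_gt0 q1 bq xt x0).
have vV : v \in V by rewrite nonrootP vt.
have Z0 := child_bias_ge0 q1 bq v.
have Zp : 0 < 1 + child_bias t b v by rewrite ltr_wpDr.
apply: (@mulfI _ (1 + child_bias t b v)); first by rewrite gt_eqF.
have := kstep_walk tP q1 bq (fun=> 1) vV.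
rewrite /kstep; under eq_bigr do rewrite mulr1.
under [in X in _ = _ + X]eq_bigr do rewrite mulr1.
rewrite -/(child_bias t b v) mulrDr => ->.
rewrite /walk_kernel (negbTE v0) [[::] == parent v]eq_sym.
have -> : ([::] \in offspring t v) = false by apply/negP => /offspring_neq0.
case: ifP => _; rewrite ?mulr0 ?mulr1 ?add0r//.
by rewrite -/(child_bias t b v) divff ?gt_eqF// add0r.
Qed.

Lemma process_event (Y : nat -> S -> vertex) A :
  (forall n v, measurable (Y n @^-1` [set v])) -> traj_event A ->
  measurable [set s | A (fun n => Y n s)].
Proof.
move=> mY mA; have mT : measurable_fun setT
    ((fun s n => Y n s) : S -> g_sigma_algebraType cylinders).
  apply: (@measurability _ _ S (g_sigma_algebraType cylinders) _ _ cylinders) => //.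
  move=> _ [B [->|[n [x ->]]] <-]; first by rewrite preimage_set0 setI0.
  rewrite setTI (_ : _ @^-1` _ = \bigcap_i (if (i <= n)%N then Y i @^-1` [set x i] else setT)).
    by apply: bigcapT_measurable => i; case: ifP.
  apply/seteqP; split=> s /=.
    by move=> H i _; case: ifP => // lin; exact: H.
  by move=> H i lin; have := H i I; rewrite lin.
by have := mT measurableT A mA; rewrite setTI.
Qed.

Lemma walk_event A : traj_event A -> measurable [set s | A (traj X s)].
Proof. by case: walk => mX _; exact: process_event. Qed.

Lemma measurable_shift A : traj_event A -> measurable [set s | A (fun n => X n.+1 s)].
Proof. by case: walk => mX _; apply: (process_event (Y := fun n => X n.+1)) => n; exact: mX. Qed.

Lemma walk_cylinder v n x : v \in t -> Pw t b v [set s | forall i, (i <= n)%N -> X i s = x i] =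
  ((x 0%N == v)%:R * \prod_(i < n) ker (x i) (x i.+1))%:E.
Proof. by move=> vt; case: walk => _; apply => //; exact: height_card. Qed.

Lemma walk_start v : v \in t -> Pw t b v [set s | X 0 s = v] = 1%E.
Proof.
move=> vt; have := walk_cylinder 0 (fun=> v) vt; rewrite eqxx big_ord0 mulr1 => <-.
congr (Pw t b v _); apply/seteqP; split=> s /=; last exact.
by move=> + [|//].
Qed.

Lemma walk_start_setI v A : v \in t -> measurable A ->
  Pw t b v A = Pw t b v (A `&` [set s | X 0 s = v]).
Proof.
move=> vt mA; have m0 : measurable [set s | X 0 s = v] by case: walk => + _; exact.
have N : Pw t b v (A `\` [set s | X 0 s = v]) = 0%E.
  apply/eqP; rewrite eq_le measure_ge0 andbT.
  apply: (@le_trans _ _ (Pw t b v (~` [set s | X 0 s = v]))).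
    have mD : measurable (A `\` [set s | X 0 s = v]) by exact: measurableD.
    have mC : measurable (~` [set s | X 0 s = v]) by exact: measurableC.
    by apply: le_measure; [exact: mem_set|exact: mem_set|move=> s []].
  by rewrite probability_setC// walk_start// subee.
apply: (etrans (measureDI (Pw t b v) mA m0)); rewrite -[RHS]add0e; congr (_ + _)%E.
exact: N.
Qed.

Lemma shift_cylinder v n x : v \in t ->
  Pw t b v [set s | forall i, (i <= n)%N -> X i.+1 s = x i]
  = (ker v (x 0%N) * \prod_(i < n) ker (x i) (x i.+1))%:E.
Proof.
move=> vt; have mC : traj_event (cylinder n x) by apply: sub_gen_smallest; right; exists n, x.
rewrite (walk_start_setI vt (measurable_shift mC)).
have := walk_cylinder n.+1 (fun i => if i is j.+1 then x j else v) vt.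
rewrite eqxx mul1r big_ord_recl /= => <-; congr (Pw t b v _).
apply/seteqP; split=> s /=; first by move=> [H X0] [|i]//; exact: H.
by move=> H; split; [move=> i lin; exact: (H i.+1)|exact: (H 0%N)].
Qed.

(** Both sides define probability measures on the trajectories, and they agree
    on the cylinders. *)
Lemma markov v A : v \in t -> traj_event A ->
  Pw t b v [set s | A (fun n => X n.+1 s)]
  = (\sum_(w <- t) (ker v w)%:E * Pw t b w [set s | A (traj X s)])%E.
Proof.
have [q q1 bq] := min_bias.
move=> vt; have k0 w : (0 <= (ker v w)%:E)%E by rewrite lee_fin (kernel_ge0 q1 bq).
pose P (A : set (nat -> vertex)) := Pw t b v [set s | A (fun n => X n.+1 s)]
  = (\sum_(w <- t) (ker v w)%:E * Pw t b w [set s | A (traj X s)])%E.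
apply: (@dynkin_induction _ (g_sigma_algebraType cylinders) cylinders P) => //.
- exact: cylinders_setI.
- rewrite /P (_ : [set s | _] = setT)// probability_setT.
  under eq_bigr => w _ do rewrite probability_setT mule1.
  by rewrite sumEFin sum_kernel.
- move=> _ [->|[n [x ->]]].
    rewrite /P (_ : [set s | _] = set0)// measure0 big1// => w _.
    by rewrite measure0 mule0.
  rewrite /P shift_cylinder//.
  rewrite (eq_big_seq (fun w => (ker v w * ((x 0%N == w)%:R * \prod_(i < n) ker (x i) (x i.+1)))%:E)); last first.
    by move=> w wt'; rewrite EFinM (walk_cylinder n x wt').
  rewrite sumEFin; congr (_%:E); move: (\prod_(i < n) _) => pr.
  have [xt|xt] := boolP (x 0%N \in t).
    rewrite (bigD1_seq (x 0%N)) ?fset_uniq//= eqxx mul1r big1 ?addr0// => w.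
    by rewrite eq_sym => /negbTE ->; rewrite mul0r mulr0.
  rewrite kernel_out// mul0r big_seq big1// => w wt'.
  by case: eqVneq => [e|_]; rewrite ?mul0r ?mulr0//; rewrite e wt' in xt.
- move=> B mB IH.
  rewrite /P (_ : [set s | _] = ~` [set s | B (fun n => X n.+1 s)])//.
  rewrite probability_setC; last exact: measurable_shift.
  rewrite IH.
  transitivity (\sum_(w <- t) ((ker v w)%:E - (ker v w)%:E * Pw t b w [set s | B (traj X s)]))%E.
    rewrite -(@EFin_sum_fine _ _ t xpredT (fun w => ((ker v w)%:E * Pw t b w [set s | B (traj X s)])%E)); last first.
      by move=> w _; rewrite fin_numM// fin_num_measure//; exact: walk_event.
    rewrite -(sum_kernel vt) -EFinB -sumrB -sumEFin; apply: eq_bigr => w _.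
    rewrite EFinB fineK// fin_numM// fin_num_measure//; exact: walk_event.
  apply: eq_bigr => w _.
  rewrite (_ : [set s | (~` B) _] = ~` [set s | B (traj X s)])//.
  rewrite probability_setC; last exact: walk_event.
  have : Pw t b w [set s | B (traj X s)] \is a fin_num.
    by rewrite fin_num_measure//; exact: walk_event.
  by move=> /fineK <-; rewrite -EFinM -!EFinB -EFinM mulrBr mulr1.
- move=> F mF tF IH.
  have tF' (f : S -> nat -> vertex) : trivIset setT (fun n => [set s | F n (f s)]).
    by move=> i j _ _ [s [/= Fi Fj]]; apply: tF => //; exists (f s); split.
  rewrite /P (_ : [set s | _] = \bigcup_n [set s | F n (fun n => X n.+1 s)]); last first.
    by apply/seteqP; split=> s [n _ Fn]; exists n.
  rewrite measure_semi_bigcup//; first last.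
  - by apply: bigcupT_measurable => n; exact: (measurable_shift (mF n)).
  - by move=> n; exact: (measurable_shift (mF n)).
  transitivity (\sum_(0 <= n <oo) \sum_(w <- t) (ker v w)%:E * Pw t b w [set s | F n (traj X s)])%E.
    by apply: eq_eseriesr => n _; exact: IH.
  rewrite nneseries_sum; last by move=> w n _; rewrite mule_ge0.
  apply: eq_bigr => w _; rewrite nneseriesZl; last by move=> n _; exact: measure_ge0.
  congr (_ * _)%E.
  rewrite (_ : [set s | _] = \bigcup_n [set s | F n (traj X s)]); last first.
    by apply/seteqP; split=> s [n _ Fn]; exists n.
  rewrite measure_semi_bigcup//; first last.
  - by apply: bigcupT_measurable => n; exact: (walk_event (mF n)).
  - by move=> n; exact: (walk_event (mF n)).
Qed.

Definition walk_prob v A : R := fine (Pw t b v [set s | A (traj X s)]).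

Lemma walk_probE v A : traj_event A ->
  Pw t b v [set s | A (traj X s)] = (walk_prob v A)%:E.
Proof.
by move=> mA; rewrite /walk_prob fineK// fin_num_measure//; exact: walk_event.
Qed.

Lemma walk_prob_ge0 v A : 0 <= walk_prob v A.
Proof. exact: fine_ge0. Qed.

Lemma walk_prob_le1 v A : traj_event A -> walk_prob v A <= 1.
Proof.
by move=> mA; rewrite -lee_fin -walk_probE// probability_le1//; exact: walk_event.
Qed.

Lemma walk_prob_le v A B : traj_event A -> traj_event B -> A `<=` B ->
  walk_prob v A <= walk_prob v B.
Proof.
move=> mA mB AB; rewrite -lee_fin -!walk_probE//.
by apply: le_measure; [exact/mem_set/walk_event|exact/mem_set/walk_event|move=> s /AB].
Qed.

Lemma walk_prob_start v A B : v \in t -> traj_event A -> traj_event B ->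
  (forall x, x 0%N = v -> A x <-> B x) -> walk_prob v A = walk_prob v B.
Proof.
move=> vt mA mB AB; rewrite /walk_prob.
rewrite (walk_start_setI vt (walk_event mA)) (walk_start_setI vt (walk_event mB)).
congr (fine (Pw t b v _)); apply/seteqP; split=> s /= [As X0]; split=> //.
  exact/(AB _ X0).
exact/(AB _ X0).
Qed.

Lemma walk_probT v : walk_prob v setT = 1.
Proof. by rewrite /walk_prob (_ : [set s | _] = setT)// probability_setT. Qed.

Lemma traj_event0 : traj_event set0.
Proof. exact: (@measurable0 _ (g_sigma_algebraType cylinders)). Qed.

(** This is the form in which the Markov property is used: the trajectories
    that return to the root at time one contribute nothing, whence the kernel
    restricted to [V]. *)
Lemma walk_prob_step v A C : v \in t -> traj_event A -> traj_event C ->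
  (forall x, x 0%N = v -> A x <-> x 1%N != [::] /\ C (fun n => x n.+1)) ->
  walk_prob v A = kstep V ker (fun w => walk_prob w C) v.
Proof.
move=> vt mA mC AC.
pose C' := [set x : nat -> vertex | x 0%N != [::]] `&` C.
have mC' : traj_event C' by apply: traj_event_setI => //; exact: traj_event_neq.
have E : Pw t b v [set s | A (traj X s)] = Pw t b v [set s | C' (fun n => X n.+1 s)].
  rewrite (walk_start_setI vt (walk_event mA)) (walk_start_setI vt (measurable_shift mC')).
  congr (Pw t b v _); apply/seteqP; split=> s /= [As X0]; split=> //.
    exact/(AC (traj X s) X0).
  exact/(AC (traj X s) X0).
rewrite /walk_prob E markov// (eq_bigr (fun w => (ker v w * walk_prob w C')%:E)); last first.
  by move=> w _; rewrite walk_probE// EFinM.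
rewrite sumEFin /= sum_fsetD1 ?(root_in tP)//.
rewrite (@walk_prob_start [::] C' set0) ?(root_in tP)//; first last.
- by move=> x x0; split=> // -[]; rewrite /= x0.
- exact: traj_event0.
rewrite /walk_prob (_ : [set s | set0 _] = set0)// measure0 /= mulr0 add0r -sum_nonroot.
apply: eq_big_seq => w; rewrite nonrootP => /andP[wt' w0]; congr (_ * _).
apply: walk_prob_start => // x x0; rewrite /C' /= x0 w0.
by split=> // -[].
Qed.

Definition surv_prob n v := walk_prob v (surviving n).
Definition deep_prob n v := walk_prob v (reach_before base `&` surviving n).

Lemma traj_event_deep n : traj_event (reach_before base `&` surviving n).
Proof. by apply: traj_event_setI; [exact: traj_event_reach|exact: traj_event_surviving]. Qed.

Lemma surv_prob0 v : surv_prob 0 v = 1.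
Proof. by rewrite /surv_prob surviving0 walk_probT. Qed.

Lemma surv_probS n v : v \in V -> surv_prob n.+1 v = kstep V ker (surv_prob n) v.
Proof.
rewrite nonrootP => /andP[vt v0]; apply: walk_prob_step => //.
- exact: traj_event_surviving.
- exact: traj_event_surviving.
by move=> x _; rewrite survivingS.
Qed.

Lemma reach_shift x : x 0%N != base -> reach_before base x <->
  x 1%N != [::] /\ reach_before base (fun n => x n.+1).
Proof.
move=> x0; split=> [[[|m] _ [/= xm]]|[x1 [m _ [xm S']]]].
- by rewrite xm eqxx in x0.
- by rewrite survivingS => -[x1 S']; split=> //; exists m.
by exists m.+1 => //; split=> //; rewrite survivingS.
Qed.

Lemma deep_prob_step n v : v \in t -> v != base ->
  deep_prob n.+1 v = kstep V ker (deep_prob n) v.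
Proof.
move=> vt vb; apply: walk_prob_step => //.
- exact: traj_event_deep.
- exact: traj_event_deep.
move=> x x0; rewrite survivingS; split=> [[/reach_shift]|[x1 [rb S']]].
  by rewrite x0 => /(_ vb)[x1 rb] [_ S'].
by split=> //; apply/reach_shift; rewrite ?x0.
Qed.

Lemma deep_prob0 v : v \in t -> v != base ->
  deep_prob 0 v = kstep V ker (deep_prob 0) v.
Proof.
move=> vt vb; apply: walk_prob_step => //; try exact: traj_event_deep.
move=> x x0; rewrite !surviving0 !setIT.
by apply: reach_shift; rewrite x0.
Qed.

Lemma deep_prob_base n : deep_prob n base = surv_prob n base.
Proof.
apply: walk_prob_start => //; [exact/vbase_in/root_in|exact: traj_event_deep|
  exact: traj_event_surviving|].
move=> x x0; split=> [[]//|S']; split=> //; exists 0%N => //; split=> //.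
by rewrite surviving0.
Qed.

Lemma sum_kernel_le v : v \in V -> \sum_(w <- V) ker v w <= 1.
Proof.
have [q q1 bq] := min_bias.
rewrite nonrootP => /andP[vt v0]; rewrite -(sum_kernel vt) (@sum_fsetD1 _ t) ?(root_in tP)//.
by rewrite sum_nonroot lerDr (kernel_ge0 q1 bq).
Qed.

Lemma base_nonroot : base \in V.
Proof. by rewrite nonrootP base_in// base_neq0. Qed.

(** A ratio of resistances, as for any reversible chain: see [deep_prob_harm]. *)
Definition deep_harm v : R := resist t b v / resist t b base.

Lemma resist_gt0 : 0 < resist t b base.
Proof.
have [q q1 bq] := min_bias.
exact: lt_le_trans ltr01 (resist_ge1 tP q1 bq t_gt1).
Qed.

Lemma deep_harm_base : deep_harm base = 1.
Proof. by rewrite /deep_harm divff// gt_eqF// resist_gt0. Qed.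

Lemma deep_harm_ge0 v : v \in V -> 0 <= deep_harm v.
Proof.
have [q q1 bq] := min_bias; rewrite nonrootP => /andP[vt _].
exact: divr_ge0 (resist_ge0 tP q1 bq vt) (ltW resist_gt0).
Qed.

Lemma deep_harm_le1 v : v \in V -> deep_harm v <= 1.
Proof.
have [q q1 bq] := min_bias; rewrite nonrootP => /andP[vt _].
by rewrite ler_pdivrMr ?resist_gt0// mul1r (resist_le tP q1 bq).
Qed.

Lemma deep_harm_harm v : v \in V -> v != base -> kstep V ker deep_harm v = deep_harm v.
Proof.
have [q q1 bq] := min_bias; move=> vV vb.
rewrite /deep_harm -(kstep_resist tP q1 bq vV vb) [RHS]mulrC -kstepZ.
by apply: eq_bigr => w _; rewrite [_ / _]mulrC.
Qed.

(** Both functions are harmonic away from the deepest leaf, equal to one there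
    and bounded, and such a function is unique. *)
Lemma deep_prob_harm v : v \in V -> deep_prob 0 v = deep_harm v.
Proof.
have [q q1 bq] := min_bias; move=> vV.
have k0 v' w : v' \in V -> 0 <= ker v' w.
  by rewrite nonrootP => /andP[vt _]; exact: (kernel_ge0 q1 bq).
have h0 v' : v' \in V -> 0 <= base_time t b v'.
  by rewrite nonrootP => /andP[vt _]; exact: (base_time_ge0 tP q1 bq).
have hs v' : v' \in V -> v' != base -> 1 + kstep V ker (base_time t b) v' <= base_time t b v'.
  exact: (base_time_super tP q1 bq).
have d0 w : w \in V -> 0 <= deep_prob 0 w by move=> _; exact: walk_prob_ge0.
have d1 w : w \in V -> deep_prob 0 w <= 1.
  by move=> _; apply: walk_prob_le1; exact: traj_event_deep.
have db : deep_prob 0 base = deep_harm base.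
  by rewrite deep_prob_base surv_prob0 deep_harm_base.
have dh w : w \in V -> w != base -> kstep V ker (deep_prob 0) w = deep_prob 0 w.
  by rewrite nonrootP => /andP[wt' w0] wb; rewrite -deep_prob0.
have le := harmonic_le k0 sum_kernel_le base_nonroot h0 hs.
apply/eqP; rewrite eq_le; apply/andP; split; apply: le => //.
- exact: deep_harm_ge0.
- exact: deep_harm_harm.
- exact: deep_harm_le1.
- exact: deep_harm_harm.
Qed.

Definition root_prob : R := ker [::] vc.

Lemma root_prob_gt0 : 0 < root_prob.
Proof.
have [q q1 bq] := min_bias.
have vo : vc \in offspring t [::].
  by apply/offspringP; rewrite vchild_in// vchild_neq0// /parent (size_vchild tP t_gt1) take0.
have b0 w : w \in offspring t [::] -> 0 < b w.
  by move=> /offspringP[wt' w0 _]; exact: (bias_gt0 q1 bq).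
rewrite /root_prob /walk_kernel eqxx vo divr_gt0 ?b0//.
rewrite (bigD1_seq vc) ?fset_uniq//= ltr_pwDl ?b0//.
by rewrite big_seq_cond sumr_ge0// => x /andP[/b0/ltW].
Qed.

Lemma deep_prob_le0 n v : deep_prob n v <= deep_prob 0 v.
Proof.
apply: walk_prob_le; [exact: traj_event_deep|exact: traj_event_deep|].
by apply: setIS; exact: surviving_le.
Qed.

(** A child of the root other than [vc] cannot lead to the deepest leaf
    without a return to the root. *)
Lemma kstep_root n : kstep V ker (deep_prob n) [::] = root_prob * deep_prob n vc.
Proof.
have vcV : vc \in V by rewrite nonrootP vchild_in// vchild_neq0.
rewrite /kstep (bigD1_seq vc) ?fset_uniq//= -/root_prob big_seq_cond big1 ?addr0//.
move=> w /andP[wV wvc].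
have [wt' w0] : w \in t /\ w != [::] by move: wV; rewrite nonrootP => /andP[].
have [pw|->] := kernel_root w0 wvc wt'; last by rewrite mul0r.
suff -> : deep_prob n w = 0 by rewrite mulr0.
apply/eqP; rewrite eq_le walk_prob_ge0 andbT (le_trans (deep_prob_le0 n w))//.
by rewrite deep_prob_harm// /deep_harm resist_out// mul0r.
Qed.

Lemma root_neq_base : [::] != base.
Proof. by rewrite eq_sym base_neq0. Qed.

Lemma deep_prob_rootS n : deep_prob n.+1 [::] = root_prob * deep_prob n vc.
Proof. by rewrite deep_prob_step ?(root_in tP) ?root_neq_base ?kstep_root. Qed.

Lemma deep_prob_root0 : deep_prob 0 [::] = root_prob * deep_prob 0 vc.
Proof. by rewrite deep_prob0 ?(root_in tP) ?root_neq_base ?kstep_root. Qed.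

Lemma deep_prob_vchild : deep_prob 0 vc = (resist t b base)^-1.
Proof.
rewrite deep_prob_harm ?nonrootP ?vchild_in ?vchild_neq0//.
by rewrite /deep_harm (resist_vchild b tP t_gt1) div1r.
Qed.

Lemma deep_excursionE :
  deep_excursion R X t = [set s | (reach_before base `&` surviving 0) (traj X s)].
Proof.
rewrite surviving0 setIT; apply/seteqP; split=> s /= /deep_traj; exact.
Qed.

Lemma p_deE : p_de X Pw t b = (resist t b base)^-1.
Proof. by rewrite /p_de deep_excursionE -deep_prob_vchild. Qed.

Lemma de_scaleE : de_scale X Pw t b = 2 * omega_star t b * resist t b base.
Proof. by rewrite /de_scale p_deE invrK. Qed.

(** A deep excursion starts with a step to [vc], from which its probability is
    the inverse of the resistance; this is the conditional probability of
    surviving [n] steps after that first step. *)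
Definition deep_cond n : R := deep_prob n vc * resist t b base.

Lemma deep_prob_root_div n :
  deep_prob n.+1 [::] * (deep_prob 0 [::])^-1 = deep_cond n.
Proof.
rewrite deep_prob_rootS deep_prob_root0 deep_prob_vchild /deep_cond.
have r0 := root_prob_gt0; have R0 := resist_gt0.
by field; rewrite !gt_eqF.
Qed.

Lemma deep_prob_root_gt0 : 0 < deep_prob 0 [::].
Proof. by rewrite deep_prob_root0 deep_prob_vchild mulr_gt0 ?root_prob_gt0 ?invr_gt0 ?resist_gt0. Qed.

Lemma de_tailE (c : R) : 0 <= c ->
  de_tail X Pw c t b = (if Num.trunc (c * de_scale X Pw t b) is n.+1
                        then deep_cond n else 1)%:E.
Proof.
have [q q1 bq] := min_bias.
move=> c0; have sc0 : 0 < de_scale X Pw t b.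
  by rewrite de_scaleE !mulr_gt0 ?resist_gt0// (omega_gt0 tP q1 bq).
have y0 : 0 <= c * de_scale X Pw t b by rewrite mulr_ge0 ?(ltW sc0).
rewrite /de_tail /cond_prob deep_excursionE.
rewrite (_ : [set s | (c%:E < _)%E] `&` _
   = [set s | (reach_before base `&` surviving (Num.trunc (c * de_scale X Pw t b))) (traj X s)]).
  rewrite !walk_probE; try exact: traj_event_deep.
  rewrite -!/(deep_prob _ _) /= -EFinM; congr (_%:E).
  case: (Num.trunc _) => [|n]; last exact: deep_prob_root_div.
  by rewrite divff// gt_eqF// deep_prob_root_gt0.
have E x : (c%:E < hit_root R x * ((de_scale X Pw t b)^-1)%:E)%E
    <-> surviving (Num.trunc (c * de_scale X Pw t b)) x.
  by rewrite -(hit_root_gt_real x y0) lte_pdivlMr// EFinM.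
apply/seteqP; split=> s /=.
  by move=> [/E ? []].
by move=> [rb sv]; split; [exact/E|split=> //; rewrite surviving0].
Qed.

Lemma de_mean_ratioE : de_mean_ratio X Pw t b
  = ((1 + \sum_(0 <= n <oo) (deep_cond n)%:E) * ((de_scale X Pw t b)^-1)%:E)%E.
Proof.
have mD n := walk_event (traj_event_deep n).
have mS n := walk_event (traj_event_surviving n).
have I : (\int[Pw t b [::]]_(s in deep_excursion R X t) hit_root R (traj X s)
   = \sum_(0 <= n <oo) (deep_prob n [::])%:E)%E.
  under eq_integral do rewrite hit_root_sum.
  rewrite integral_nneseries; first last.
  - by move=> n s _; rewrite lee_fin.
  - move=> n; apply/measurable_EFinP.
    rewrite (_ : (fun s => _) = \1_[set s | surviving n (traj X s)] :> (S -> R)).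
      exact: measurable_indic.
    by apply/funext => s; rewrite !indicE.
  - rewrite deep_excursionE; exact: mD.
  apply: eq_eseriesr => n _.
  transitivity (\int[Pw t b [::]]_(s in deep_excursion R X t)
      (\1_[set s | surviving n (traj X s)] s)%:E)%E.
    by apply: eq_integral => s _; rewrite !indicE.
  rewrite integral_indic//; last by rewrite deep_excursionE; exact: mD.
  rewrite /deep_prob -walk_probE; last exact: traj_event_deep.
  congr (Pw t b [::] _); rewrite deep_excursionE surviving0 setIT setIC.
  by apply/seteqP; split=> s /=.
rewrite /de_mean_ratio /cond_expect I; congr (_ * _)%E.
rewrite deep_excursionE -/(walk_prob [::] _) -/(deep_prob 0 [::]) muleC -nneseriesZl; last first.
  by move=> n _; rewrite lee_fin walk_prob_ge0.
rewrite [LHS](nneseries_split 0 1); last first.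
  move=> n _; rewrite -EFinM lee_fin mulr_ge0 ?walk_prob_ge0// invr_ge0 walk_prob_ge0//.
rewrite big_nat1 -EFinM mulVf ?gt_eqF ?deep_prob_root_gt0//; congr (_ + _)%E.
rewrite add0n -nneseries_addn; last first.
  move=> n; rewrite -EFinM lee_fin mulr_ge0 ?walk_prob_ge0// invr_ge0 walk_prob_ge0//.
apply: eq_eseriesr => n _; rewrite addn1 -EFinM mulrC; congr (_%:E).
exact: deep_prob_root_div.
Qed.

End WalkLaw.

(** * Geometric survival along deep excursions *)

Section WalkEstimates.
Context {R : realType} {d' : measure_display} {S : measurableType d'}.
Variables (X : nat -> S -> vertex)
  (Pw : {fset vertex} -> (vertex -> R) -> vertex -> probability S R).
Hypothesis walk : is_biased_walk X Pw.
Variables (t : {fset vertex}) (b : vertex -> R) (q : R).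
Hypothesis wt : is_weighted_tree t b.
Hypothesis t_gt1 : (0 < height t)%N.
Hypothesis q_gt1 : 1 < q.
Hypothesis b_geq : forall v, v \in t -> v != [::] -> q <= b v.

Let tP : is_plane_tree t. Proof. by case: wt. Qed.

Local Notation V := (nonroot t).
Local Notation ker := (walk_kernel t b).
Local Notation base := (vbase t).
Local Notation vc := (vchild t).
Local Notation omega := (omega_star t b).
Local Notation Rb := (resist t b base).
Local Notation A := (hit_time t b base).
Local Notation a_ n := (deep_cond X Pw t b n).

(** This time dominates both the mean time to reach the deepest leaf or the
    root and the difference between the mean time [A] from this leaf to the
    root and the commute time [2 * omega * Rb]. *)
Definition error_time : R := (1 + 4 / (q - 1)) * total_loss t b.

Let vcV : vc \in V. Proof. by rewrite nonrootP vchild_in// vchild_neq0. Qed.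

Lemma hit_time_base_bounds : 2 * omega * Rb - error_time <= A <= 2 * omega * Rb.
Proof.
have rt := root_in tP.
have := base_time_ge0 tP q_gt1 b_geq rt.
have := base_time_le tP q_gt1 b_geq t_gt1 rt (or_intror erefl).
rewrite /base_time -/error_time /hit_time path_sum0 /resist path_sum0 => H1 H2.
by apply/andP; split; lra.
Qed.

(** Bounding [deep_harm] by one, the left-hand side is at most the reversible
    mass of the subtree of [vc] times the resistance, minus [A]: this is again
    the defect of the commute time. *)
Lemma sum_green_deep : 0 < A ->
  \sum_(v <- V) green t b v - \sum_(v <- V) green t b v * deep_harm t b v
  <= error_time / A * \sum_(v <- V) green t b v.
Proof.
move=> A0; rewrite (sum_green tP q_gt1 b_geq)// divfK ?gt_eqF//.
have R0 : 0 < Rb := resist_gt0 wt t_gt1.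
have rV v : v \in V -> 0 <= resist t b v /\ resist t b v <= Rb.
  rewrite nonrootP => /andP[vt _]; split; first exact: (resist_ge0 tP q_gt1 b_geq).
  exact: (resist_le tP q_gt1 b_geq).
pose m v := conduct b v * (1 + child_bias t b v).
have m0 v : v \in V -> 0 <= m v.
  rewrite nonrootP => /andP[vt _]; rewrite mulr_ge0//.
    by rewrite ltW// (conduct_gt0 tP q_gt1 b_geq).
  by rewrite addr_ge0// (child_bias_ge0 q_gt1 b_geq).
rewrite -(sum_green tP q_gt1 b_geq t_gt1) -sumrB.
apply: (@le_trans _ _ (\sum_(v <- V | prefix vc v) m v * (Rb - resist t b v))).
  rewrite [leRHS]big_mkcond big_seq [leRHS]big_seq ler_sum// => v vV.
  have [r0 r1] := rV v vV.
  rewrite /green -/(m v); case: ifP => pv; last first.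
    have vt : v \in t by move: vV; rewrite nonrootP => /andP[].
    by rewrite resist_out ?pv// mulr0 mul0r subrr.
  have -> : m v * resist t b v - m v * resist t b v * deep_harm t b v
    = (resist t b v / Rb) * (m v * (Rb - resist t b v)).
    by rewrite /deep_harm; field; rewrite gt_eqF.
  apply: ler_piMl; last by rewrite ler_pdivrMr// mul1r.
  by apply: mulr_ge0; [exact: m0|rewrite subr_ge0].
have E : \sum_(v <- V | prefix vc v) green t b v = A.
  rewrite -(sum_green tP q_gt1 b_geq)// big_mkcond big_seq [RHS]big_seq.
  apply: eq_bigr => v vV; case: ifP => // /negbT pv.
  have vt : v \in t by move: vV; rewrite nonrootP => /andP[].
  by rewrite /green resist_out// mulr0.
have -> : \sum_(v <- V | prefix vc v) m v * (Rb - resist t b v)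
  = (\sum_(v <- V | prefix vc v) m v) * Rb - A.
  by rewrite -[in RHS]E mulr_suml -sumrB; apply: eq_bigr => v _; rewrite mulrBr.
have /andP[H1 H2] := hit_time_base_bounds.
have : (\sum_(v <- V | prefix vc v) m v) * Rb <= 2 * omega * Rb.
  by rewrite ler_wpM2r ?(ltW R0)// (sum_conduct_le tP q_gt1 b_geq).
by move=> ?; lra.
Qed.

Section Estimates.
Variable s : nat.
Hypothesis s_gt0 : (0 < s)%N.
Hypothesis A_gt1 : 1 < A.
Let eta := error_time / A + s%:R / A + error_time / s%:R.

Let k0 v w : v \in V -> 0 <= ker v w.
Proof. by rewrite nonrootP => /andP[vt _]; exact: (kernel_ge0 q_gt1 b_geq). Qed.
Let h0 v : v \in V -> 0 <= base_time t b v.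
Proof. by rewrite nonrootP => /andP[vt _]; exact: (base_time_ge0 tP q_gt1 b_geq). Qed.
Let hs v : v \in V -> v != base -> 1 + kstep V ker (base_time t b) v <= base_time t b v.
Proof. exact: (base_time_super tP q_gt1 b_geq). Qed.
Let k1 := sum_kernel_le wt t_gt1.
Let bV := base_nonroot wt t_gt1.
Let u0 v : v \in V -> surv_prob X Pw t b 0 v = 1.
Proof. by move=> _; exact: surv_prob0. Qed.
Let uS n v (vV : v \in V) := surv_probS walk wt t_gt1 n vV.
Let g1 := deep_harm_base wt t_gt1.
Let g0 := deep_harm_ge0 wt t_gt1.
Let gle := deep_harm_le1 wt t_gt1.
Let gh := deep_harm_harm wt.
Let a0 := deep_prob_harm walk wt t_gt1.
Let ab n := deep_prob_base walk wt t_gt1 n.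
Let aS n v (vV : v \in V) (vb : v != base) :
  deep_prob X Pw t b n.+1 v = kstep V ker (deep_prob X Pw t b n) v.
Proof.
by apply: (deep_prob_step walk wt t_gt1) => //; move: vV; rewrite nonrootP => /andP[].
Qed.
Let G0 := green_ge0 tP q_gt1 b_geq.
Let Gid := green_identity tP q_gt1 b_geq t_gt1.
Let SG := sum_green tP q_gt1 b_geq t_gt1.
Let SG1 : 1 < \sum_(v <- V) green t b v. Proof. by rewrite SG. Qed.
Let HP v : v \in V -> green t b v != 0 -> base_time t b v <= error_time.
Proof.
rewrite nonrootP => /andP[vt v0] Gv; apply: (base_time_le tP q_gt1 b_geq) => //.
left; apply: contraNT Gv => pv; by rewrite /green resist_out// mulr0.
Qed.
Let k1P := sum_green_deep (lt_trans ltr01 A_gt1).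
Let Hvc : base_time t b vc <= error_time.
Proof. by apply: (base_time_le tP q_gt1 b_geq); rewrite ?vchild_in//; left; exact: prefix_refl. Qed.
Let gvc : deep_harm t b vc * Rb = 1.
Proof.
by rewrite /deep_harm (resist_vchild b tP t_gt1) div1r mulVf// gt_eqF// (resist_gt0 wt t_gt1).
Qed.
Let R0 : 0 < Rb := resist_gt0 wt t_gt1.

Lemma deep_cond_lower n : (1 - A^-1) ^+ n - 2 * eta <= a_ n.
Proof.
have := deep_geom_lower k0 k1 bV h0 hs u0 uS g1 g0 gle gh a0 ab aS G0 Gid SG1 s_gt0 k1P HP n vcV.
rewrite SG -/eta -(ler_pM2r R0) -/(a_ n) mulrAC gvc mul1r; exact.
Qed.

Lemma deep_cond_upper n :
  a_ (s + n) <= Rb * (error_time / s%:R) + (1 - A^-1) ^+ n + 2 * eta.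
Proof.
have := deep_geom_upper k0 k1 bV h0 hs u0 uS g1 g0 gle gh a0 ab aS G0 Gid SG1 s_gt0 k1P HP n vcV Hvc.
rewrite SG -/eta -(ler_pM2r R0) -/(a_ _) mulrDl [deep_harm _ _ _ * _ * _]mulrAC gvc mul1r.
by rewrite [_ * Rb]mulrC addrA.
Qed.

Lemma sum_deep_cond_lower n : A * (1 - eta - (1 - A^-1) ^+ n) <= \sum_(i < n) a_ i.
Proof.
have := sum_deep_lower k0 k1 bV h0 hs u0 uS g1 g0 gle gh a0 ab aS G0 Gid SG1 s_gt0 k1P HP n vcV.
by rewrite SG -/eta -(ler_pM2r R0) mulrAC gvc mul1r [(\sum_(i < n) _) * _]mulr_suml.
Qed.

Lemma sum_deep_cond_upper n : \sum_(i < n) a_ i <= A + Rb * error_time.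
Proof.
have := sum_deep_upper k0 bV h0 hs u0 uS g1 g0 gle gh a0 ab aS G0 Gid SG1 n vcV.
rewrite SG -(ler_pM2r R0) mulrDl mulrAC gvc mul1r [(\sum_(i < n) _) * _]mulr_suml => H; apply: le_trans H _.
by rewrite lerD2l mulrC ler_wpM2l// ltW.
Qed.

End Estimates.
End WalkEstimates.

(** * Limits on a fixed tree *)

Lemma geom_le_exp {R : realType} (A : R) n : 1 < A ->
  (1 - A^-1) ^+ n <= expR (- (n%:R / A)).
Proof.
move=> A1; rewrite mulrC -mulNr mulrC expRM_natl lerXn2r ?nnegrE ?expR_ge0 ?expR_ge1Dx//.
by rewrite subr_ge0 invf_le1 ?ltW// (lt_trans ltr01).
Qed.

Lemma exp_le_geom {R : realType} (A : R) n : 1 < A ->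
  expR (- (n%:R / (A - 1))) <= (1 - A^-1) ^+ n.
Proof.
move=> A1; have A10 : 0 < A - 1 by rewrite subr_gt0.
rewrite mulrC -mulNr mulrC expRM_natl lerXn2r ?nnegrE ?expR_ge0//.
  by rewrite subr_ge0 invf_le1 ?ltW// (lt_trans ltr01).
rewrite expRN -[leRHS]invrK lef_pV2 ?posrE ?expR_gt0//; last first.
  by rewrite invr_gt0 subr_gt0 invf_lt1// (lt_trans ltr01).
apply: le_trans (expR_ge1Dx _); rewrite le_eqVlt; apply/orP; left; apply/eqP.
by field; rewrite !gt_eqF//; lra.
Qed.

Lemma exp_small {R : realType} (x : R) : 0 <= x -> x <= 1 / 2 -> expR x <= 1 + 2 * x.
Proof.
move=> x0 x1; have e := expR_ge1Dx (- x).
rewrite -[leLHS]invrK -expRN invf_ple ?posrE ?expR_gt0//; last by lra.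
apply: le_trans e; rewrite -(ler_pM2l (_ : 0 < 1 + 2 * x)); last by lra.
by rewrite mulfV; [nra|rewrite gt_eqF//; lra].
Qed.

Lemma pow_small {R : realType} (x eps : R) : 0 <= x -> x < 1 -> 0 < eps ->
  exists n, x ^+ n <= eps.
Proof.
move=> x0 x1 e0; have : geometric 1 x n @[n --> \oo] --> (0 : R).
  by apply: cvg_geometric; rewrite ger0_norm.
move=> /cvgrPdist_le /(_ _ e0)[n _ /(_ n (leqnn n))] /=.
by rewrite sub0r normrN mul1r ger0_norm ?exprn_ge0// => H; exists n.
Qed.

(** The three time scales [H], [s] and [A] are separated by factors of order
    [dl]: this is what makes the errors of the geometric approximation small. *)
Lemma error_scales {R : realType} (dl omega Rb A H s : R) :
  0 < dl -> dl <= 1 / 10 -> 0 < omega -> 1 <= Rb -> 1 <= H ->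
  H <= dl ^+ 2 * omega -> 2 * omega * Rb - H <= A -> A <= 2 * omega * Rb ->
  dl * omega < s -> s <= dl * omega + 1 ->
  [/\ H / A + s / A + H / s <= 4 * dl, H + 1 <= dl * (2 * omega * Rb),
      Rb * H <= dl * (2 * omega * Rb), H / s <= dl &
      s + 2 <= dl * (2 * omega * Rb)].
Proof.
move=> dl0 dl1 om0 R1 H1 Hle AL1 AL2 sl su.
have Lom : 2 * omega <= 2 * omega * Rb by rewrite ler_peMr//; lra.
have dL : dl * (2 * omega) <= dl * (2 * omega * Rb) by rewrite ler_wpM2l// ltW.
have do0 : 0 < dl * omega by rewrite mulr_gt0.
have d2o : dl ^+ 2 * omega <= dl * omega / 10.
  have := ler_wpM2r (ltW do0) dl1; rewrite expr2 -mulrA; lra.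
have do1 : dl * omega <= omega / 10 by have := ler_wpM2r (ltW om0) dl1; lra.
have A1 : 1 < A by lra.
have A0 : 0 < A by lra.
have s0 : 0 < s by lra.
have Hs : H / s <= dl.
  by rewrite ler_pdivrMr//; have := ler_wpM2l (ltW dl0) (ltW sl); rewrite mulrA -expr2; lra.
have dA : dl * omega <= dl * A by rewrite ler_wpM2l ?(ltW dl0)//; lra.
have HA : H / A <= dl by rewrite ler_pdivrMr//; lra.
have sA : s / A <= 2 * dl by rewrite ler_pdivrMr//; lra.
split=> //; try lra.
have : Rb * H <= Rb * (dl * omega) by rewrite ler_wpM2l//; lra.
have : 0 < Rb * (dl * omega) by rewrite mulr_gt0//; lra.
by rewrite (_ : dl * (2 * omega * Rb) = 2 * (Rb * (dl * omega))); [lra|ring].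
Qed.

(** The power is taken at a time of order [a * L], and [A] agrees with [L] up
    to the factor [1 - dl]. *)
Lemma geom_lower {R : realType} (a dl A L : R) n : 0 < a -> 0 < dl -> dl <= 1 / 10 ->
  1 < A -> 0 < L -> L * (1 - dl) <= A - 1 -> n%:R <= a * L ->
  expR (- a) - 2 * a * dl <= (1 - A^-1) ^+ n.
Proof.
move=> a0 dl0 dl1 A1 L0 LA nL; apply: le_trans (exp_le_geom n A1).
have ea0 : 0 < expR (- a) := expR_gt0 _.
have ea1 : expR (- a) <= 1 by rewrite -[leRHS]expR0 ler_expR; lra.
have ad : 0 < a * (2 * dl) by rewrite !mulr_gt0.
have nA : n%:R / (A - 1) <= a * (1 + 2 * dl).
  rewrite ler_pdivrMr; last by lra.
  apply: le_trans nL _; rewrite -mulrA ler_wpM2l ?(ltW a0)//.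
  apply: (@le_trans _ _ ((1 + 2 * dl) * (L * (1 - dl)))).
    rewrite mulrCA -[leLHS]mulr1 ler_wpM2l ?(ltW L0)//; nra.
  by rewrite ler_wpM2l//; lra.
apply: (@le_trans _ _ (expR (- (a * (1 + 2 * dl))))); last by rewrite ler_expR lerN2.
rewrite mulrDr mulr1 opprD expRD.
have H2 := ler_wpM2l (ltW ea0) (expR_ge1Dx (- (a * (2 * dl)))).
have H3 := ler_wpM2r (ltW ad) ea1.
by move: H2 H3; rewrite mulrDr mulr1 mulrN; lra.
Qed.

Lemma geom_upper {R : realType} (a dl A L : R) n : 0 < a -> 0 < dl -> dl <= 1 / 10 ->
  1 < A -> A <= L -> a * L - dl * L <= n%:R ->
  (1 - A^-1) ^+ n <= expR (- a) + 2 * dl.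
Proof.
move=> a0 dl0 dl1 A1 AL nL; apply: le_trans (geom_le_exp n A1) _.
have A0 : 0 < A by lra.
have ea0 : 0 < expR (- a) := expR_gt0 _.
have ea1 : expR (- a) <= 1 by rewrite -[leRHS]expR0 ler_expR; lra.
have nA : a - dl <= n%:R / A.
  rewrite ler_pdivlMr//; have [ad|ad] := leP 0 (a - dl).
    by apply: le_trans nL; rewrite -mulrBl ler_wpM2l.
  by apply: (@le_trans _ _ 0) => //; rewrite mulr_le0_ge0// ltW.
apply: (@le_trans _ _ (expR (- a + dl))); first by rewrite ler_expR; lra.
have dl2 : dl <= 1 / 2 by lra.
have H2 := ler_wpM2l (ltW ea0) (exp_small (ltW dl0) dl2).
have d0 : 0 <= 2 * dl by lra.
have H3 := ler_wpM2r d0 ea1.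
by rewrite expRD; move: H2 H3; rewrite mulrDr mulr1; lra.
Qed.

(** A small total loss makes [error_time] small with respect to [omega_star],
    hence to the mean time from the deepest leaf to the root; the survival
    probabilities are then geometric, and their parameter is the inverse of
    the normalisation up to a factor close to one. *)
Lemma excursion_limits {R : realType} (eps a q : R) : 0 < eps -> 0 < a -> 1 < q ->
  exists2 kappa : R, 0 < kappa &
  forall (d' : measure_display) (S : measurableType d') (X : nat -> S -> vertex)
    (Pw : {fset vertex} -> (vertex -> R) -> vertex -> probability S R)
    (t : {fset vertex}) (b : vertex -> R),
  is_biased_walk X Pw -> is_weighted_tree t b -> (0 < height t)%N ->
  (forall v, v \in t -> v != [::] -> q <= b v) ->
  total_loss t b <= kappa * omega_star t b ->
  ((1 - eps)%:E < de_mean_ratio X Pw t b < (1 + eps)%:E)%E /\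
  exists2 x : R, de_tail X Pw a t b = x%:E & `|x - expR (- a)| < eps.
Proof.
move=> eps_gt0 a_gt0 q_gt1.
have q10 : 0 < q - 1 by rewrite subr_gt0.
pose C := 1 + 4 / (q - 1).
have C1 : 1 <= C by rewrite /C lerDl divr_ge0// ltW.
have [Q QE Q1] : exists2 Q, Q = q / (q - 1) & 1 <= Q.
  by eexists; [reflexivity|rewrite ler_pdivlMr// mul1r; lra].
(* The relative error [dl]: the approximations below are wrong by at most [20
   * dl + Q * dl + 2 * a * dl], and [4 * dl <= a] places the time [a * L]
   beyond the intermediate time [s]. *)
have [dl [dl0 dl1 dla dle]] : exists dl, [/\ 0 < dl, dl <= 1 / 10, 4 * dl <= a &
    20 * dl + Q * dl + 2 * a * dl < eps].
  have K0 : 0 < 20 + Q + 2 * a by lra.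
  exists (Num.min (Num.min (1 / 10) (a / 4)) (eps / (2 * (20 + Q + 2 * a)))).
  set dl := Num.min _ _.
  have d1 : dl <= 1 / 10 by rewrite /dl !ge_min lexx.
  have d2 : dl <= a / 4 by rewrite /dl !ge_min lexx orbT.
  have : dl <= eps / (2 * (20 + Q + 2 * a)) by rewrite /dl ge_min lexx orbT.
  rewrite ler_pdivlMr ?mulr_gt0// => d3.
  have d0 : 0 < dl by rewrite /dl !lt_min !divr_gt0// ?mulr_gt0//; lra.
  by split=> //; [lra|have := mulr_gt0 K0 d0; lra].
(* With this constant, [error_time] is at most [dl ^+ 2 * omega], so that
   both quotients of successive scales [H], [s = dl * omega] and [A] are of
   order [dl]. *)
exists (dl ^+ 2 / C); first by rewrite divr_gt0 ?exprn_gt0//; lra.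
move=> d' S X Pw t b walk wt t_gt1 b_geq loss.
have tP : is_plane_tree t by case: wt.
set omega := omega_star t b in loss *.
have om0 : 0 < omega := omega_gt0 tP q_gt1 b_geq.
set H := error_time t b q.
have Hle : H <= dl ^+ 2 * omega.
  rewrite /H /error_time -/C; apply: (@le_trans _ _ (C * (dl ^+ 2 / C * omega))).
    by rewrite ler_wpM2l//; lra.
  by rewrite mulrA [C * _]mulrCA divff ?mulr1// gt_eqF//; lra.
have S1 : 1 <= total_loss t b.
  apply: le_trans (total_loss_size tP q_gt1 b_geq).
  by rewrite ler1n size_base_gt0.
have H1 : 1 <= H.
  by rewrite /H /error_time -/C -[X in X <= _]mulr1 ler_pM//; lra.
clear S1 loss.
set Rb := resist t b (vbase t).
have R1 : 1 <= Rb := resist_ge1 tP q_gt1 b_geq t_gt1.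
have RQ : Rb <= Q by rewrite QE (resist_base_le tP q_gt1 b_geq t_gt1).
set A := hit_time t b (vbase t).
have /andP[AL1 AL2] := hit_time_base_bounds wt t_gt1 q_gt1 b_geq.
rewrite -/omega -/Rb -/A -/H in AL1 AL2.
pose s := (Num.trunc (dl * omega)).+1.
have /andP[s1 s2] := truncn_itv (ltW (mulr_gt0 dl0 om0)).
have su : s%:R <= dl * omega + 1 by rewrite /s -natr1 lerD2r.
have [eta_le HL RH Hs sL] := error_scales dl0 dl1 om0 R1 H1 Hle AL1 AL2 s2 su.
have sc := de_scaleE walk wt t_gt1; rewrite -/omega -/Rb in sc.
have L0 : 0 < 2 * omega * Rb by rewrite !mulr_gt0//; lra.
set L := 2 * omega * Rb in AL1 AL2 sc HL RH sL L0.
have A1 : 1 < A.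
  have : dl * L <= 1 / 10 * L by rewrite ler_wpM2r// ltW.
  by move: HL H1 AL1; clear; lra.
rewrite -/s in eta_le Hs sL.
set eta := H / A + s%:R / A + H / s%:R in eta_le.
move: (sum_deep_cond_lower walk wt t_gt1 q_gt1 b_geq (s := s) isT A1)
  (sum_deep_cond_upper walk wt t_gt1 q_gt1 b_geq A1)
  (deep_cond_upper walk wt t_gt1 q_gt1 b_geq (s := s) isT A1)
  (deep_cond_lower walk wt t_gt1 q_gt1 b_geq (s := s) isT A1).
rewrite -/A -/H -/eta -/Rb => SD SU DU DD.
clear su s1 s2 Hle om0.
split.
  rewrite (de_mean_ratioE walk wt t_gt1) sc.
  have a0 n : 0 <= deep_cond X Pw t b n.
    by rewrite mulr_ge0 ?walk_prob_ge0// (le_trans ler01).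
  apply/andP; split.
    have [n nP] : exists n, (1 - A^-1) ^+ n <= dl.
      apply: pow_small => //; first by rewrite subr_ge0 invf_le1 ?ltW// (lt_trans ltr01).
      by rewrite gtrBl invr_gt0 (lt_trans ltr01).
    apply: (@lt_le_trans _ _ ((1 - 6 * dl)%:E)).
      have adl := mulr_gt0 a_gt0 dl0; have Qdl := mulr_gt0 (lt_le_trans ltr01 Q1) dl0.
      by rewrite lte_fin; move: dle adl Qdl dl0; clear; lra.
    apply: (@le_trans _ _ ((\sum_(0 <= i < n) (deep_cond X Pw t b i)%:E) * (L^-1)%:E)%E).
      rewrite sumEFin -EFinM lee_fin ler_pdivlMr// big_mkord.
      apply: le_trans (SD n).
      apply: (@le_trans _ _ ((L - dl * L) * (1 - 5 * dl))).
        have : 0 <= dl * dl * L by apply: mulr_ge0; [apply: mulr_ge0|]; exact: ltW.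
        by clear; lra.
      have dLL : dl * L <= 1 / 10 * L by rewrite ler_wpM2r// ltW.
      move: dLL L0 eta_le nP dl0 dl1 AL1 HL A1; clear => *.
      by apply: ler_pM; lra.
    rewrite lee_wpmul2r ?lee_fin ?invr_ge0 ?(ltW L0)//.
    apply: (@le_trans _ _ (\sum_(0 <= n <oo) (deep_cond X Pw t b n)%:E)%E).
      by apply: nneseries_lim_ge => i _ _; rewrite lee_fin.
    by rewrite leeDr.
  apply: (@le_lt_trans _ _ ((1 + 3 * dl)%:E)).
    rewrite lee_pdivrMr// -EFinM.
    apply: (@le_trans _ _ (1 + (A + Rb * H)%:E)%E).
      rewrite leeD2l//; apply: lime_le.
        by apply: is_cvg_nneseries => i _ _; rewrite lee_fin.
      by apply: nearW => n; rewrite sumEFin lee_fin big_mkord.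
    by rewrite -EFinD lee_fin; move: RH AL2 HL H1 (mulr_gt0 dl0 L0); clear; lra.
  have adl := mulr_gt0 a_gt0 dl0; have Qdl := mulr_gt0 (lt_le_trans ltr01 Q1) dl0.
  by rewrite lte_fin; move: dle adl Qdl dl0; clear; lra.
have aL0 : 0 <= a * L by rewrite mulr_ge0 ?(ltW a_gt0) ?(ltW L0).
rewrite (de_tailE walk wt t_gt1 (ltW a_gt0)) sc.
have /andP[N1 N2] := truncn_itv aL0.
set N := Num.trunc (a * L) in N1 N2 *.
have aL : 4 * dl * L <= a * L by rewrite ler_wpM2r// ltW.
have sN : (s < N)%N.
  rewrite -(ltr_nat R); rewrite -natr1 in N2.
  by move: sL N2 aL (mulr_gt0 dl0 L0); clear; lra.
have NE : N = (s + (N - s.+1)).+1 by rewrite -addSn subnKC.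
rewrite NE; exists (deep_cond X Pw t b (s + (N - s.+1))) => //.
have NR : (s + (N - s.+1))%:R + 1 = N%:R :> R by rewrite natr1 -NE.
have NR' : (N - s.+1)%:R = N%:R - s%:R - 1 :> R.
  by rewrite natrB// -[in s.+1%:R]natr1 opprD addrA.
move: (DU (N - s.+1)%N) (DD (s + (N - s.+1))%N) => U D.
have D1 : expR (- a) - 2 * a * dl <= (1 - A^-1) ^+ (s + (N - s.+1)).
  apply: (geom_lower (L := L)) => //.
    by move: AL1 HL; clear; lra.
  by move: NR N1; clear; lra.
have U1 : (1 - A^-1) ^+ (N - s.+1) <= expR (- a) + 2 * dl.
  apply: (geom_upper (L := L)) => //; rewrite NR'; rewrite -natr1 in N2.
  by move: N2 sL; clear; lra.
have RHs : Rb * (H / s%:R) <= Q * dl.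
  apply: ler_pM => //; first exact: le_trans ler01 R1.
  by rewrite divr_ge0// (le_trans ler01).
have adl := mulr_gt0 a_gt0 dl0; have Qdl := mulr_gt0 (lt_le_trans ltr01 Q1) dl0.
rewrite -mulrA in D1; rewrite -[2 * a * dl]mulrA in dle.
move: (_ ^+ (s + _)) (_ ^+ (N - _)) (Rb * _) (a * dl) (Q * dl) (expR _) (deep_cond _ _ _ _ _) (eta)
  U D D1 U1 RHs dle eta_le adl Qdl dl0; clear => y2 y1 z ad Qd e x et *.
by rewrite ltr_norml; apply/andP; split; lra.
Qed.

(** * Galton-Watson trees and their subtrees *)

Section RandomTreeCombinatorics.
Implicit Types (t s : {fset vertex}) (k : vertex -> nat) (u v : vertex).

Definition degree t v : nat :=
  xget 0%N [set n | forall j, (rcons v j \in t) = (1 <= j <= n)%N].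

Lemma degreeP t v j : is_plane_tree t -> v \in t ->
  (rcons v j \in t) = (1 <= j <= degree t v)%N.
Proof.
move=> tP vt; have [_ _ /(_ v vt) ex] := tP.
exact: (xgetPex 0%N ex j).
Qed.

Lemma degree_unique t v n : is_plane_tree t -> v \in t ->
  (forall j, (rcons v j \in t) = (1 <= j <= n)%N) -> degree t v = n.
Proof.
move=> tP vt H; have E j : (1 <= j <= degree t v)%N = (1 <= j <= n)%N.
  by rewrite -H degreeP.
apply/eqP; rewrite eqn_leq; apply/andP; split.
  have [->//|] := posnP (degree t v); move=> d0.
  by have := E (degree t v); rewrite d0 leqnn /= => /esym.
have [->//|n0] := posnP n.
by have := E n; rewrite n0 leqnn /= => ->.
Qed.

Lemma gw_vertices_rcons k u j :
  gw_vertices k (rcons u j) <-> gw_vertices k u /\ (1 <= j <= k u)%N.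
Proof.
split=> [H|[H ju] i].
  split=> [i iu|].
    have := H i; rewrite size_rcons ltnS (ltnW iu) => /(_ isT).
    by rewrite nth_rcons iu -cats1 takel_cat// ltnW.
  have := H (size u); rewrite size_rcons ltnSn => /(_ isT).
  by rewrite nth_rcons ltnn eqxx -cats1 take_size_cat.
rewrite size_rcons ltnS leq_eqVlt => /predU1P[->|iu].
  by rewrite nth_rcons ltnn eqxx -cats1 take_size_cat.
by rewrite nth_rcons iu -cats1 takel_cat ?(ltnW iu)//; exact: H.
Qed.

Lemma gw_vertices_nil k : gw_vertices k [::].
Proof. by move=> i. Qed.

Lemma gw_tree_finite k : gw_tree k != fset0 -> finite_set (gw_vertices k).
Proof.
apply: contraNP => inf; rewrite /gw_tree /fset_set; case: pselect => //.
Qed.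

Lemma mem_gw_tree k v : finite_set (gw_vertices k) ->
  (v \in gw_tree k) <-> gw_vertices k v.
Proof. by move=> fin; rewrite /gw_tree in_fset_set//; split=> [/set_mem|/mem_set]. Qed.

Lemma gw_tree_neq0 k : finite_set (gw_vertices k) -> gw_tree k != fset0.
Proof.
move=> fin; apply/eqP => e; have := gw_vertices_nil k.
by move/(mem_gw_tree _ fin); rewrite e.
Qed.

Lemma gw_tree_degree k v j : finite_set (gw_vertices k) -> v \in gw_tree k ->
  (rcons v j \in gw_tree k) = (1 <= j <= k v)%N.
Proof.
move=> fin /(mem_gw_tree _ fin) vG; apply/idP/idP => [/(mem_gw_tree _ fin)|jk].
  by move=> /gw_vertices_rcons[].
exact/(mem_gw_tree _ fin)/gw_vertices_rcons.
Qed.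

Lemma gw_tree_plane k : finite_set (gw_vertices k) -> is_plane_tree (gw_tree k).
Proof.
move=> fin; split.
- exact/(mem_gw_tree _ fin)/gw_vertices_nil.
- by move=> u j /(mem_gw_tree _ fin)/gw_vertices_rcons[? _]; exact/(mem_gw_tree _ fin).
- by move=> u uG; exists (k u) => j; exact: gw_tree_degree.
Qed.

(** The event that the random tree has a given shape only involves the
    finitely many offspring numbers of its vertices: its probability is a
    finite product. *)
Lemma gw_treeP k t : is_plane_tree t ->
  gw_tree k = t <-> (forall v, v \in t -> k v = degree t v).
Proof.
move=> tP; split=> [e v|H].
  have t0 : gw_tree k != fset0.
    by rewrite e; apply/eqP => t0; have := root_in tP; rewrite t0.
  have fin := gw_tree_finite t0.
  rewrite -e => vt; apply/esym/degree_unique => //; first exact: gw_tree_plane.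
  by move=> j; exact: gw_tree_degree.
have E v : gw_vertices k v <-> v \in t.
  elim/last_ind: v => [|v j IH].
    by split=> _; [exact: root_in|exact: gw_vertices_nil].
  rewrite gw_vertices_rcons; split=> [[/IH vt jk]|vt].
    by rewrite degreeP// -H.
  have v't : v \in t by have := parent_in tP vt; rewrite parent_rcons.
  by split; [exact/IH|rewrite H// -degreeP].
have fin : finite_set (gw_vertices k).
  by rewrite (_ : gw_vertices k = [set` t]) ?finite_fset//; apply/seteqP; split=> v /E.
by apply/fsetP => v; apply/idP/idP => [/(mem_gw_tree _ fin)/E|/E/(mem_gw_tree _ fin)].
Qed.

Definition sub_tree i t : {fset vertex} :=
  [fset behead v | v in [fset u in t | prefix [:: i] u]]%fset.

Lemma mem_sub_tree i t u : (u \in sub_tree i t) = (i :: u \in t).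
Proof.
apply/imfsetP/idP => [[v] /=|H]; last first.
  by exists (i :: u) => //=; rewrite !inE H /= eqxx prefix0s.
rewrite !inE /= => /andP[vt]; case: v vt => // j v vt.
by rewrite /= prefix0s andbT => /eqP -> /= ->.
Qed.

Lemma rcons_cons_eq i u j : rcons (i :: u) j = i :: rcons u j.
Proof. by []. Qed.

Lemma sub_tree_plane i t : is_plane_tree t -> [:: i] \in t ->
  is_plane_tree (sub_tree i t).
Proof.
move=> tP it; split; first by rewrite mem_sub_tree.
  move=> u j; rewrite !mem_sub_tree -rcons_cons_eq => /(parent_in tP).
  by rewrite parent_rcons.
move=> u; rewrite mem_sub_tree => iu; exists (degree t (i :: u)) => j.
by rewrite mem_sub_tree -rcons_cons_eq degreeP.
Qed.

Lemma sub_tree_degree i t u : is_plane_tree t -> [:: i] \in t -> i :: u \in t ->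
  degree (sub_tree i t) u = degree t (i :: u).
Proof.
move=> tP it iu; apply: degree_unique; first exact: sub_tree_plane.
  by rewrite mem_sub_tree.
by move=> j; rewrite mem_sub_tree -rcons_cons_eq degreeP.
Qed.

Lemma child_in t i : is_plane_tree t -> ([:: i] \in t) = (1 <= i <= degree t [::])%N.
Proof. by move=> tP; rewrite -[[:: i]]/(rcons [::] i) degreeP// root_in. Qed.

End RandomTreeCombinatorics.

(** * The spine of a subtree *)

Section SubTree.
Context {R : realType}.
Implicit Types (t s : {fset vertex}) (b : vertex -> R) (u v z : vertex).

Lemma big_sub_tree (M : Type) (idx : M) (op : Monoid.com_law idx) i t
    (F : vertex -> M) (p : pred vertex) :
  \big[op/idx]_(v <- sub_tree i t | p v) F (i :: v)
  = \big[op/idx]_(v <- t | prefix [:: i] v && p (behead v)) F v.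
Proof.
rewrite -big_filter -[RHS]big_filter -(big_map (cons i) xpredT F).
apply: perm_big; apply: uniq_perm.
- by rewrite map_inj_uniq ?filter_uniq ?fset_uniq// => x y [].
- by rewrite filter_uniq ?fset_uniq.
move=> v; rewrite mem_filter; apply/mapP/andP => [[u + ->]|[/andP[iv pv] vt]].
  by rewrite mem_filter mem_sub_tree => /andP[pu ut]; rewrite /= eqxx prefix0s.
case: v iv pv vt => // j v /=; rewrite prefix0s andbT => /eqP <- pv vt.
by exists v; rewrite // mem_filter mem_sub_tree pv.
Qed.

Lemma sum_sub_tree i t (F : vertex -> R) (p : pred vertex) :
  \sum_(v <- sub_tree i t | p v) F (i :: v)
  = \sum_(v <- t | prefix [:: i] v && p (behead v)) F v.
Proof. exact: big_sub_tree. Qed.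

Lemma sub_weight_cons i t b z :
  sub_weight t b (i :: z) = sub_weight (sub_tree i t) (b \o cons i) z.
Proof.
rewrite [RHS](eq_bigr (fun v => path_weight b (i :: z) (i :: v))); last first.
  by move=> v _; rewrite path_weight_cons.
rewrite (sum_sub_tree i t (path_weight b (i :: z))); apply: eq_bigl => v.
by case: v => // j v /=; rewrite prefix0s andbT.
Qed.

Lemma tree_weight_sub i t b :
  tree_weight (sub_tree i t) (b \o cons i) = sub_weight t b [:: i].
Proof. by rewrite tree_weightE sub_weight_cons. Qed.

Lemma sum_offspring_cons i t z (F : vertex -> R) (p : pred vertex) :
  \sum_(w <- offspring t (i :: z) | p w) F w
  = \sum_(w <- offspring (sub_tree i t) z | p (i :: w)) F (i :: w).
Proof.
rewrite -big_filter -[RHS]big_filter -(big_map (cons i) xpredT F).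
apply: perm_big; apply: uniq_perm.
- by rewrite filter_uniq ?fset_uniq.
- by rewrite map_inj_uniq ?filter_uniq ?fset_uniq// => x y [].
move=> v; rewrite mem_filter; apply/andP/mapP => [[pv /offspringP[vt v0 pvE]]|[u]].
  have [j vE] := rcons_parent v0; rewrite pvE rcons_cons_eq in vE.
  exists (rcons z j) => //; rewrite mem_filter -vE pv; apply/offspringP.
  by rewrite mem_sub_tree -vE rcons_neq0 parent_rcons.
rewrite mem_filter => /andP[pu /offspringP[ut u0 puE]] ->; split=> //.
have [j uE] := rcons_parent u0; rewrite puE in uE.
by rewrite uE -rcons_cons_eq offspring_rcons rcons_cons_eq -uE -mem_sub_tree.
Qed.

Section VBase.
Variable t : {fset vertex}.
Hypothesis tP : is_plane_tree t.
Hypothesis t_gt1 : (0 < height t)%N.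

Definition base_child : nat := head 0%N (vbase t).

Lemma vbaseE : vbase t = base_child :: behead (vbase t).
Proof. by rewrite /base_child; case: (vbase t) (base_neq0 tP t_gt1). Qed.

Lemma base_child_in : [:: base_child] \in t.
Proof. by have := take_in tP 1 (base_in tP); rewrite vbaseE /= take0. Qed.

Lemma height_sub_tree : height (sub_tree base_child t) = (height t).-1.
Proof.
have sP := sub_tree_plane tP base_child_in.
have rs := root_in sP; have rt := root_in tP.
apply/eqP; rewrite eqn_leq; apply/andP; split.
  rewrite -size_vbase// -ltnS prednK//; have := vbase_in rs.
  by rewrite mem_sub_tree => /height_geq.
rewrite -(size_vbase rt) vbaseE /=; apply: height_geq.
by rewrite mem_sub_tree -vbaseE vbase_in.
Qed.

Lemma vbase_sub_tree : vbase (sub_tree base_child t) = behead (vbase t).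
Proof.
have sP := sub_tree_plane tP base_child_in.
have rs := root_in sP; have rt := root_in tP.
have [bs sbs mins] := vbase_spec rs; have [bt sbt mint] := vbase_spec rt.
have : ((vbase (sub_tree base_child t) : seqlexi nat) <= behead (vbase t))%O.
  apply: mins; first by rewrite mem_sub_tree -vbaseE.
  by rewrite height_sub_tree -sbt size_behead.
have : ((vbase t : seqlexi nat) <= base_child :: vbase (sub_tree base_child t))%O.
  apply: mint; first by rewrite -mem_sub_tree.
  by rewrite /= sbs height_sub_tree prednK.
rewrite {1}vbaseE lexi_cons lexx /= => H1 H2.
by apply/eqP; rewrite -[_ == _]/((_ : seqlexi nat) == _) eq_le H1 H2.
Qed.

End VBase.

Definition lossy (eps : R) (j : nat) t b : Prop :=
  eps * sub_weight t b (take j (vbase t)) <= spine_loss t b (take j (vbase t)).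

(** The spine of the tree continues as the spine of the subtree of its first
    vertex; inductions along the spine rest on this. *)
Lemma lossy_sub eps j t b : is_plane_tree t -> (0 < height t)%N ->
  lossy eps j.+1 t b = lossy eps j (sub_tree (base_child t) t) (b \o cons (base_child t)).
Proof.
move=> tP t_gt1; rewrite /lossy vbase_sub_tree//.
have -> : take j.+1 (vbase t) = base_child t :: take j (behead (vbase t)).
  by rewrite {1}vbaseE.
rewrite /spine_loss sub_weight_cons sum_offspring_cons.
under eq_bigr do rewrite sub_weight_cons.
rewrite (eq_bigl (fun w => prefix w (behead (vbase t)))) ?vbase_sub_tree// => w.
by rewrite {1}vbaseE// prefix_cons eqxx.
Qed.

Lemma geometric_tail (r : R) J n : 0 <= r -> r < 1 ->
  \sum_(i < n) (if (J <= i)%N then r ^+ i else 0) <= r ^+ J / (1 - r).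
Proof.
move=> r0 r1; have r10 : 0 < 1 - r by rewrite subr_gt0.
rewrite ler_pdivlMr//.
suff : (\sum_(i < n) (if (J <= i)%N then r ^+ i else 0)) * (1 - r) <= r ^+ J - r ^+ (maxn n J).
  by move=> H; apply: le_trans H _; rewrite gerBl exprn_ge0.
elim: n => [|n IH]; first by rewrite big_ord0 mul0r max0n subrr.
rewrite big_ord_recr /= mulrDl; have [Jn|nJ] := leqP J n; last first.
  rewrite mul0r addr0 (le_trans IH)//.
  by rewrite (maxn_idPr _) ?(ltnW nJ)// (maxn_idPr nJ).
rewrite (maxn_idPl Jn) in IH; rewrite (maxn_idPl (leqW Jn)) exprSr mulrBr mulr1.
lra.
Qed.

(** A loss at a vertex is at most the whole weight above it, and these weights
    decay geometrically: the losses above height [J] add up to the tail of a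
    geometric series, and the previous ones are a proportion [eps] of the
    whole series. *)
Lemma total_loss_le (eps q : R) J t b : is_plane_tree t -> 1 < q ->
  (forall v, v \in t -> v != [::] -> q <= b v) -> (0 < height t)%N -> 0 <= eps ->
  (forall j, (j < J)%N -> ~ lossy eps j.+1 t b) ->
  total_loss t b <= (eps + q^-1 ^+ J) / (1 - q^-1) * omega_star t b.
Proof.
move=> tP q1 bq t_gt1 eps0 nl; set r := q^-1.
have q0 : 0 < q by exact: lt_trans q1.
have r0 : 0 <= r by rewrite invr_ge0 ltW.
have r1 : r < 1 by rewrite invf_lt1.
have om0 := omega_gt0 tP q1 bq.
apply: (@le_trans _ _ (\sum_(i < size (vbase t)) (eps * (if (0 <= i)%N then r ^+ i else 0)
    + (if (J <= i)%N then r ^+ i else 0)) * omega_star t b)).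
  rewrite /total_loss /path_sum ler_sum// => i _.
  have W := sub_weight_spine_le tP q1 bq t_gt1 (ltn_ord i).
  have tt : take i.+1 (vbase t) \in t by apply: (take_in tP); exact: base_in.
  have W0 := sub_weight_ge0 tP q1 bq (take i.+1 (vbase t)).
  have [Ji|iJ] := leqP J i; rewrite leq0n ?addr0.
    apply: (le_trans (spine_loss_le tP q1 bq tt)); apply: (le_trans W).
    by rewrite ler_wpM2r ?(ltW om0)// lerDr mulr_ge0// exprn_ge0.
  have /negP := nl i iJ; rewrite -ltNge => /ltW H; apply: (le_trans H).
  by rewrite -mulrA ler_wpM2l.
rewrite -mulr_suml ler_wpM2r ?(ltW om0)// big_split /= -mulr_sumr mulrDl lerD//.
  rewrite ler_wpM2l//; have := geometric_tail 0 (size (vbase t)) r0 r1.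
  by rewrite expr0 div1r.
exact: geometric_tail.
Qed.

End SubTree.

(** * Events of a weighted tree *)

(** These rectangles constrain finitely many biases only, and the law of the
    biases given the shape is a product on them. They generate the events that
    depend on the biases of the edges of [t]. *)
Definition bias_rects {R : realType} (t : {fset vertex}) : set (set (vertex -> R)) :=
  [set E | exists2 A : vertex -> set (measurableTypeR R), (forall v, measurable (A v)) &
     E = [set b | forall v, v \in t -> v != [::] -> A v (b v)]].

Definition bias_event {R : realType} (t : {fset vertex}) (E : set (vertex -> R)) :=
  <<s bias_rects t >> E.

Notation bias_space R t := (g_sigma_algebraType (@bias_rects R t)).

Section BiasEvents.
Context {R : realType}.
Implicit Types (t s : {fset vertex}).

Lemma bias_rects_setI t : setI_closed (@bias_rects R t).
Proof.
move=> _ _ [A mA ->] [A' mA' ->]; exists (fun v => A v `&` A' v).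
  by move=> v; exact: measurableI.
apply/seteqP; split=> b /=; first by move=> [H H'] v vt v0; split; [exact: H|exact: H'].
by move=> H; split=> v vt v0; have [] := H v vt v0.
Qed.

Lemma bias_event_rect t (A : vertex -> set (measurableTypeR R)) :
  (forall v, measurable (A v)) ->
  bias_event t [set b | forall v, v \in t -> v != [::] -> A v (b v)].
Proof. by move=> mA; apply: sub_gen_smallest; exists A. Qed.

Lemma bias_coord_measurable t v : v \in t -> v != [::] ->
  measurable_fun setT ((fun b => b v) : bias_space R t -> measurableTypeR R).
Proof.
move=> vt v0 _ A mA; rewrite setTI.
have := @bias_event_rect t (fun w => if w == v then A else setT).
rewrite /bias_event (_ : [set b | _] = (fun b => b v) @^-1` A); first apply.
  by move=> w; case: ifP.
apply/seteqP; split=> b /=.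
  by move=> /(_ v vt v0); rewrite eqxx.
by move=> Ab w wt w0; case: eqVneq => // ->.
Qed.

Lemma bias_shift_measurable t i : is_plane_tree t -> [:: i] \in t ->
  measurable_fun setT ((fun b => b \o cons i) : bias_space R t -> bias_space R (sub_tree i t)).
Proof.
move=> tP it; apply: (@measurability _ _ (bias_space R t) (bias_space R (sub_tree i t)) _ _
  (bias_rects (sub_tree i t))) => //.
move=> _ [_ [A mA ->] <-]; rewrite setTI.
have := @bias_event_rect t (fun w => if w is j :: u then (if (j == i) && (u != [::]) then A u else setT) else setT).
rewrite /bias_event.
rewrite (_ : [set b | _] = (fun b : vertex -> R => b \o cons i) @^-1`
   [set b | forall v, v \in sub_tree i t -> v != [::] -> A v (b v)]); first apply.
  by move=> [//|j u]; case: ifP.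
apply/seteqP; split=> b /= H v.
  by rewrite mem_sub_tree => vt v0; have := H (i :: v) vt isT; rewrite eqxx v0.
case: v => // j u vt _; case: ifP => // /andP[/eqP ji u0].
by rewrite ji in vt *; apply: H => //; rewrite mem_sub_tree.
Qed.

End BiasEvents.

(** There are countably many plane trees, so measurability can be required
    separately for each shape. *)
Definition tree_event {R : realType} (E : {fset vertex} -> (vertex -> R) -> Prop) :=
  forall t, is_plane_tree t -> bias_event t [set b | E t b].

Section TreeEvents.
Context {R : realType}.
Implicit Types (E : {fset vertex} -> (vertex -> R) -> Prop).

Lemma tree_event_and E E' : tree_event E -> tree_event E' ->
  tree_event (fun t b => E t b /\ E' t b).
Proof.
move=> mE mE' t tP; exact: (@measurableI _ (bias_space R t) _ _ (mE t tP) (mE' t tP)).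
Qed.

Lemma tree_event_not E : tree_event E -> tree_event (fun t b => ~ E t b).
Proof. by move=> mE t tP; exact: (@measurableC _ (bias_space R t) _ (mE t tP)). Qed.

Lemma bias_event_cst t (D : Prop) : bias_event t [set _ : vertex -> R | D].
Proof.
have [d|nd] := pselect D.
  rewrite (_ : [set _ | _] = setT); first exact: (@measurableT _ (bias_space R t)).
  by apply/seteqP; split.
rewrite (_ : [set _ | _] = set0); first exact: (@measurable0 _ (bias_space R t)).
by apply/seteqP; split.
Qed.

Lemma tree_event_shape (D : {fset vertex} -> Prop) : tree_event (fun t (_ : vertex -> R) => D t).
Proof. by move=> t _; exact: bias_event_cst. Qed.

Lemma tree_event_exists (I : countType) (F : I -> {fset vertex} -> (vertex -> R) -> Prop) :
  (forall i, tree_event (F i)) -> tree_event (fun t b => exists i, F i t b).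
Proof.
move=> mF t tP; rewrite (_ : [set b | _] = \bigcup_i [set b | F i t b]).
  by apply: (@countable_bigcupT_measurable _ (bias_space R t)) => // i; exact: mF.
by apply/seteqP; split=> b /= [i]; [exists i|move=> _; exists i].
Qed.

Lemma tree_event_ext E E' : (forall t b, is_plane_tree t -> E t b <-> E' t b) ->
  tree_event E -> tree_event E'.
Proof.
move=> EE mE t tP; have := mE t tP; congr (bias_event t _).
by apply/seteqP; split=> b /= /(EE t b tP).
Qed.

Lemma tree_event_or E E' : tree_event E -> tree_event E' ->
  tree_event (fun t b => E t b \/ E' t b).
Proof.
move=> mE mE'; apply: (@tree_event_ext (fun t b => exists i : bool, (if i then E else E') t b)).
  move=> t b _; split; first by case=> -[] H1; [left|right].
  by case=> H1; [exists true|exists false].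
by apply: tree_event_exists; case.
Qed.

Lemma tree_event_sub E i : tree_event E ->
  tree_event (fun t b => [:: i] \in t /\ E (sub_tree i t) (b \o cons i)).
Proof.
move=> mE t tP; have [it|nit] := boolP ([:: i] \in t); last first.
  rewrite (_ : [set b | _] = set0); first exact: (@measurable0 _ (bias_space R t)).
  by apply/seteqP; split=> // b [].
have := bias_shift_measurable tP it measurableT (mE _ (sub_tree_plane tP it)).
by rewrite setTI; congr (bias_event t _); apply/seteqP; split=> b /= => [|[]].
Qed.

Definition tree_fun (f : {fset vertex} -> (vertex -> R) -> R) :=
  forall t, is_plane_tree t -> measurable_fun setT (f t : bias_space R t -> R).

Lemma tree_event_le f g : tree_fun f -> tree_fun g -> tree_event (fun t b => f t b <= g t b).
Proof.
move=> mf mg t tP; have m1 : measurable [set true] by [].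
have := measurable_fun_ler (mf t tP) (mg t tP) measurableT (Y := [set true]).
rewrite setTI => /(_ m1).
by congr (bias_event t _); apply/seteqP; split=> b.
Qed.

Lemma tree_event_lt f g : tree_fun f -> tree_fun g -> tree_event (fun t b => f t b < g t b).
Proof.
move=> mf mg t tP; have m1 : measurable [set true] by [].
have := measurable_fun_ltr (mf t tP) (mg t tP) measurableT (Y := [set true]).
rewrite setTI => /(_ m1).
by congr (bias_event t _); apply/seteqP; split=> b.
Qed.

Lemma tree_fun_cst (c : {fset vertex} -> R) : tree_fun (fun t _ => c t).
Proof. by move=> t tP; exact: measurable_cst. Qed.

Lemma tree_funM f g : tree_fun f -> tree_fun g -> tree_fun (fun t b => f t b * g t b).
Proof. by move=> mf mg t tP; exact: measurable_funM (mf t tP) (mg t tP). Qed.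

End TreeEvents.

(** * Measurability of the quenched quantities *)

Section TreeFunctions.
Context {R : realType}.

Lemma measurable_invr : measurable_fun [set: R] (@GRing.inv R).
Proof.
rewrite (_ : @GRing.inv R = fun x => x * ((x ^+ 2) `^ (-1))); last first.
  apply/funext => x; rewrite powR_inv1 ?sqr_ge0//.
  have [->|x0] := eqVneq x 0; first by rewrite invr0 mul0r.
  by field.
apply: measurable_funM; first exact: measurable_id.
apply: (measurableT_comp (measurable_powR (-1))).
exact: exprn_measurable.
Qed.

Section FixedTree.
Variable t : {fset vertex}.
Hypothesis tP : is_plane_tree t.

Lemma measurable_sum_in (I : eqType) (s : seq I) (p : pred I)
    (F : I -> (vertex -> R) -> R) :
  (forall i, i \in s -> p i -> measurable_fun setT (F i : bias_space R t -> R)) ->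
  measurable_fun setT ((fun b => \sum_(i <- s | p i) F i b) : bias_space R t -> R).
Proof.
elim: s => [|i s IH] mF.
  rewrite (_ : (fun b => _) = cst 0); first exact: measurable_cst.
  by apply/funext => b; rewrite big_nil.
have ms : measurable_fun setT ((fun b => \sum_(i <- s | p i) F i b) : bias_space R t -> R).
  by apply: IH => j js; apply: mF; rewrite inE js orbT.
have [pi|pi] := boolP (p i).
  rewrite (_ : (fun b => _) = (fun b => F i b + \sum_(i <- s | p i) F i b)).
    by apply: measurable_funD => //; apply: mF; rewrite ?mem_head.
  by apply/funext => b; rewrite big_cons pi.
rewrite (_ : (fun b => _) = (fun b => \sum_(i <- s | p i) F i b))//.
by apply/funext => b; rewrite big_cons (negbTE pi).
Qed.

Lemma measurable_path_weight x v : v \in t ->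
  measurable_fun setT ((fun b => path_weight b x v) : bias_space R t -> R).
Proof.
move=> vt; apply: measurable_prod => i; rewrite mem_index_iota => /andP[_ iv].
apply: bias_coord_measurable; first exact: take_in.
by rewrite -size_gt0P size_takel.
Qed.

Lemma measurable_sub_weight z :
  measurable_fun setT ((fun b => sub_weight t b z) : bias_space R t -> R).
Proof. by apply: measurable_sum_in => v vt _; exact: measurable_path_weight. Qed.

Lemma measurable_bias_offspring v w : w \in offspring t v ->
  measurable_fun setT ((fun b => b w) : bias_space R t -> R).
Proof. by move=> /offspringP[wt w0 _]; exact: bias_coord_measurable. Qed.

Lemma measurable_spine_loss z :
  measurable_fun setT ((fun b => spine_loss t b z) : bias_space R t -> R).
Proof.
apply: measurable_funB; first exact: measurable_sub_weight.
apply: measurable_sum_in => w wo _; apply: measurable_funM.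
  exact: measurable_bias_offspring wo.
exact: measurable_sub_weight.
Qed.

Lemma measurable_resist v : v \in t ->
  measurable_fun setT ((fun b => resist t b v) : bias_space R t -> R).
Proof.
move=> vt; rewrite (_ : (fun b => _) = (fun b => \sum_(w <- t | (w != [::]) && prefix w v) dresist t b w)).
  2: by apply/funext => b; exact: sum_ancestors.
apply: measurable_sum_in => w wt _; apply: measurable_funM; first exact: measurable_cst.
apply: (measurableT_comp measurable_invr).
exact: measurable_path_weight.
Qed.

Lemma measurable_kernel v w :
  measurable_fun setT ((fun b => walk_kernel t b v w) : bias_space R t -> R).
Proof.
have mZ : measurable_fun setT ((fun b => \sum_(x <- offspring t v) b x) : bias_space R t -> R).
  by apply: measurable_sum_in => x xo _; exact: measurable_bias_offspring xo.
have mZ1 : measurable_fun setT ((fun b => (1 + \sum_(x <- offspring t v) b x)^-1) : bias_space R t -> R).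
  apply: (measurableT_comp measurable_invr); apply: measurable_funD => //; exact: measurable_cst.
have mbZ f : w \in offspring t v -> measurable_fun setT (f : bias_space R t -> R) ->
    measurable_fun setT ((fun b => b w * f b) : bias_space R t -> R).
  by move=> wo mf; apply: measurable_funM => //; exact: measurable_bias_offspring wo.
rewrite /walk_kernel; case: (boolP (w \in offspring t v)) => wo;
  case: (v == [::]); case: (w == parent v) => //=; try exact: measurable_cst;
  try exact: mbZ; apply: mbZ => //; exact: (measurableT_comp measurable_invr).
Qed.

Lemma measurable_kstep (f : (vertex -> R) -> vertex -> R) v :
  (forall w, w \in nonroot t -> measurable_fun setT ((fun b => f b w) : bias_space R t -> R)) ->
  measurable_fun setT
    ((fun b => kstep (nonroot t) (walk_kernel t b) (f b) v) : bias_space R t -> R).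
Proof.
move=> mf; apply: measurable_sum_in => w wV _; apply: measurable_funM; last exact: mf.
exact: measurable_kernel.
Qed.

End FixedTree.

(** The survival probabilities of the walk, as explicit functions of the
    biases, from which their measurability is read off. *)
Fixpoint surv_iter t (b : vertex -> R) n v : R :=
  if n is n'.+1 then kstep (nonroot t) (walk_kernel t b) (surv_iter t b n') v else 1.

Fixpoint deep_iter t (b : vertex -> R) n v : R :=
  if n is n'.+1 then
    (if v == vbase t then surv_iter t b n v
     else kstep (nonroot t) (walk_kernel t b) (deep_iter t b n') v)
  else deep_harm t b v.

Lemma measurable_surv_iter t n v : is_plane_tree t ->
  measurable_fun setT ((fun b => surv_iter t b n v) : bias_space R t -> R).
Proof.
move=> tP; elim: n v => [|n IH] v; first exact: measurable_cst.
exact: (@measurable_kstep t (fun b => surv_iter t b n) v (fun w _ => IH w)).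
Qed.

Lemma measurable_deep_iter t n v : is_plane_tree t -> v \in t ->
  measurable_fun setT ((fun b => deep_iter t b n v) : bias_space R t -> R).
Proof.
move=> tP; elim: n v => [|n IH] v vt.
  apply: measurable_funM; first exact: measurable_resist.
  apply: (measurableT_comp measurable_invr); apply: measurable_resist => //.
  exact/vbase_in/root_in.
rewrite /=; case: (v == vbase t); first exact: (measurable_surv_iter n.+1).
apply: (@measurable_kstep t (fun b => deep_iter t b n) v) => w; rewrite nonrootP => /andP[wt _].
exact: IH.
Qed.

Lemma tree_fun_weight : tree_fun (@tree_weight R).
Proof.
move=> t tP; rewrite (_ : tree_weight t = (fun b => sub_weight t b [::])).
  exact: measurable_sub_weight.
by apply/funext => b; exact: tree_weightE.
Qed.

Lemma tree_event_lossy eps j : tree_event (@lossy R eps j).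
Proof.
move=> t tP; apply: (@tree_event_le R (fun t b => eps * sub_weight t b (take j (vbase t)))
  (fun t b => spine_loss t b (take j (vbase t)))) => //.
  apply: tree_funM; first exact: (tree_fun_cst (fun=> eps)).
  by move=> s sP; exact: measurable_sub_weight.
by move=> s sP; exact: measurable_spine_loss.
Qed.

Definition scale_expr t (b : vertex -> R) : R :=
  2 * omega_star t b * resist t b (vbase t).

(** The terms are nonnegative on weighted trees ([de_mean_ratio_expr]); the
    maximum with zero makes the series one of nonnegative measurable functions
    of all biases. *)
Definition mean_ratio_expr t (b : vertex -> R) : \bar R :=
  ((1 + \sum_(0 <= n <oo)
      (Num.max 0 (deep_iter t b n (vchild t) * resist t b (vbase t)))%:E)
   * ((scale_expr t b)^-1)%:E)%E.

Lemma measurable_mean_ratio_expr t : is_plane_tree t ->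
  measurable_fun setT (mean_ratio_expr t : bias_space R t -> \bar R).
Proof.
move=> tP; have bt : vbase t \in t by exact/vbase_in/root_in.
apply: emeasurable_funM; last first.
  apply/measurable_EFinP; apply: (measurableT_comp measurable_invr).
  apply: measurable_funM; last exact: measurable_resist.
  apply: measurable_funM; first exact: measurable_cst.
  rewrite (_ : omega_star t = (fun b => sub_weight t b (vchild t))).
    exact: measurable_sub_weight.
  by apply/funext => b; exact: omega_starE.
apply: emeasurable_funD; first exact: measurable_cst.
apply: ge0_emeasurable_sum => n.
  by move=> b _ _; rewrite lee_fin le_max lexx.
move=> _; apply/measurable_EFinP; apply: measurable_maxr; first exact: measurable_cst.
apply: measurable_funM; last exact: measurable_resist.
apply: measurable_deep_iter => //; exact: (take_in tP).
Qed.

End TreeFunctions.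

Section ExplicitWalk.
Context {R : realType} {d' : measure_display} {S : measurableType d'}.
Variables (X : nat -> S -> vertex)
  (Pw : {fset vertex} -> (vertex -> R) -> vertex -> probability S R).
Hypothesis walk : is_biased_walk X Pw.
Variables (t : {fset vertex}) (b : vertex -> R).
Hypothesis wt : is_weighted_tree t b.
Hypothesis t_gt1 : (0 < height t)%N.

Lemma surv_iterE n v : v \in nonroot t -> surv_prob X Pw t b n v = surv_iter t b n v.
Proof.
elim: n v => [|n IH] v vV; first exact: surv_prob0.
rewrite (surv_probS walk wt t_gt1)//=; apply: eq_big_seq => w wV.
by rewrite IH.
Qed.

Lemma deep_iterE n v : v \in nonroot t -> deep_prob X Pw t b n v = deep_iter t b n v.
Proof.
elim: n v => [|n IH] v vV; first by rewrite (deep_prob_harm walk wt t_gt1).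
rewrite /=; case: eqVneq => [->|vb].
  by rewrite (deep_prob_base walk wt t_gt1) surv_iterE// (base_nonroot wt).
have vt : v \in t by move: vV; rewrite nonrootP => /andP[].
rewrite (deep_prob_step walk wt t_gt1)//=; apply: eq_big_seq => w wV.
by rewrite IH.
Qed.

Lemma de_mean_ratio_expr : de_mean_ratio X Pw t b = mean_ratio_expr t b.
Proof.
have tP : is_plane_tree t by case: wt.
rewrite (de_mean_ratioE walk wt t_gt1) /mean_ratio_expr (de_scaleE walk wt t_gt1).
congr ((1 + _) * _)%E; apply: eq_eseriesr => n _; congr (_%:E).
have vcV : vchild t \in nonroot t by rewrite nonrootP vchild_in// vchild_neq0.
rewrite /deep_cond -deep_iterE//; apply/esym/max_idPr.
by rewrite mulr_ge0 ?walk_prob_ge0// ltW// (resist_gt0 wt).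
Qed.

End ExplicitWalk.

(** * The law of the shape and of the biases *)

Section Fibers.
Context {R : realType} {d : measure_display} {W : measurableType d}.
Variable P : probability W R.

Definition prob (A : set W) : R := fine (P A).

Lemma probE A : measurable A -> P A = (prob A)%:E.
Proof. by move=> mA; rewrite /prob fineK// fin_num_measure. Qed.

Lemma prob_ge0 A : 0 <= prob A. Proof. exact: fine_ge0. Qed.

Lemma prob_le A A' : measurable A -> measurable A' -> A `<=` A' -> prob A <= prob A'.
Proof.
move=> mA mA' AA'; rewrite -lee_fin -!probE//.
by apply: le_measure => //; exact: mem_set.
Qed.

Lemma prob_le1 A : measurable A -> prob A <= 1.
Proof. by move=> mA; rewrite -lee_fin -probE// probability_le1. Qed.

Lemma prob_setC A : measurable A -> prob (~` A) = 1 - prob A.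
Proof.
move=> mA; apply/EFin_inj; rewrite EFinB -!probE//; last exact: measurableC.
exact: probability_setC.
Qed.

Lemma prob_setU A A' : measurable A -> measurable A' -> prob (A `|` A') <= prob A + prob A'.
Proof.
move=> mA mA'; rewrite -lee_fin EFinD -!probE//; last exact: measurableU.
exact: measureU2.
Qed.

(** Subadditivity bounds the first event by the sum over its pieces, and
    additivity compares the disjoint pieces of the second one with their
    union. *)
Lemma le_fibers (C : countType) (A A' : set W) (F F' : C -> set W) (c : R) :
  0 <= c -> measurable A -> measurable A' ->
  (forall x, measurable (F x)) -> (forall x, measurable (F' x)) ->
  (forall w, A w -> exists x, F x w) ->
  (forall x w, F' x w -> A' w) ->
  (forall x y w, F' x w -> F' y w -> x = y) ->
  (forall x, prob (F x) <= c * prob (F' x)) -> prob A <= c * prob A'.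
Proof.
move=> c0 mA mA' mF mF' AF F'A' dF' FF'.
pose G n := if choice.pickle_inv n is Some x then F x else set0.
pose G' n := if choice.pickle_inv n is Some x then F' x else set0.
have mG n : measurable (G n) by rewrite /G; case: choice.pickle_inv.
have mG' n : measurable (G' n) by rewrite /G'; case: choice.pickle_inv.
rewrite -lee_fin EFinM -!probE//.
apply: (@le_trans _ _ (\sum_(0 <= n <oo) P (G n))%E).
  apply: measure_sigma_subadditive => // w Aw; have [x Fx] := AF w Aw.
  by exists (choice.pickle x) => //; rewrite /G choice.pickleK_inv.
apply: (@le_trans _ _ (\sum_(0 <= n <oo) (c%:E * P (G' n)))%E).
  apply: lee_nneseries => // n _; rewrite /G /G'; case: choice.pickle_inv => [x|].
    by rewrite !probE// -EFinM lee_fin.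
  by rewrite measure0 mule0.
rewrite nneseriesZl// lee_wpmul2l ?lee_fin//.
rewrite -measure_semi_bigcup//; first last.
- exact: bigcupT_measurable.
- move=> i j _ _ [w []]; rewrite /G' -/G'.
  have := @choice.pickle_invK C i; have := @choice.pickle_invK C j.
  case: (choice.pickle_inv j) => [y|//] /= <-; case: (choice.pickle_inv i) => [x|//] /= <-.
  by move=> Fx Fy; rewrite (dF' _ _ _ Fx Fy).
apply: le_measure; [exact/mem_set/bigcupT_measurable|exact: mem_set|].
by move=> w [n _]; rewrite /G'; case: choice.pickle_inv => // x; exact: F'A'.
Qed.

End Fibers.

Section GaltonWatson.
Context {R : realType}.
Variables (h : nat -> R) (nu : probability (measurableTypeR R) R).
Context {d : measure_display} {W : measurableType d}.
Variables (P : probability W R) (K : vertex -> W -> nat) (B : vertex -> W -> R).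
Hypothesis GW : is_weighted_gw P h nu K B.

Local Notation T := (rand_tree K).
Local Notation b_ := (rand_bias B).
Local Notation pr := (prob P).
Implicit Types (t s : {fset vertex}) (E : {fset vertex} -> (vertex -> R) -> Prop).

Lemma rand_tree_plane w : T w != fset0 -> is_plane_tree (T w).
Proof. by move=> /gw_tree_finite; exact: gw_tree_plane. Qed.

Lemma plane_neq0 t : is_plane_tree t -> t != fset0.
Proof. by move=> tP; apply/eqP => t0; have := root_in tP; rewrite t0. Qed.

Lemma measurable_K v n : measurable [set w | K v w = n].
Proof.
case: GW => mK _ _ _ _; have m1 : measurable [set n] by [].
by have := mK v measurableT [set n] m1; rewrite setTI.
Qed.

Lemma measurable_forall (J : countType) (F : J -> set W) :
  (forall i, measurable (F i)) -> measurable [set w | forall i, F i w].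
Proof.
move=> mF; rewrite (_ : [set w | _] = ~` \bigcup_i ~` F i).
  by apply/measurableC/countable_bigcupT_measurable => // i; exact: measurableC.
by rewrite setC_bigcup; apply/seteqP; split=> w /= H i; [move=> _; rewrite setCK|have := H i I; rewrite setCK].
Qed.

Lemma measurable_K_on s (k : vertex -> nat) :
  measurable [set w | forall v, v \in s -> K v w = k v].
Proof.
rewrite (_ : [set w | _] = [set w | forall v, (if v \in s then [set w | K v w = k v] else setT) w]).
  by apply: measurable_forall => v; case: ifP => // _; exact: measurable_K.
apply/seteqP; split=> w /= H v; first by case: ifP => //; exact: H.
by move=> vs; have := H v; rewrite vs.
Qed.

Lemma rand_treeE t w : is_plane_tree t ->
  T w = t <-> (forall v, v \in t -> K v w = degree t v).
Proof. exact: gw_treeP. Qed.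

Lemma measurable_tree t : is_plane_tree t -> measurable [set w | T w = t].
Proof.
move=> tP; have := measurable_K_on t (degree t).
by congr (measurable _); apply/seteqP; split=> w /= /(rand_treeE w tP).
Qed.

Lemma measurable_rand_bias t : measurable_fun setT (b_ : W -> bias_space R t).
Proof.
case: GW => _ mB _ _ _.
apply: (@measurability _ _ W (bias_space R t) _ _ (bias_rects t)) => //.
move=> _ [_ [A mA ->] <-]; rewrite setTI.
rewrite (_ : _ @^-1` _ = [set w | forall v, (if (v \in t) && (v != [::]) then B v @^-1` A v else setT) w]).
  apply: measurable_forall => v; case: ifP => // _.
  by have := mB v measurableT (A v) (mA v); rewrite setTI.
apply/seteqP; split=> w /= H v; first by case: ifP => // /andP[]; exact: H.
by move=> vt v0; have := H v; rewrite vt v0.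
Qed.

Lemma measurable_bias_event t (E : set (vertex -> R)) : bias_event t E ->
  measurable [set w | E (b_ w)].
Proof. by move=> mE; have := @measurable_rand_bias t measurableT E mE; rewrite setTI. Qed.

Lemma measurable_bias_shift t i (E : set (vertex -> R)) : is_plane_tree t ->
  [:: i] \in t -> bias_event (sub_tree i t) E -> measurable [set w | E (b_ w \o cons i)].
Proof.
move=> tP it mE; have := bias_shift_measurable tP it measurableT mE.
by rewrite setTI => /(measurable_bias_event).
Qed.

(** Infinite trees are represented by the empty set, which is excluded. *)
Definition alive E : set W := [set w | T w != fset0 /\ E (T w) (b_ w)].

Lemma alive_tree E t : is_plane_tree t -> tree_event E ->
  measurable [set w | T w = t /\ E t (b_ w)].
Proof.
move=> tP mE; apply: (@measurableI _ _ [set w | T w = t] [set w | E t (b_ w)]).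
  exact: measurable_tree.
exact: measurable_bias_event (mE t tP).
Qed.

Lemma measurable_tree_pieces (E : {fset vertex} -> W -> Prop) :
  (forall t, is_plane_tree t -> measurable [set w | T w = t /\ E t w]) ->
  measurable [set w | T w != fset0 /\ E (T w) w].
Proof.
move=> mE.
rewrite (_ : [set w | _] = \bigcup_t [set w | is_plane_tree t /\ T w = t /\ E t w]).
  apply: countable_bigcupT_measurable => // t; have [tP|ntP] := pselect (is_plane_tree t).
    by have := mE t tP; congr (measurable _); apply/seteqP; split=> w /= => [|[]].
  by rewrite (_ : [set w | _] = set0)//; apply/seteqP; split=> // w [].
apply/seteqP; split=> w /=.
  by move=> [T0 EH]; exists (T w) => //; split=> //; exact: rand_tree_plane.
by move=> [t _ [tP [-> Et]]]; split=> //; exact: plane_neq0.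
Qed.

Lemma measurable_alive E : tree_event E -> measurable (alive E).
Proof.
move=> mE; apply: (@measurable_tree_pieces (fun t w => E t (b_ w))) => t tP.
exact: alive_tree.
Qed.

Lemma prob_seq_K (s : seq vertex) (k : vertex -> nat) : uniq s ->
  pr [set w | forall v, v \in s -> K v w = k v] = \prod_(v <- s) h (k v).
Proof. by case: GW => _ _ iid _ _ us; rewrite /prob iid. Qed.

Lemma prob_tree t : is_plane_tree t ->
  pr [set w | T w = t] = \prod_(v <- t) h (degree t v).
Proof.
move=> tP; rewrite -prob_seq_K ?fset_uniq//; congr pr.
by apply/seteqP; split=> w /= /(rand_treeE w tP).
Qed.

Lemma prob_tree_bias t (A : vertex -> set (measurableTypeR R)) :
  is_plane_tree t -> (forall v, measurable (A v)) ->
  pr [set w | T w = t /\ (forall v, v \in t -> v != [::] -> A v (b_ w v))]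
  = pr [set w | T w = t] * \prod_(v <- t | v != [::]) fine (nu (A v)).
Proof.
move=> tP; case: GW => _ _ _ cb _ mA; rewrite /prob (cb t A mA).
have fin v : nu (A v) \is a fin_num by rewrite fin_num_measure.
rewrite (eq_bigr (fun v => (fine (nu (A v)))%:E)); last by move=> v _; rewrite fineK.
by rewrite prodEFin fineM// fin_num_measure//; exact: measurable_tree.
Qed.

(** As functions of [E] both sides are finite measures, and they agree on the
    rectangles, where both are products over the edges of the subtree. *)
Lemma subtree_bias t j (E : set (vertex -> R)) : is_plane_tree t -> [:: j] \in t ->
  bias_event (sub_tree j t) E ->
  pr [set w | T w = t /\ E (b_ w \o cons j)] * pr [set w | T w = sub_tree j t]
  = pr [set w | T w = t] * pr [set w | T w = sub_tree j t /\ E (b_ w)].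
Proof.
move=> tP jt; set s := sub_tree j t; have sP : is_plane_tree s := sub_tree_plane tP jt.
have mt := measurable_tree tP; have ms := measurable_tree sP.
have m1 U : bias_event s U -> measurable [set w | T w = t /\ U (b_ w \o cons j)].
  move=> mU; apply: (@measurableI _ _ [set w | T w = t] [set w | U (b_ w \o cons j)]) => //.
  exact: measurable_bias_shift mU.
have m2 U : bias_event s U -> measurable [set w | T w = s /\ U (b_ w)].
  move=> mU; apply: (@measurableI _ _ [set w | T w = s] [set w | U (b_ w)]) => //.
  exact: measurable_bias_event mU.
pose Q (U : set (vertex -> R)) :=
  pr [set w | T w = t /\ U (b_ w \o cons j)] * pr [set w | T w = s]
  = pr [set w | T w = t] * pr [set w | T w = s /\ U (b_ w)].
apply: (@dynkin_induction _ (bias_space R s) (bias_rects s) Q) => //.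
- exact: bias_rects_setI.
- rewrite /Q; congr (pr _ * pr _); apply/seteqP; split=> w //=; by case.
- move=> _ [A mA ->]; rewrite /Q prob_tree_bias//.
  pose A' v : set (measurableTypeR R) :=
    if v is i :: u then (if (i == j) && (u != [::]) then A u else setT) else setT.
  have mA' v : measurable (A' v).
    by case: v => [|i u]; rewrite /A'; [exact: measurableT|case: ifP => _; [exact: mA|exact: measurableT]].
  rewrite (_ : [set w | _] = [set w | T w = t /\ forall v, v \in t -> v != [::] -> A' v (b_ w v)]); last first.
    apply/seteqP; split=> w /= [-> H]; split=> // v.
      case: v => // i u vt _; rewrite /A'; case: ifP => // /andP[/eqP ij u0].
      by rewrite ij in vt *; apply: H => //; rewrite mem_sub_tree.
    by rewrite mem_sub_tree => vt v0; have := H (j :: v) vt isT; rewrite /A' eqxx v0.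
  rewrite prob_tree_bias// -mulrA; congr (_ * _); rewrite mulrC; congr (_ * _).
  rewrite (bigID (fun v => prefix [:: j] v && (behead v != [::])))/= [X in _ * X]big1 ?mulr1.
    rewrite (eq_bigl (fun v => prefix [:: j] v && (behead v != [::]))); last first.
      by move=> v; case: v.
    rewrite -(big_sub_tree *%R j t (fun v => fine (nu (A' v))) (fun u => u != [::])).
    apply: eq_bigr => v v0.
    by rewrite /A' eqxx v0.
  move=> v /andP[v0 nv]; rewrite (_ : A' v = setT) ?probability_setT//.
  by case: v v0 nv => // i u _; rewrite prefix_cons prefix0s andbT /A' eq_sym => /negbTE ->.
- move=> U mU IH; rewrite /Q.
  have C (X Y : set W) : measurable X -> measurable Y -> pr (X `&` ~` Y) = pr X - pr (X `&` Y).
    move=> mX mY; rewrite -setDE /prob measureD ?fineB ?fin_num_measure//.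
      exact: measurableI.
    by rewrite ltey_eq fin_num_measure.
  have mUj : measurable [set w | U (b_ w \o cons j)] by exact: measurable_bias_shift mU.
  have mUs : measurable [set w | U (b_ w)] by exact: measurable_bias_event mU.
  have E1 : pr [set w | T w = t /\ (~` U) (b_ w \o cons j)]
    = pr [set w | T w = t] - pr [set w | T w = t /\ U (b_ w \o cons j)] := C _ _ mt mUj.
  have E2 : pr [set w | T w = s /\ (~` U) (b_ w)]
    = pr [set w | T w = s] - pr [set w | T w = s /\ U (b_ w)] := C _ _ ms mUs.
  by rewrite E1 E2 mulrBl mulrBr; congr (_ - _); exact: IH.
- move=> F mF tF IH; rewrite /Q.
  have tF' (f : W -> vertex -> R) (X : set W) : trivIset setT (fun n => X `&` [set w | F n (f w)]).
    by move=> i i' _ _ [w [[_ /= Fi] [_ Fj]]]; apply: tF => //; exists (f w); split.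
  have mX n := m1 _ (mF n); have mY n := m2 _ (mF n).
  have mFU : bias_event s (\bigcup_n F n) by exact: (@bigcupT_measurable _ (bias_space R s)).
  apply/EFin_inj; rewrite !EFinM -(probE P (m1 _ mFU)) -(probE P (m2 _ mFU)).
  have -> : [set w | T w = t /\ (\bigcup_n F n) (b_ w \o cons j)]
    = \bigcup_n [set w | T w = t /\ F n (b_ w \o cons j)].
    by apply/seteqP; split=> w /= => [[Tt [n _ Fn]]|[n _ [Tt Fn]]]; [exists n|split=> //; exists n].
  have -> : [set w | T w = s /\ (\bigcup_n F n) (b_ w)]
    = \bigcup_n [set w | T w = s /\ F n (b_ w)].
    by apply/seteqP; split=> w /= => [[Tt [n _ Fn]]|[n _ [Tt Fn]]]; [exists n|split=> //; exists n].
  rewrite !measure_semi_bigcup//; first last.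
  - exact: bigcupT_measurable.
  - exact: (tF' (fun w => b_ w \o cons j)).
  - exact: bigcupT_measurable.
  - exact: (tF' b_).
  rewrite muleC -!nneseriesZl//; apply: eq_eseriesr => n _.
  transitivity ((pr [set w | T w = s])%:E * (pr [set w | T w = t /\ F n (b_ w \o cons j)])%:E)%E.
    by congr (_ * _)%E; exact: (probE P (mX n)).
  transitivity ((pr [set w | T w = t])%:E * (pr [set w | T w = s /\ F n (b_ w)])%:E)%E.
    by rewrite -!EFinM; congr (_%:E); rewrite mulrC; exact: IH.
  by congr (_ * _)%E; apply/esym; exact: (probE P (mY n)).
Qed.

End GaltonWatson.

(** * Comparison of a tree with one of its subtrees *)

Section SubtreeBounds.
Context {R : realType}.
Variables (h : nat -> R) (nu : probability (measurableTypeR R) R).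
Context {d : measure_display} {W : measurableType d}.
Variables (P : probability W R) (K : vertex -> W -> nat) (B : vertex -> W -> R).
Hypothesis GW : is_weighted_gw P h nu K B.

Local Notation T := (rand_tree K).
Local Notation b_ := (rand_bias B).
Local Notation pr := (prob P).
Local Notation alive := (alive K B).
Implicit Types (t s : {fset vertex}) (E : {fset vertex} -> (vertex -> R) -> Prop).

Lemma measurable_shape (D : {fset vertex} -> Prop) :
  measurable [set w | T w != fset0 /\ D (T w)].
Proof. exact: (measurable_alive GW (tree_event_shape D)). Qed.

Section Child.
Variables (D : {fset vertex} -> Prop) (E : {fset vertex} -> (vertex -> R) -> Prop) (j : nat).
Hypothesis mE : tree_event E.
Hypothesis Dj : forall t, is_plane_tree t -> D t -> [:: j] \in t.

Let EF s := fun t (b : vertex -> R) => D t /\ sub_tree j t = s /\ E s (b \o cons j).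
Let DF s := fun t (b : vertex -> R) => D t /\ sub_tree j t = s.

Let mDF s : tree_event (DF s).
Proof. exact: (tree_event_shape (fun t => D t /\ sub_tree j t = s)). Qed.

Let mEF s : tree_event (EF s).
Proof.
apply: (@tree_event_ext _ (fun t b => DF s t b /\ ([:: j] \in t /\ E (sub_tree j t) (b \o cons j)))).
  move=> t b tP; rewrite /EF /DF; split=> [[[Dt e] [_ Et]]|[Dt [e Et]]].
    by rewrite -[in E s]e.
  by split=> //; rewrite e; split=> //; exact: Dj.
by apply: tree_event_and; [exact: mDF|exact: tree_event_sub].
Qed.

Let piece t s : is_plane_tree t -> 
  pr [set w | T w = t /\ EF s t (b_ w)] * pr [set w | T w = s]
  = pr [set w | T w = s /\ E s (b_ w)] * pr [set w | T w = t /\ DF s t (b_ w)].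
Proof.
move=> tP; have [[Dt e]|nD] := pselect (D t /\ sub_tree j t = s); last first.
  rewrite (_ : [set w | T w = t /\ EF s t _] = set0); last first.
    by apply/seteqP; split=> // w [_ [? []]] ? _; apply: nD.
  rewrite (_ : [set w | T w = t /\ DF s t _] = set0); last first.
    by apply/seteqP; split=> // w [_ ?]; apply: nD.
  by rewrite /prob measure0 mul0r mulr0.
have jt := Dj tP Dt; have mEs : bias_event (sub_tree j t) [set b | E s b].
  by rewrite e; apply: mE; rewrite -e; exact: sub_tree_plane.
have := subtree_bias GW tP jt mEs; rewrite e => H.
rewrite (_ : [set w | T w = t /\ EF s t _] = [set w | T w = t /\ E s (b_ w \o cons j)]); last first.
  by apply/seteqP; split=> w [Tt /=]; [move=> [_ [_ ?]]|].
rewrite (_ : [set w | T w = t /\ DF s t _] = [set w | T w = t]); last first.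
  by apply/seteqP; split=> w /= => [[]|].
by rewrite H mulrC.
Qed.

Let fibers (X Y : {fset vertex} -> (vertex -> R) -> Prop) (c : R) : 0 <= c ->
  tree_event X -> tree_event Y ->
  (forall t, is_plane_tree t -> pr [set w | T w = t /\ X t (b_ w)]
     <= c * pr [set w | T w = t /\ Y t (b_ w)]) ->
  pr (alive X) <= c * pr (alive Y).
Proof.
move=> c0 mX mY XY.
have mp (Z : {fset vertex} -> (vertex -> R) -> Prop) : tree_event Z ->
    forall t, measurable [set w | is_plane_tree t /\ T w = t /\ Z t (b_ w)].
  move=> mZ t; have [tP|ntP] := pselect (is_plane_tree t).
    have := alive_tree GW tP mZ.
    by congr (measurable _); apply/seteqP; split=> w /= => [|[]].
  by rewrite (_ : [set w | _] = set0)//; apply/seteqP; split=> // w [].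
apply: (@le_fibers _ _ _ P {fset vertex} _ _ (fun t => [set w | is_plane_tree t /\ T w = t /\ X t (b_ w)])
  (fun t => [set w | is_plane_tree t /\ T w = t /\ Y t (b_ w)])) => //.
- exact: (measurable_alive GW).
- exact: (measurable_alive GW).
- exact: mp.
- exact: mp.
- by move=> w [T0 Xw]; exists (T w); split=> //; exact: rand_tree_plane.
- by move=> t w [tP [Tt Yt]]; rewrite /alive /= Tt; split=> //; exact: plane_neq0.
- by move=> t t' w [_ [<- _]] [_ [<- _]].
move=> t; have [tP|ntP] := pselect (is_plane_tree t).
  have e (Z : {fset vertex} -> (vertex -> R) -> Prop) :
    [set w | is_plane_tree t /\ T w = t /\ Z t (b_ w)] = [set w | T w = t /\ Z t (b_ w)].
    by apply/seteqP; split=> w /= => [[]|].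
  by rewrite !e XY.
rewrite (_ : [set w | is_plane_tree t /\ T w = t /\ X t (b_ w)] = set0).
  by rewrite /prob measure0 mulr_ge0// prob_ge0.
by apply/seteqP; split=> // w [].
Qed.

(** Given the shape of the whole tree, the biases of the subtree follow the
    law of the biases given the shape of the subtree. A comparison of the laws
    of the shapes therefore extends to weighted trees. *)
Lemma subtree_upper (c : R) : 0 <= c ->
  (forall s, is_plane_tree s ->
     pr [set w | T w != fset0 /\ (D (T w) /\ sub_tree j (T w) = s)] <= c * pr [set w | T w = s]) ->
  pr (alive (fun t b => D t /\ E (sub_tree j t) (b \o cons j))) <= c * pr (alive E).
Proof.
move=> c0 Dc.
have mDE : tree_event (fun t (b : vertex -> R) => D t /\ E (sub_tree j t) (b \o cons j)).
  apply: (@tree_event_ext _ (fun t b => D t /\ ([:: j] \in t /\ E (sub_tree j t) (b \o cons j)))).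
    by move=> t b tP; split=> [[Dt []]//|[Dt Et]]; split=> //; split=> //; exact: Dj.
  by apply: tree_event_and; [exact: tree_event_shape|exact: tree_event_sub].
have mT s : measurable [set w | is_plane_tree s /\ T w = s /\ E s (b_ w)].
  have [sP|nsP] := pselect (is_plane_tree s).
    have := alive_tree GW sP mE.
    by congr (measurable _); apply/seteqP; split=> w /= => [|[]].
  by rewrite (_ : [set w | _] = set0)//; apply/seteqP; split=> // w [].
apply: (@le_fibers _ _ _ P {fset vertex} _ _ (fun s => alive (EF s))
  (fun s => [set w | is_plane_tree s /\ T w = s /\ E s (b_ w)])) => //.
- exact: (measurable_alive GW).
- exact: (measurable_alive GW).
- by move=> s; exact: (measurable_alive GW).
- by move=> w [T0 [Dw Ew]]; exists (sub_tree j (T w)).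
- by move=> s w [sP [Ts Es]]; rewrite /alive /= Ts; split=> //; exact: plane_neq0.
- by move=> s s' w [_ [<- _]] [_ [<- _]].
move=> s; have [sP|nsP] := pselect (is_plane_tree s); last first.
  rewrite (_ : alive (EF s) = set0); first by rewrite /prob measure0 mulr_ge0// prob_ge0.
  apply/seteqP; split=> // w [T0 [Dw [e _]]]; apply: nsP; rewrite -e.
  have TP := rand_tree_plane T0; apply: sub_tree_plane => //; exact: Dj.
rewrite (_ : [set w | is_plane_tree s /\ _] = [set w | T w = s /\ E s (b_ w)]); last first.
  by apply/seteqP; split=> w /= => [[]|].
have mTs := measurable_tree GW sP.
have [p0|p0] := eqVneq (pr [set w | T w = s]) 0.
  have H := Dc s sP; rewrite p0 mulr0 in H.
  have H2 : pr (alive (EF s)) <= pr [set w | T w != fset0 /\ (D (T w) /\ sub_tree j (T w) = s)].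
    apply: prob_le; [exact: (measurable_alive GW)|exact: (measurable_alive GW (mDF s))|].
    by move=> w [T0 [Dw [e _]]].
  by rewrite (le_trans (le_trans H2 H))// mulr_ge0// prob_ge0.
have pp : 0 < pr [set w | T w = s] by rewrite lt_def p0 prob_ge0.
have F0 := prob_ge0 P [set w | T w = s /\ E s (b_ w)].
have H : pr (alive (EF s)) <= (pr [set w | T w = s /\ E s (b_ w)] / pr [set w | T w = s]) * pr (alive (DF s)).
  apply: fibers => //; first by rewrite divr_ge0// ltW.
  move=> t tP; rewrite mulrAC ler_pdivlMr//; rewrite piece//.
apply: (le_trans H); rewrite mulrAC ler_pdivrMr// mulrC.
apply: le_trans (ler_wpM2r F0 (Dc s sP)) _.
by rewrite mulrAC.
Qed.

Lemma subtree_lower (c : R) : 0 <= c ->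
  (forall s, is_plane_tree s ->
     pr [set w | T w = s] <= c * pr [set w | T w != fset0 /\ (D (T w) /\ sub_tree j (T w) = s)]) ->
  pr (alive E) <= c * pr (alive (fun t b => D t /\ E (sub_tree j t) (b \o cons j))).
Proof.
move=> c0 Dc.
have mDE : tree_event (fun t (b : vertex -> R) => D t /\ E (sub_tree j t) (b \o cons j)).
  apply: (@tree_event_ext _ (fun t b => D t /\ ([:: j] \in t /\ E (sub_tree j t) (b \o cons j)))).
    by move=> t b tP; split=> [[Dt []]//|[Dt Et]]; split=> //; split=> //; exact: Dj.
  by apply: tree_event_and; [exact: tree_event_shape|exact: tree_event_sub].
have mT s : measurable [set w | is_plane_tree s /\ T w = s /\ E s (b_ w)].
  have [sP|nsP] := pselect (is_plane_tree s).
    have := alive_tree GW sP mE.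
    by congr (measurable _); apply/seteqP; split=> w /= => [|[]].
  by rewrite (_ : [set w | _] = set0)//; apply/seteqP; split=> // w [].
apply: (@le_fibers _ _ _ P {fset vertex} _ _
  (fun s => [set w | is_plane_tree s /\ T w = s /\ E s (b_ w)]) (fun s => alive (EF s))) => //.
- exact: (measurable_alive GW).
- exact: (measurable_alive GW).
- by move=> s; exact: (measurable_alive GW).
- by move=> w [T0 Ew]; exists (T w); split=> //; exact: rand_tree_plane.
- by move=> s w [T0 [Dw [e Ew]]]; split=> //; split=> //; rewrite e.
- by move=> s s' w [_ [_ [<- _]]] [_ [_ [<- _]]].
move=> s; have [sP|nsP] := pselect (is_plane_tree s); last first.
  rewrite (_ : [set w | _] = set0); first by rewrite /prob measure0 mulr_ge0// prob_ge0.
  by apply/seteqP; split=> // w [].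
rewrite (_ : [set w | is_plane_tree s /\ _] = [set w | T w = s /\ E s (b_ w)]); last first.
  by apply/seteqP; split=> w /= => [[]|].
have mTs := measurable_tree GW sP.
have F0 := prob_ge0 P [set w | T w = s /\ E s (b_ w)].
have [f0|f0] := eqVneq (pr [set w | T w = s /\ E s (b_ w)]) 0.
  by rewrite f0 mulr_ge0// prob_ge0.
have fp : 0 < pr [set w | T w = s /\ E s (b_ w)] by rewrite lt_def f0.
have H : pr (alive (DF s)) <= (pr [set w | T w = s] / pr [set w | T w = s /\ E s (b_ w)]) * pr (alive (EF s)).
  apply: fibers => //; first by rewrite divr_ge0// prob_ge0.
  move=> t tP; rewrite mulrAC ler_pdivlMr// [X in _ <= X]mulrC piece//.
  by rewrite mulrC.
have p0 : 0 < pr [set w | T w = s].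
  apply: lt_le_trans fp _; apply: prob_le => //; first exact: (alive_tree GW sP mE).
  by move=> w [].
have H2 := le_trans (Dc s sP) (ler_wpM2l c0 H).
move: (pr [set w | T w = s]) (pr [set w | T w = s /\ _]) (pr (alive _)) p0 fp H2 => p f x p0 fp.
rewrite (_ : c * (p / f * x) = p * (c * x / f)); last by ring.
by rewrite -[X in X <= _]mulr1 ler_pM2l// ler_pdivlMr// mul1r.
Qed.

End Child.
End SubtreeBounds.

(** * The branching property *)

Lemma gw_vertices_cons (k : vertex -> nat) i u :
  gw_vertices k (i :: u) <-> (1 <= i <= k [::])%N /\ gw_vertices (k \o cons i) u.
Proof.
split=> [H|[ik H]].
  by split=> [|j ju]; [exact: (H 0%N)|exact: (H j.+1)].
by move=> [|j] //= ju; exact: H.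
Qed.

Section ChildBounds.
Context {R : realType}.
Variables (h : nat -> R) (nu : probability (measurableTypeR R) R).
Context {d : measure_display} {W : measurableType d}.
Variables (P : probability W R) (K : vertex -> W -> nat) (B : vertex -> W -> R).
Hypothesis GW : is_weighted_gw P h nu K B.

Local Notation T := (rand_tree K).
Local Notation b_ := (rand_bias B).
Local Notation pr := (prob P).
Local Notation alive := (alive K B).
Implicit Types (t s : {fset vertex}) (E : {fset vertex} -> (vertex -> R) -> Prop).

Lemma h_ge0_gw n : 0 <= h n.
Proof.
have := prob_seq_K GW (s := [:: [::]]) (fun=> n) isT.
by rewrite big_seq1 => <-; exact: prob_ge0.
Qed.

Lemma degree_rand_tree w v : T w != fset0 -> v \in T w -> degree (T w) v = K v w.
Proof.
move=> T0 vT; have := (gw_treeP (fun v => K v w) (rand_tree_plane T0)).1 erefl v vT.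
exact: esym.
Qed.

(** The events concern the offspring numbers of disjoint sets of vertices: the
    root and the vertices of the two subtrees. *)
Lemma prob_two_subtrees k i j r s : is_plane_tree r -> is_plane_tree s -> i != j ->
  pr [set w | [/\ K [::] w = k, (forall v, v \in r -> K (i :: v) w = degree r v) &
       (forall v, v \in s -> K (j :: v) w = degree s v)]]
  = h k * pr [set w | T w = r] * pr [set w | T w = s].
Proof.
move=> rP sP ij; pose l := [::] :: map (cons i) r ++ map (cons j) s.
pose kk v := if v is i' :: u then (if i' == i then degree r u else degree s u) else k.
have ul : uniq l.
  rewrite /= mem_cat negb_or; apply/andP; split.
    by apply/andP; split; apply/mapP => -[].
  rewrite cat_uniq !map_inj_uniq ?fset_uniq//= ?andbT; try by move=> x y [].
  by apply/hasPn => x /mapP[u _ ->]; apply/mapP => -[v _ []] e; rewrite e eqxx in ij.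
have := prob_seq_K GW kk ul.
rewrite /l big_cons big_cat !big_map => E.
have -> : pr [set w | T w = s] = \prod_(v <- s) h (kk (j :: v)).
  by rewrite (prob_tree GW sP); apply: eq_bigr => v _; rewrite /kk eq_sym (negbTE ij).
rewrite (prob_tree GW rP).
have -> : \prod_(v <- r) h (degree r v) = \prod_(v <- r) h (kk (i :: v)).
  by apply: eq_bigr => v _; rewrite /kk eqxx.
rewrite -mulrA -E; congr pr; apply/seteqP; split=> w /=.
  move=> [K0 Kr Ks] v; rewrite inE => /predU1P[->//|].
  rewrite mem_cat => /orP[/mapP[u ur ->]|/mapP[u us ->]] /=; first by rewrite eqxx Kr.
  by rewrite eq_sym (negbTE ij) Ks.
move=> H; split=> [|v vr|v vs].
- by have := H [::]; rewrite mem_head => /(_ isT).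
- have := H (i :: v); rewrite /kk eqxx; apply.
  by rewrite inE mem_cat map_f ?orbT.
- have := H (j :: v); rewrite /kk eq_sym (negbTE ij); apply.
  by rewrite inE mem_cat (map_f _ vs) !orbT.
Qed.

Lemma prob_one_subtree k j s : is_plane_tree s ->
  pr [set w | K [::] w = k /\ (forall v, v \in s -> K (j :: v) w = degree s v)]
  = h k * pr [set w | T w = s].
Proof.
move=> sP; pose l := [::] :: map (cons j) s.
pose kk v := if v is _ :: u then degree s u else k.
have ul : uniq l.
  rewrite /=; apply/andP; split; first by apply/mapP => -[].
  by rewrite map_inj_uniq ?fset_uniq//; move=> x y [].
have := prob_seq_K GW kk ul.
rewrite /l big_cons big_map /= -(prob_tree GW sP) => <-.
congr pr; apply/seteqP; split=> w /=.
  by move=> [K0 Ks] v; rewrite inE => /predU1P[->//|/mapP[u us ->]]; exact: Ks.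
move=> H; split=> [|v vs].
  by have := H [::]; rewrite mem_head => /(_ isT).
by have := H (j :: v); rewrite inE map_f// orbT => /(_ isT).
Qed.

Lemma sub_tree_K w j s : T w != fset0 -> [:: j] \in T w -> sub_tree j (T w) = s ->
  forall v, v \in s -> K (j :: v) w = degree s v.
Proof.
move=> T0 jT <- v; rewrite mem_sub_tree => jv.
have TP := rand_tree_plane T0.
by rewrite sub_tree_degree// degree_rand_tree.
Qed.

Lemma measurable_K_sub j s : measurable [set w | forall v, v \in s -> K (j :: v) w = degree s v].
Proof.
rewrite (_ : [set w | _] = [set w | forall v, (if v \in s then [set w | K (j :: v) w = degree s v] else setT) w]).
  by apply: measurable_forall => v; case: ifP => // _; exact: (measurable_K GW).
apply/seteqP; split=> w /= H v; first by case: ifP => //; exact: H.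
by move=> vs; have := H v; rewrite vs.
Qed.

(** The subtree of a child has the law of the whole tree and is independent of
    the degree of the root. *)
Lemma child_upper k j E : tree_event E ->
  pr (alive (fun t b => (degree t [::] = k /\ [:: j] \in t) /\ E (sub_tree j t) (b \o cons j)))
  <= h k * pr (alive E).
Proof.
move=> mE; apply: (subtree_upper GW mE (D := fun t => degree t [::] = k /\ [:: j] \in t)).
- by move=> t tP [].
- exact: h_ge0_gw.
move=> s sP; rewrite -(prob_one_subtree k j sP); apply: prob_le.
- exact: (measurable_shape GW (fun t => (degree t [::] = k /\ [:: j] \in t) /\ sub_tree j t = s)).
- apply: measurableI; [exact: (measurable_K GW)|exact: measurable_K_sub].
move=> w [T0 [[dk jT] e]]; split; last exact: (sub_tree_K T0 jT e).
by rewrite -degree_rand_tree// root_in//; exact: rand_tree_plane.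
Qed.

(** The subtrees of two children are moreover independent of each other. *)
Lemma two_child_upper k i j (C : {fset vertex} -> Prop) E : tree_event E -> i != j ->
  pr (alive (fun t b => ([/\ degree t [::] = k, [:: i] \in t & [:: j] \in t] /\
         C (sub_tree i t)) /\ E (sub_tree j t) (b \o cons j)))
  <= h k * pr (alive (fun t _ => C t)) * pr (alive E).
Proof.
move=> mE ij.
apply: (subtree_upper GW mE (D := fun t => [/\ degree t [::] = k, [:: i] \in t & [:: j] \in t] /\ C (sub_tree i t))).
- by move=> t tP [[]].
- by rewrite mulr_ge0 ?h_ge0_gw// prob_ge0.
move=> s sP; rewrite mulrAC.
have mC : measurable (alive (fun t _ => C t)) by exact: (measurable_shape GW).
apply: (@le_fibers _ _ _ P {fset vertex} _ _
  (fun r => [set w | T w != fset0 /\ (([/\ degree (T w) [::] = k, [:: i] \in T w & [:: j] \in T w] /\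
         C (sub_tree i (T w))) /\ sub_tree j (T w) = s) /\ sub_tree i (T w) = r])
  (fun r => [set w | is_plane_tree r /\ T w = r /\ C r])) => //.
- by rewrite mulr_ge0 ?h_ge0_gw// prob_ge0.
- exact: (measurable_shape GW (fun t => ([/\ degree t [::] = k, [:: i] \in t & [:: j] \in t] /\ C (sub_tree i t)) /\ sub_tree j t = s)).
- move=> r; exact: (measurable_shape GW (fun t => (([/\ degree t [::] = k, [:: i] \in t & [:: j] \in t] /\ C (sub_tree i t)) /\ sub_tree j t = s) /\ sub_tree i t = r)).
- move=> r; have [rP|nrP] := pselect (is_plane_tree r).
    have [Cr|nC] := pselect (C r).
      have := measurable_tree GW rP.
      by congr (measurable _); apply/seteqP; split=> w /= => [|[_ []]].
    by rewrite (_ : [set w | _] = set0)//; apply/seteqP; split=> // w [_ []].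
  by rewrite (_ : [set w | _] = set0)//; apply/seteqP; split=> // w [].
- by move=> w [T0 H]; exists (sub_tree i (T w)).
- by move=> r w [rP [Tr Cr]]; rewrite /alive /= Tr; split=> //; exact: plane_neq0.
- by move=> r r' w [_ [<- _]] [_ [<- _]].
move=> r; have [[rP Cr]|nr] := pselect (is_plane_tree r /\ C r); last first.
  rewrite (_ : [set w | T w != fset0 /\ _] = set0).
    by rewrite /prob measure0 mulr_ge0// ?mulr_ge0 ?h_ge0_gw// fine_ge0.
  apply/seteqP; split=> // w [T0 [[[[_ iT _] Ci] _] e]]; apply: nr; rewrite -e; split=> //.
  by apply: sub_tree_plane => //; exact: rand_tree_plane.
rewrite (_ : [set w | is_plane_tree r /\ _] = [set w | T w = r]); last first.
  by apply/seteqP; split=> w /= => [[_ []]|].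
rewrite mulrAC -(prob_two_subtrees k rP sP ij); apply: prob_le.
- exact: (measurable_shape GW (fun t => (([/\ degree t [::] = k, [:: i] \in t & [:: j] \in t] /\ C (sub_tree i t)) /\ sub_tree j t = s) /\ sub_tree i t = r)).
- rewrite (_ : [set w | _] = [set w | K [::] w = k] `&` ([set w | forall v, v \in r -> K (i :: v) w = degree r v] `&` [set w | forall v, v \in s -> K (j :: v) w = degree s v])).
    apply: measurableI; first exact: (measurable_K GW).
    by apply: measurableI; exact: measurable_K_sub.
  by apply/seteqP; split=> w /= => [[]|[? []]].
move=> w [T0 [[[[dk iT jT] _] e] e']]; split.
- by rewrite -degree_rand_tree// root_in//; exact: rand_tree_plane.
- exact: (sub_tree_K T0 iT e').
- exact: (sub_tree_K T0 jT e).
Qed.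

(** With probability [h k * h 0 ^+ k.-1], the root has [k] children and all of
    them but the first are leaves; the subtree of the first child is then an
    independent copy of the random tree. *)
Lemma child_lower k E : tree_event E -> (0 < k)%N -> 0 < h k -> 0 < h 0%N ->
  pr (alive E) <= (h k * h 0%N ^+ k.-1)^-1 *
    pr (alive (fun t b => [:: 1%N] \in t /\ E (sub_tree 1 t) (b \o cons 1%N))).
Proof.
move=> mE k0 hk h0; have c0 : 0 < h k * h 0%N ^+ k.-1 by rewrite mulr_gt0// exprn_gt0.
apply: (subtree_lower GW mE (D := fun t => [:: 1%N] \in t)) => //.
  by rewrite invr_ge0 ltW.
move=> s sP; rewrite mulrC ler_pdivlMr//.
pose l := [::] :: map (cons 1%N) s ++ map (fun i => [:: i]) (iota 2 k.-1).
pose kk v := if v is i :: u then (if i == 1%N then degree s u else 0%N) else k.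
have ul : uniq l.
  rewrite /= mem_cat negb_or; apply/andP; split.
    by apply/andP; split; apply/mapP => -[].
  rewrite cat_uniq !map_inj_uniq ?fset_uniq ?iota_uniq//= ?andbT; try by move=> x y [].
  apply/hasPn => x /mapP[i]; rewrite mem_iota => /andP[i2 _] ->.
  by apply/mapP => -[v _ [e]]; rewrite e in i2.
have := prob_seq_K GW kk ul.
rewrite /l big_cons big_cat !big_map /=.
have -> : \prod_(v <- s) h (kk (1%N :: v)) = pr [set w | T w = s] by rewrite (prob_tree GW sP).
have -> : \prod_(i <- iota 2 k.-1) h (if i == 1%N then degree s [::] else 0%N) = h 0%N ^+ k.-1.
  rewrite (eq_big_seq (fun=> h 0%N)).
    by rewrite big_const_seq count_predT size_iota iter_mulr_1.
  by move=> i; rewrite mem_iota => /andP[i2 _]; case: eqP i2 => // ->.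
move=> E1; rewrite mulrCA -E1.
apply: prob_le.
- have := measurable_forall (J := seq nat) (F := fun v => if v \in l then [set w | K v w = kk v] else setT).
  move=> /(_ (fun v => _)) H; have := H _.
  rewrite (_ : [set w | forall i, _] = [set w | forall v, v \in l -> K v w = kk v]).
    by apply => v; case: ifP => // _; exact: (measurable_K GW).
  apply/seteqP; split=> w /= H' v; last by case: ifP => //; exact: H'.
  by move=> vl; have := H' v; rewrite vl.
- exact: (measurable_shape GW (fun t => [:: 1%N] \in t /\ sub_tree 1 t = s)).
move=> w /= Kw.
have K0 : K [::] w = k by have := Kw [::]; rewrite mem_head => /(_ isT).
have Ks v : v \in s -> K (1%N :: v) w = degree s v.
  by move=> vs; have := Kw (1%N :: v); rewrite /kk /=; apply; rewrite inE mem_cat map_f// orbT.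
have Ki i : (2 <= i <= k)%N -> K [:: i] w = 0%N.
  move=> /andP[i2 ik]; have := Kw [:: i]; rewrite /kk; case: eqP i2 => [->//|_ i2]; apply.
  rewrite inE mem_cat; apply/orP; right; apply/orP; right; apply: map_f.
  by rewrite mem_iota i2 /= addSn add1n prednK.
have T1 : gw_tree ((fun v => K v w) \o cons 1%N) = s by apply/gw_treeP.
have s0 := plane_neq0 sP; rewrite -T1 in s0; have fin1 := gw_tree_finite s0.
have G1 u : gw_vertices ((fun v => K v w) \o cons 1%N) u <-> u \in s.
  by rewrite -(mem_gw_tree u fin1) T1.
have sub : gw_vertices (fun v => K v w) `<=` [set` l].
  move=> [|i u]; first by rewrite /= mem_head.
  move=> /gw_vertices_cons[/andP[i1]]; rewrite K0 => ik Gu.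
  rewrite /= inE mem_cat; apply/orP; right; apply/orP.
  have [e|i1'] := eqVneq i 1%N.
    by left; rewrite e; apply: map_f; apply/G1; rewrite -e.
  right; have i2 : (2 <= i)%N by rewrite ltn_neqAle eq_sym i1' i1.
  case: u Gu => [_|j u]; last first.
    by move=> /gw_vertices_cons[]; rewrite /= Ki ?i2//; case: j.
  by apply: map_f; rewrite mem_iota i2 /= addSn add1n prednK.
have fin : finite_set (gw_vertices (fun v => K v w)).
  by apply: sub_finite_set sub _; exact: finite_seq.
have memT u : (1%N :: u \in T w) = (u \in s).
  apply/idP/idP => [/(mem_gw_tree _ fin)/gw_vertices_cons[_ /G1//]|/G1 us].
  by apply/(mem_gw_tree _ fin)/gw_vertices_cons; rewrite K0.
split; first exact: gw_tree_neq0.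
split; first by rewrite memT root_in.
by apply/fsetP => u; rewrite mem_sub_tree memT.
Qed.

End ChildBounds.

(** * Moments of the offspring law *)

Section OffspringLaw.
Context {R : realType}.
Variable h : nat -> R.
Hypothesis h_ge0 : forall k, 0 <= h k.

Lemma offspring0_gt0 : (\sum_(0 <= k <oo) (h k)%:E = 1)%E ->
  (\sum_(1 <= k <oo) (k%:R * h k)%:E < 1)%E -> 0 < h 0%N.
Proof.
move=> h1 hm; rewrite lt_def h_ge0 andbT; apply/eqP => h00.
move: hm; rewrite ltNge => /negP; apply; rewrite -h1.
rewrite (nneseries_split 0 1) => [|k _]; last by rewrite lee_fin.
rewrite big_nat1 h00 add0e add0n; apply: lee_nneseries => [k _ _|k _].
  by rewrite lee_fin.
rewrite lee_fin; case: k => [|k]; first by rewrite h00 mulr0.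
by rewrite ler_peMl// ler1n.
Qed.

Lemma offspring_gt0 : (0 < \sum_(1 <= k <oo) (k%:R * h k)%:E)%E ->
  exists2 k, (0 < k)%N & 0 < h k.
Proof.
move=> hm; apply: contrapT => nk; move: hm; rewrite eseries0 ?ltxx// => k k1 _.
congr (_%:E); suff -> : h k = 0 by rewrite mulr0.
apply/eqP; rewrite eq_le h_ge0 andbT leNgt; apply/negP => hk; apply: nk.
by exists k.
Qed.

Hypothesis h_tail : exists2 c : R, 0 < c & forall k : nat, (1 <= k)%N ->
  (\sum_(k <= l <oo) (h l)%:E <= (expR (- (c * k%:R)))%:E)%E.

Lemma offspring_exp : exists2 c : R, 0 < c & forall k, (1 <= k)%N -> h k <= expR (- (c * k%:R)).
Proof.
case: h_tail => c c0 H; exists c => // k k1; rewrite -lee_fin.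
apply: le_trans (H k k1).
apply: (@le_trans _ _ (\sum_(k <= i < k.+1) (h i)%:E)%E); first by rewrite big_nat1.
by apply: nneseries_lim_ge => i _ _; rewrite lee_fin.
Qed.

(** The exponential tail absorbs any power: [expR (c * k)] exceeds its Taylor
    term of order [j + 2]. *)
Lemma offspring_moment j : exists2 C : R, 0 < C &
  forall k, (1 <= k)%N -> h k * k%:R ^+ j <= C / k%:R ^+ 2.
Proof.
have [c c0 H] := offspring_exp.
exists ((j + 2)`!%:R / c ^+ (j + 2)); first by rewrite divr_gt0 ?exprn_gt0// ltr0n fact_gt0.
move=> k k1; have k0 : 0 < k%:R :> R by rewrite ltr0n.
have ck : 0 < c * k%:R by rewrite mulr_gt0.
have f0 : 0 < (j + 2)`!%:R :> R by rewrite ltr0n fact_gt0.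
have E : (c * k%:R) ^+ (j + 2) / (j + 2)`!%:R <= expR (c * k%:R).
  have H2 := expR_ge1Dxn j.+1 (ltW ck); apply: le_trans H2.
  by rewrite addn2 lerDr.
apply: (@le_trans _ _ (expR (- (c * k%:R)) * k%:R ^+ j)).
  by rewrite ler_wpM2r ?exprn_ge0 ?(ltW k0)// H.
rewrite expRN ler_pdivlMr ?exprn_gt0// -mulrA -exprD mulrC ler_pdivrMr ?expR_gt0//.
rewrite -(ler_pM2l (_ : 0 < c ^+ (j + 2) / (j + 2)`!%:R)); last by rewrite divr_gt0 ?exprn_gt0.
rewrite exprMn in E; apply: le_trans (_ : _ <= expR (c * k%:R)) _.
  by rewrite mulrAC.
rewrite le_eqVlt; apply/orP; left; apply/eqP; field.
by rewrite !gt_eqF// exprn_gt0.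
Qed.

Lemma sum_inv_sq L n : (1 <= L)%N -> \sum_(L.+1 <= k < n) (k%:R ^+ 2)^-1 <= L%:R^-1 :> R.
Proof.
move=> L1; have L0 : 0 < L%:R :> R by rewrite ltr0n.
have [nL|Ln] := leqP n L.+1; first by rewrite big_geq// invr_ge0 ltW.
suff H m : \sum_(L.+1 <= k < L.+1 + m) (k%:R ^+ 2)^-1 <= L%:R^-1 - (L + m)%:R^-1 :> R.
  rewrite -(subnKC (ltnW Ln)); apply: (le_trans (H _)).
  by rewrite gerBl invr_ge0 ler0n.
elim: m => [|m IH]; first by rewrite !addn0 big_geq// subrr.
rewrite addnS big_nat_recr ?leq_addr//=; apply: le_trans (lerD IH (lexx _)) _.
rewrite -addrA lerD2l addnS addSn.
have x0 : 0 < (L + m)%:R :> R by rewrite ltr0n addn_gt0 L1.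
rewrite -[(L + m).+1%:R]natr1; move: ((L + m)%:R) x0 => x x0.
rewrite -subr_ge0 (_ : _ - _ = (x * (x + 1) ^+ 2)^-1).
  by rewrite invr_ge0 mulr_ge0 ?exprn_ge0//; lra.
by field; rewrite !gt_eqF//; lra.
Qed.

Lemma offspring_moment_tail j (eps : R) : 0 < eps -> exists2 L, (1 <= L)%N &
  forall n, \sum_(L <= k < n) h k * k%:R ^+ j <= eps.
Proof.
move=> e0; have [C C0 H] := offspring_moment j.
pose L := (Num.trunc (C / eps)).+1.
exists L.+1 => // n.
have L0 : 0 < L%:R :> R by rewrite ltr0n.
have CL : C / L%:R <= eps.
  by rewrite ler_pdivrMr// mulrC -ler_pdivrMr// ltW// truncnS_gt.
apply: le_trans CL; apply: (@le_trans _ _ (\sum_(L.+1 <= k < n) C * (k%:R ^+ 2)^-1)).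
  rewrite big_nat [leRHS]big_nat ler_sum// => k /andP[Lk _]; apply: H.
  exact: leq_trans Lk.
by rewrite -mulr_sumr ler_wpM2l ?(ltW C0)// sum_inv_sq.
Qed.

Lemma offspring_moment_bound j : exists2 M : R, 0 < M &
  forall n, \sum_(0 <= k < n) h k * k%:R ^+ j <= M.
Proof.
have [L L1 HL] := offspring_moment_tail j ltr01.
have t0 k : 0 <= h k * k%:R ^+ j by rewrite mulr_ge0 ?exprn_ge0.
exists (\sum_(0 <= k < L) h k * k%:R ^+ j + 1).
  by rewrite ltr_wpDl// sumr_ge0.
move=> n; apply: (@le_trans _ _ (\sum_(0 <= k < maxn n L) h k * k%:R ^+ j)).
  by rewrite [leRHS](big_cat_nat (n := n)) ?leq_maxl//= lerDl sumr_ge0.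
by rewrite (big_cat_nat (n := L)) ?leq_maxr//= lerD2l HL.
Qed.

End OffspringLaw.

(** * Almost sure bounds on the biases *)

(** The complement of the support is covered by the null open intervals with
    rational endpoints, of which there are countably many. *)
Lemma support_interval {R : realType} (nu : probability (measurableTypeR R) R) (q Q : R) :
  msupport nu `<=` `[q, Q]%classic -> fine (nu `[q, Q]%classic) = 1.
Proof.
move=> supp; pose J : set (measurableTypeR R) := `[q, Q]%classic.
have mJ : measurable J by exact: measurable_itv.
pose I (p : rat * rat) : set (measurableTypeR R) := `]ratr p.1, ratr p.2[%classic.
have mI p : measurable (I p) by exact: measurable_itv.
pose F p : set (measurableTypeR R) := if `[< nu (I p) = 0%E >] then I p else set0.
have : prob nu (~` J) <= 0 * prob nu set0.
  apply: (@le_fibers _ _ _ nu (rat * rat)%type _ _ F (fun=> set0)) => //.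
  - exact: measurableC.
  - by move=> p; rewrite /F; case: ifP.
  - move=> x nJx; have : ~ msupport nu x by move=> /supp.
    rewrite /msupport /= => nS.
    have [U [oU Ux nU]] : exists U : set R, [/\ open U, U x & ~ (0 < nu U)%E].
      by apply: contrapT => H; apply: nS => U oU Ux; apply: contrapT => nU; apply: H; exists U.
    have : nbhs x U by exact: open_nbhs_nbhs.
    move=> /nbhs_ballP[e /= e0 eU].
    have xe1 : x - e < x by rewrite gtrBl.
    have xe2 : x < x + e by rewrite ltrDl.
    have [r1] := rat_in_itvoo xe1.
    rewrite in_itv /= => /andP[r1a r1b].
    have [r2] := rat_in_itvoo xe2.
    rewrite in_itv /= => /andP[r2a r2b].
    have sub : I (r1, r2) `<=` U.
      move=> y; rewrite /I /= in_itv /= => /andP[y1 y2]; apply: eU.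
      by rewrite /ball /= ltr_norml; apply/andP; split; lra.
    exists (r1, r2); rewrite /F ifT; first by rewrite /I /= in_itv /= r1b r2a.
    apply/asboolP; apply/eqP; rewrite eq_le measure_ge0 andbT.
    have : (nu U <= 0)%E by rewrite leNgt; exact/negP.
    apply: le_trans; apply: le_measure => //; apply: mem_set => //.
    exact: open_measurable.
  move=> p; rewrite mul0r /F; case: asboolP => [e|_]; last by rewrite /prob measure0.
  by rewrite /prob e.
rewrite mul0r prob_setC// => H; apply/eqP; rewrite eq_le -/(prob nu J).
by rewrite prob_le1//=; lra.
Qed.

Section Regularity.
Context {R : realType}.
Variables (h : nat -> R) (nu : probability (measurableTypeR R) R).
Context {d : measure_display} {W : measurableType d}.
Variables (P : probability W R) (K : vertex -> W -> nat) (B : vertex -> W -> R).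
Hypothesis GW : is_weighted_gw P h nu K B.

Local Notation T := (rand_tree K).
Local Notation b_ := (rand_bias B).
Local Notation pr := (prob P).
Local Notation alive := (alive K B).
Implicit Types (t s : {fset vertex}) (E : {fset vertex} -> (vertex -> R) -> Prop).

Variables (q Q : R).
Hypotheses (q_gt1 : 1 < q) (ltqQ : q < Q).
Hypothesis nu_supp : msupport nu `<=` `[q, Q]%classic.

Definition regular t (b : vertex -> R) : Prop :=
  forall v, v \in t -> v != [::] -> q <= b v <= Q.

Lemma tree_event_regular : tree_event regular.
Proof.
move=> t tP; have := @bias_event_rect R t (fun=> `[q, Q]%classic).
rewrite (_ : [set b | _] = [set b | regular t b]); first by apply=> v; exact: measurable_itv.
by apply/seteqP; split=> b /= H v vt v0; have := H v vt v0; rewrite /= in_itv.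
Qed.

Lemma not_regular0 : pr (alive (fun t b => ~ regular t b)) = 0.
Proof.
have mN := tree_event_not tree_event_regular.
have mp t : measurable [set w | is_plane_tree t /\ T w = t /\ ~ regular t (b_ w)].
  have [tP|ntP] := pselect (is_plane_tree t).
    have := alive_tree GW tP mN.
    by congr (measurable _); apply/seteqP; split=> w /= => [|[]].
  by rewrite (_ : [set w | _] = set0)//; apply/seteqP; split=> // w [].
apply/eqP; rewrite eq_le prob_ge0 andbT.
suff : pr (alive (fun t b => ~ regular t b)) <= 0 * pr set0 by rewrite mul0r.
apply: (@le_fibers _ _ _ P {fset vertex} _ _
  (fun t => [set w | is_plane_tree t /\ T w = t /\ ~ regular t (b_ w)]) (fun=> set0)) => //.
- exact: (measurable_alive GW).
- by move=> w [T0 nr]; exists (T w); split=> //; exact: rand_tree_plane.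
move=> t; rewrite mul0r; have [tP|ntP] := pselect (is_plane_tree t); last first.
  by rewrite (_ : [set w | _] = set0) ?/prob ?measure0//; apply/seteqP; split=> // w [].
have mt := measurable_tree GW tP.
have mr := alive_tree GW tP tree_event_regular.
have -> : [set w | is_plane_tree t /\ T w = t /\ ~ regular t (b_ w)]
  = [set w | T w = t] `\` [set w | T w = t /\ regular t (b_ w)].
  apply/seteqP; split=> w /= => [[_ [Tt nr]]|[Tt nr]].
    by split=> // -[].
  by split=> //; split=> // r; apply: nr.
have E : pr [set w | T w = t /\ regular t (b_ w)] = pr [set w | T w = t].
  have := prob_tree_bias GW tP (A := fun=> `[q, Q]%classic).
  rewrite (_ : [set w | T w = t /\ _] = [set w | T w = t /\ regular t (b_ w)]); last first.
    by apply/seteqP; split=> w /= [Tt H]; split=> // v vt v0; have := H v vt v0; rewrite /= in_itv.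
  move=> -> //; rewrite big1 ?mulr1// => v _; exact: support_interval.
rewrite /prob measureD//; last by rewrite ltey_eq fin_num_measure.
rewrite (_ : [set w | T w = t] `&` _ = [set w | T w = t /\ regular t (b_ w)]); last first.
  by apply/seteqP; split=> w /= => [[]|[]].
by rewrite fineB ?fin_num_measure// -!/(prob _ _) E subrr.
Qed.

Lemma almost_regular E : tree_event E ->
  pr (alive E) <= pr (alive (fun t b => regular t b /\ E t b)).
Proof.
move=> mE; have mrE := tree_event_and tree_event_regular mE.
have mN := tree_event_not tree_event_regular.
rewrite -[leRHS]addr0 -not_regular0.
apply: (@le_trans _ _ (pr (alive (fun t b => regular t b /\ E t b) `|` alive (fun t b => ~ regular t b)))).
  apply: prob_le; [exact: (measurable_alive GW)|apply: measurableU; exact: (measurable_alive GW)|].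
  move=> w [T0 Ew]; have [r|nr] := pselect (regular (T w) (b_ w)); first by left.
  by right.
by apply: prob_setU; exact: (measurable_alive GW).
Qed.

Lemma alive_le E E' : tree_event E -> tree_event E' ->
  (forall t b, is_plane_tree t -> E t b -> E' t b) -> pr (alive E) <= pr (alive E').
Proof.
move=> mE mE' EE'; apply: prob_le; [exact: (measurable_alive GW)|exact: (measurable_alive GW)|].
by move=> w [T0 Ew]; split=> //; apply: EE' => //; exact: rand_tree_plane.
Qed.

Lemma alive_or E E' E'' : tree_event E -> tree_event E' -> tree_event E'' ->
  (forall t b, is_plane_tree t -> E t b -> E' t b \/ E'' t b) ->
  pr (alive E) <= pr (alive E') + pr (alive E'').
Proof.
move=> mE mE' mE'' EE'; apply: le_trans (prob_setU P (measurable_alive GW mE') (measurable_alive GW mE'')).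
apply: prob_le; [exact: (measurable_alive GW)|apply: measurableU; exact: (measurable_alive GW)|].
move=> w [T0 Ew]; have := EE' _ _ (rand_tree_plane T0) Ew.
by case=> ?; [left|right].
Qed.

(** A union bound over the degree [k] of the root and over finitely many
    choices, indexed by [I k], of children at which something happens. *)
Lemma alive_sum (J : choiceType) E (I : nat -> seq J) (a : nat -> R) (F : nat -> J -> {fset vertex} -> (vertex -> R) -> Prop) (M : R) :
  tree_event E -> (forall k i, tree_event (F k i)) ->
  (forall t b, is_plane_tree t -> E t b -> exists2 i, i \in I (degree t [::]) & F (degree t [::]) i t b) ->
  (forall k i, i \in I k -> pr (alive (F k i)) <= a k) ->
  (forall n, \sum_(0 <= k < n) (size (I k))%:R * a k <= M) ->
  (forall k, 0 <= a k) ->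
  pr (alive E) <= M.
Proof.
move=> mE mF EF Fa SM a0.
pose G k := \big[setU/set0]_(i <- I k) alive (F k i).
have mG k : measurable (G k).
  by apply: bigsetU_measurable => i _; exact: (measurable_alive GW).
rewrite -lee_fin -(probE P (measurable_alive GW mE)).
apply: (@le_trans _ _ (\sum_(0 <= k <oo) P (G k))%E).
  apply: measure_sigma_subadditive => //; first exact: (measurable_alive GW).
  move=> w [T0 Ew]; have [i iI Fi] := EF _ _ (rand_tree_plane T0) Ew.
  exists (degree (T w) [::]) => //; rewrite /G -bigcup_seq.
  by exists i.
have PG k : (P (G k) <= ((size (I k))%:R * a k)%:E)%E.
  apply: (@le_trans _ _ (\sum_(i <- I k) P (alive (F k i)))%E).
    rewrite /G; elim: (I k) => [|i s IH]; first by rewrite !big_nil measure0.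
    rewrite !big_cons; apply: le_trans (measureU2 _ _ _) _ => //.
    - exact: (measurable_alive GW).
    - by apply: bigsetU_measurable => i' _; exact: (measurable_alive GW).
    by rewrite leeD2l.
  apply: (@le_trans _ _ (\sum_(i <- I k) (a k)%:E)%E).
    rewrite big_seq [leRHS]big_seq; apply: lee_sum => i iI.
    by rewrite (probE P (measurable_alive GW (mF k i))) lee_fin Fa.
  by rewrite sumEFin lee_fin big_const_seq count_predT iter_addr_0 mulr_natl.
apply: lime_le.
  by apply: is_cvg_nneseries => k _ _; exact: measure_ge0.
apply: nearW => n; apply: (@le_trans _ _ (\sum_(0 <= k < n) ((size (I k))%:R * a k)%:E)%E).
  by apply: lee_sum => k _; exact: PG.
by rewrite sumEFin lee_fin SM.
Qed.

End Regularity.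

(** * The tail of the weight and negligible events *)

Section RootDecomposition.
Context {R : realType}.
Implicit Types (t s : {fset vertex}) (b : vertex -> R).

Lemma tree_weight_rec t b : is_plane_tree t ->
  tree_weight t b = 1 + \sum_(i <- iota 1 (degree t [::]))
    b [:: i] * tree_weight (sub_tree i t) (b \o cons i).
Proof.
move=> tP; rewrite tree_weightE (sub_weight_rec b tP (root_in tP)); congr (_ + _).
rewrite -(big_map (fun i => [:: i]) xpredT (fun w => b w * tree_weight (sub_tree (head 0%N w) t) (b \o cons (head 0%N w)))).
rewrite (perm_big [seq [:: i] | i <- iota 1 (degree t [::])]) /=; last first.
  apply: uniq_perm; first exact: fset_uniq.
    by rewrite map_inj_uniq ?iota_uniq// => x y [].
  move=> w; apply/offspringP/mapP => [[wt w0 pw]|[i ii ->]].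
    have [j wE] := rcons_parent w0; rewrite pw in wE; exists j => //.
    by rewrite mem_iota add1n ltnS -child_in// -[[:: j]]wE.
  by split=> //; rewrite child_in//; move: ii; rewrite mem_iota add1n ltnS.
rewrite !big_map; apply: eq_bigr => i _; by rewrite tree_weight_sub.
Qed.

Lemma sum_gt_exists (k : nat) (f : nat -> R) (s : R) : 0 <= s ->
  s < \sum_(i <- iota 1 k) f i -> exists2 i, i \in iota 1 k & s / k%:R < f i.
Proof.
move=> s0 sf; apply: contrapT => nf; move: sf; apply/negP; rewrite -leNgt.
apply: (@le_trans _ _ (\sum_(i <- iota 1 k) s / k%:R)).
  rewrite big_seq [leRHS]big_seq ler_sum// => i ik; rewrite leNgt; apply/negP => fi.
  by apply: nf; exists i.
rewrite big_const_seq count_predT size_iota iter_addr_0 -[_ *+ k]mulr_natr.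
have [->|k0] := posnP k; first by rewrite mulr0.
by rewrite divfK// pnatr_eq0 -lt0n.
Qed.

Lemma height_sub_lt t i : is_plane_tree t -> [:: i] \in t ->
  (height (sub_tree i t) < height t)%N.
Proof.
move=> tP it; have rs := root_in (sub_tree_plane tP it).
have := vbase_in rs; rewrite mem_sub_tree => /height_geq.
by rewrite /= size_vbase.
Qed.

End RootDecomposition.

Section Negligible.
Context {R : realType}.
Variables (h : nat -> R) (nu : probability (measurableTypeR R) R).
Context {d : measure_display} {W : measurableType d}.
Variables (P : probability W R) (K : vertex -> W -> nat) (B : vertex -> W -> R).
Hypothesis GW : is_weighted_gw P h nu K B.

Local Notation T := (rand_tree K).
Local Notation b_ := (rand_bias B).
Local Notation pr := (prob P).
Local Notation alive := (alive K B).
Implicit Types (t s : {fset vertex}) (E : {fset vertex} -> (vertex -> R) -> Prop).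

Variables (q Q : R).
Hypotheses (q_gt1 : 1 < q) (ltqQ : q < Q).
Hypothesis nu_supp : msupport nu `<=` `[q, Q]%classic.
Hypothesis h_tail : exists2 c : R, 0 < c & forall k : nat, (1 <= k)%N ->
  (\sum_(k <= l <oo) (h l)%:E <= (expR (- (c * k%:R)))%:E)%E.
Hypothesis h0_gt0 : 0 < h 0%N.
Hypothesis h_branch : exists2 k, (0 < k)%N & 0 < h k.

Let q_gt0 : 0 < q. Proof. exact: lt_trans q_gt1. Qed.
Let Q_gt0 : 0 < Q. Proof. exact: lt_trans ltqQ. Qed.
Let Q_gt1 : 1 < Q. Proof. exact: lt_trans ltqQ. Qed.

Local Notation regular := (regular q Q).
Let mreg := @tree_event_regular R q Q.

Definition heavy (u : R) t (b : vertex -> R) : Prop := u < tree_weight t b.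

Lemma tree_event_heavy u : tree_event (heavy u).
Proof. exact: tree_event_lt (tree_fun_cst (fun=> u)) tree_fun_weight. Qed.

Lemma regular_sub t b i : is_plane_tree t -> [:: i] \in t -> regular t b ->
  regular (sub_tree i t) (b \o cons i).
Proof. by move=> tP it r v; rewrite mem_sub_tree => iv _; exact: r. Qed.

Lemma regular_geq t b : regular t b -> forall v, v \in t -> v != [::] -> q <= b v.
Proof. by move=> r v vt v0; have /andP[] := r v vt v0. Qed.

Lemma regular_weight_ge0 t b : is_plane_tree t -> regular t b -> 0 <= tree_weight t b.
Proof.
by move=> tP r; rewrite tree_weightE; exact: sub_weight_ge0 tP q_gt1 (regular_geq r) _.
Qed.

Lemma regular_weight_child t b i : is_plane_tree t -> regular t b -> [:: i] \in t ->
  q * tree_weight (sub_tree i t) (b \o cons i) <= tree_weight t b.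
Proof.
move=> tP r it; rewrite tree_weight_sub tree_weightE.
exact: (sub_weight_child tP q_gt1 (regular_geq r) it).
Qed.

Definition mass u := pr (alive (fun t b => regular t b /\ heavy u t b)).

Lemma mass_ge0 u : 0 <= mass u. Proof. exact: prob_ge0. Qed.

Lemma mass_le u v : u <= v -> mass v <= mass u.
Proof.
move=> uv; apply: (alive_le GW); try exact: tree_event_and (tree_event_heavy _).
by move=> t b _ [r H]; split=> //; exact: le_lt_trans H.
Qed.

(** Graft the tree of weight more than [u / q] above the first child of the
    root: its weight is multiplied by the bias of the new edge, at least [q]. *)
Lemma mass_step : exists2 C : R, 0 <= C & forall u, mass (u / q) <= C * mass u.
Proof.
case: h_branch => k k0 hk; exists (h k * h 0%N ^+ k.-1)^-1.
  by rewrite invr_ge0 mulr_ge0 ?exprn_ge0// ltW.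
move=> u; have mE := tree_event_and mreg (tree_event_heavy (u / q)).
apply: (le_trans (child_lower GW mE k0 hk h0_gt0)); rewrite ler_wpM2l//.
  by rewrite invr_ge0 mulr_ge0 ?exprn_ge0// ltW.
have mX := tree_event_sub 1 mE.
apply: (le_trans (almost_regular GW nu_supp mX)).
apply: (alive_le GW); [exact: tree_event_and|exact: tree_event_and (tree_event_heavy _)|].
move=> t b tP [r [it [_ H]]]; split=> //; apply: lt_le_trans (regular_weight_child tP r it).
by rewrite mulrC -ltr_pdivrMr.
Qed.

Lemma bernoulli_ineq (x : R) n : 0 <= x -> 1 + x *+ n <= (1 + x) ^+ n.
Proof.
move=> x0; elim: n => [|n IH]; first by rewrite mulr0n addr0 expr0.
rewrite exprS; apply: le_trans (_ : _ <= (1 + x) * (1 + x *+ n)) _.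
  rewrite mulrDl mul1r mulrDr mulr1 mulrS.
  have : 0 <= x * (x *+ n) by rewrite mulr_ge0 ?mulrn_wge0.
  lra.
by rewrite ler_wpM2l// addr_ge0.
Qed.

Lemma exists_power (x : R) : exists n, x <= q ^+ n.
Proof.
have q1 : 0 < q - 1 by rewrite subr_gt0.
exists (Num.trunc (x / (q - 1))).+1.
have := bernoulli_ineq (Num.trunc (x / (q - 1))).+1 (ltW q1); rewrite subrKC => H.
apply: le_trans H; rewrite -mulr_natr.
have := truncnS_gt (x / (q - 1)); rewrite ltr_pdivrMr// => H; lra.
Qed.

(** Iterate [mass_step] as many times as the powers of [q] need to reach [x];
    the resulting power of the constant is a power of [x]. *)
Lemma mass_growth : exists r, forall x u, 1 <= x -> 0 <= u ->
  mass (u / x) <= (q * x) ^+ r * mass u.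
Proof.
have [C C0 HC] := mass_step; have [r Cr] := exists_power C; exists r => x u x1 u0.
have x0 : 0 < x by exact: lt_le_trans x1.
have it n v : mass (v / q ^+ n) <= C ^+ n * mass v.
  elim: n v => [|n IH] v; first by rewrite expr0 divr1 expr0 mul1r.
  rewrite [q ^+ _]exprS invfM mulrA; apply: (le_trans (IH _)).
  by rewrite exprSr -mulrA ler_wpM2l ?exprn_ge0.
have ex : exists n, x <= q ^+ n by exact: exists_power.
have [n xn nmin] := ex_minnP ex.
have nx : q ^+ n <= q * x.
  case: n xn nmin => [|n] xn nmin; first by rewrite expr0 mulr_ege1// ltW.
  rewrite exprS ler_pM2l// leNgt; apply/negP => /ltW /nmin.
  by rewrite ltnn.
apply: (@le_trans _ _ (mass (u / q ^+ n))).
  by apply: mass_le; rewrite ler_wpM2l// lef_pV2// posrE exprn_gt0.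
apply: (le_trans (it n u)); rewrite ler_wpM2r ?mass_ge0//.
apply: (@le_trans _ _ ((q ^+ r) ^+ n)); first by rewrite lerXn2r// nnegrE ?exprn_ge0// ltW.
by rewrite exprAC lerXn2r// nnegrE ?exprn_ge0 ?mulr_ge0// ltW.
Qed.

Lemma plane_root : is_plane_tree [fset [::]]%fset.
Proof.
split; first by rewrite inE.
  by move=> u j; rewrite !inE; case: u.
by move=> u _; exists 0%N => j; rewrite inE; case: u j => [|? ?] [|j].
Qed.

(** The tree reduced to its root has weight one and positive probability;
    larger weights are reached by [mass_growth]. *)
Lemma mass_gt0 u : 0 < mass u.
Proof.
have H v : v < 1 -> 0 < mass v.
  move=> v1; apply: (@lt_le_trans _ _ (pr [set w | T w = [fset [::]]%fset])).
    rewrite (prob_tree GW plane_root) big_seq_fset1 (@degree_unique _ _ 0%N) ?inE//.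
      exact: plane_root.
    by move=> j; rewrite inE; case: j.
  apply: prob_le; first exact: (measurable_tree GW plane_root).
    exact: (measurable_alive GW (tree_event_and mreg (tree_event_heavy v))).
  move=> w /= Tw; split; first by rewrite Tw; exact: plane_neq0 plane_root.
  rewrite Tw; split; first by move=> x; rewrite inE => /eqP ->.
  by rewrite /heavy /tree_weight big_seq_fset1 path_weightxx.
have [u1|u1] := ltrP u 1; first exact: H.
have [r Hr] := mass_growth; have u0 : 0 <= u by exact: le_trans u1.
have x1 : 1 <= u + 1 by lra.
have := Hr _ _ x1 u0; apply: contraPT; rewrite -leNgt => m0.
apply/negP; rewrite -ltNge; apply: le_lt_trans (_ : 0 < _).
  by rewrite mulr_ge0_le0// exprn_ge0// mulr_ge0 ?(ltW q_gt0)//; lra.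
by apply: H; rewrite ltr_pdivrMr; lra.
Qed.

(** These are the events whose probability for the tree conditioned on a
    weight larger than [u] tends to zero as [u] grows. *)
Definition negl E : Prop := forall eta, 0 < eta -> exists u0, forall u, u0 <= u ->
  pr (alive (fun t b => (regular t b /\ E t b) /\ heavy u t b)) <= eta * mass u.

Let mREH E u : tree_event E -> tree_event (fun t b => (regular t b /\ E t b) /\ heavy u t b).
Proof. by move=> mE; apply: tree_event_and (tree_event_heavy u); exact: tree_event_and. Qed.

Lemma negl_le (v : R) E E' : tree_event E -> tree_event E' ->
  (forall t b, is_plane_tree t -> regular t b -> heavy v t b -> E t b -> E' t b) ->
  negl E' -> negl E.
Proof.
move=> mE mE' EE' nE eta /nE[u0 H]; exists (Num.max v u0) => u; rewrite ge_max => /andP[vu /H].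
apply: le_trans; apply: (alive_le GW); [exact: mREH|exact: mREH|].
by move=> t b tP [[r Et] hv]; split=> //; split=> //; apply: EE' => //; exact: le_lt_trans hv.
Qed.

Lemma negl_or E E' : tree_event E -> tree_event E' -> negl E -> negl E' ->
  negl (fun t b => E t b \/ E' t b).
Proof.
move=> mE mE' nE nE' eta e0; have e2 : 0 < eta / 2 by rewrite divr_gt0.
have [u0 H] := nE _ e2; have [u1 H'] := nE' _ e2.
exists (Num.max u0 u1) => u; rewrite ge_max => /andP[/H Hu /H' Hu'].
apply: (@le_trans _ _ (eta / 2 * mass u + eta / 2 * mass u)); last by lra.
apply: le_trans (lerD Hu Hu'); apply: (alive_or GW).
- by apply: mREH; exact: tree_event_or.
- exact: mREH.
- exact: mREH.
by move=> t b _ [[r [?|?]] hv]; [left|right].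
Qed.

Lemma negl_false : negl (fun _ _ => False).
Proof.
move=> eta e0; exists 0 => u _; rewrite (_ : alive _ = set0).
  by rewrite /prob measure0 mulr_ge0 ?mass_ge0// ltW.
by apply/seteqP; split=> // w [_ [[]]].
Qed.

Lemma sum_degree_tail (f : nat -> R) (L n : nat) (y : R) : (forall k, 0 <= f k) ->
  0 <= y -> \sum_(0 <= k < n) f k * (if (k < L)%N then y else 1)
  <= y * \sum_(0 <= k < n) f k + \sum_(L <= k < n) f k.
Proof.
move=> f0 y0; rewrite mulr_sumr [X in _ + X](big_nat_widenl L 0)//= [X in _ + X]big_mkcond -big_split /=.
rewrite ler_sum// => k _; rewrite ltnNge; case: leqP => _ /=; last by rewrite addr0 mulrC.
by rewrite mulr1 lerDr mulr_ge0.
Qed.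

(** If [E] and heaviness force a child whose subtree satisfies [E'] and has a
    weight of order [u] over the degree, then [E] inherits the negligibility
    of [E']. The law of the subtree costs a power of the degree by
    [mass_growth]; for bounded degrees [E'] is negligible at the level
    reached, and large degrees are controlled by the moments of the offspring
    law. *)
Lemma negl_child E E' (c v : R) : tree_event E -> tree_event E' -> 1 <= c ->
  (forall u t b, v <= u -> is_plane_tree t -> regular t b -> E t b -> heavy u t b ->
     exists i, [/\ [:: i] \in t, E' (sub_tree i t) (b \o cons i) &
       heavy (u / (c * (degree t [::])%:R)) (sub_tree i t) (b \o cons i)]) ->
  negl E' -> negl E.
Proof.
move=> mE mE' c1 EE' nE' eta e0; have c0 : 0 < c by exact: lt_le_trans c1.
have h_ge0 := h_ge0_gw GW.
have [r Hr] := mass_growth; pose A := (q * c) ^+ r.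
have A0 : 0 < A by rewrite exprn_gt0// mulr_gt0.
have [M M0 HM] := offspring_moment_bound h_ge0 h_tail r.+1.
have e1 : 0 < eta / 2 / A by rewrite !divr_gt0.
have [L L1 HL] := offspring_moment_tail h_ge0 h_tail r.+1 e1.
have L0 : 0 < L%:R :> R by rewrite ltr0n.
(* The degrees below [L] and above [L] each contribute at most half of [eta *
   mass u]. *)
pose eta' := eta / 2 / A / M; have e'0 : 0 < eta' by rewrite !divr_gt0.
have [u0 Hu0] := nE' _ e'0.
exists (Num.max (Num.max v 0) (Num.max u0 0 * (c * L%:R))) => u.
rewrite !ge_max => /andP[/andP[vu u_ge0] uL].
pose F k i t (b : vertex -> R) := (degree t [::] = k /\ [:: i] \in t) /\
  ((regular (sub_tree i t) (b \o cons i) /\ E' (sub_tree i t) (b \o cons i)) /\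
    heavy (u / (c * k%:R)) (sub_tree i t) (b \o cons i)).
pose a k := h k * k%:R ^+ r * (A * mass u) * (if (k < L)%N then eta' else 1).
apply: (alive_sum GW (I := fun k => iota 1 k) (F := F) (a := a)).
- exact: mREH.
- move=> k i; have mF := tree_event_sub i (mREH (u / (c * k%:R)) mE').
  have := tree_event_and (tree_event_shape (R := R) (fun t => degree t [::] = k)) mF.
  by apply: tree_event_ext => t b _; rewrite /F; split=> [[? []]|[[]]].
- move=> t b tP [[rt Et] hu]; have [i [it E'i hi]] := EE' u t b vu tP rt Et hu.
  exists i; first by rewrite mem_iota add1n ltnS -child_in.
  by split=> //; split=> //; split=> //; exact: regular_sub.
- move=> k i; rewrite mem_iota => /andP[i1 ik].
  have k1 : (1 <= k)%N by rewrite add1n ltnS in ik; exact: leq_trans ik.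
  have k1' : 1 <= k%:R :> R by rewrite ler1n.
  apply: (le_trans (child_upper GW k i (mREH (u / (c * k%:R)) mE'))).
  rewrite /a -!mulrA ler_wpM2l//.
  have mk : mass (u / (c * k%:R)) <= k%:R ^+ r * (A * mass u).
    apply: (le_trans (Hr _ _ _ u_ge0)); first by rewrite mulr_ege1.
    by rewrite mulrA [q * c * _]mulrC exprMn -mulrA.
  suff H : pr (alive (fun t b => (regular t b /\ E' t b) /\ heavy (u / (c * k%:R)) t b))
      <= (if (k < L)%N then eta' else 1) * mass (u / (c * k%:R)).
    apply: (le_trans H).
    rewrite [leRHS](_ : _ = (if (k < L)%N then eta' else 1) * (k%:R ^+ r * (A * mass u))); last first.
      by rewrite [RHS]mulrC !mulrA.
    by rewrite ler_wpM2l//; case: ifP => // _; exact: ltW.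
  case: ltnP => kL; last first.
    rewrite mul1r; apply: (alive_le GW); first exact: mREH.
      exact: tree_event_and (tree_event_heavy _).
    by move=> t b _ [[]].
  apply: Hu0; apply: (@le_trans _ _ (Num.max u0 0)); first by rewrite le_max lexx.
  rewrite ler_pdivlMr ?mulr_gt0//; last by rewrite ltr0n.
  apply: le_trans uL; rewrite ler_wpM2l ?le_max ?lexx ?orbT// ler_pM2l// ler_nat ltnW//.
- move=> n; rewrite (eq_bigr (fun k => A * mass u * (h k * k%:R ^+ r.+1 * (if (k < L)%N then eta' else 1)))); last first.
    by move=> k _; rewrite size_iota /a exprS; ring.
  rewrite -mulr_sumr.
  have := sum_degree_tail (f := fun k => h k * k%:R ^+ r.+1) L n _ (ltW e'0).
  move=> /(_ (fun k => mulr_ge0 (h_ge0 k) (exprn_ge0 _ (ler0n _ _)))) H.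
  apply: (@le_trans _ _ (A * mass u * (eta' * M + eta / 2 / A))).
    rewrite ler_wpM2l ?mulr_ge0 ?mass_ge0 ?(ltW A0)//; apply: (le_trans H).
    by rewrite lerD ?HL// ler_wpM2l ?(ltW e'0).
  rewrite le_eqVlt; apply/orP; left; apply/eqP; rewrite /eta'; field.
  by rewrite !gt_eqF.
move=> k; rewrite /a; apply: mulr_ge0; last by case: ifP => // _; exact: ltW.
apply: mulr_ge0; first by rewrite mulr_ge0 ?h_ge0 ?exprn_ge0 ?ler0n.
by rewrite mulr_ge0 ?mass_ge0 ?(ltW A0).
Qed.

(** Since [u >= 2], more than half of [u] is carried by the subtrees of the
    children, and one of them carries at least the average share. *)
Lemma heavy_child u t b : is_plane_tree t -> regular t b -> 2 <= u -> heavy u t b ->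
  exists2 i, [:: i] \in t & heavy (u / (2 * Q * (degree t [::])%:R)) (sub_tree i t) (b \o cons i).
Proof.
move=> tP r u2; rewrite /heavy tree_weight_rec// => hu.
have s2 : u / 2 < \sum_(i <- iota 1 (degree t [::])) b [:: i] * tree_weight (sub_tree i t) (b \o cons i).
  by lra.
have u20 : 0 <= u / 2 by rewrite divr_ge0//; lra.
have [i ik Hi] := sum_gt_exists u20 s2.
have it : [:: i] \in t by rewrite child_in//; move: ik; rewrite mem_iota add1n ltnS.
exists i => //; have k0 : 0 < (degree t [::])%:R :> R.
  by rewrite ltr0n; move: ik; rewrite mem_iota add1n ltnS => /andP[]; exact: leq_trans.
rewrite -mulrA invfM mulrA [Q * _]mulrC invfM mulrA ltr_pdivrMr//; apply: (lt_le_trans Hi).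
rewrite mulrC ler_wpM2l//; first exact: regular_weight_ge0 (sub_tree_plane tP it) (regular_sub tP it r).
by have /andP[] := r _ it isT.
Qed.

(** A heavy tree of small height has a child whose subtree is heavy and of
    smaller height. *)
Lemma negl_height M : negl (fun t _ => (height t < M)%N).
Proof.
elim: M => [|M IH].
  apply: (@negl_le 0 _ _ _ _ _ negl_false) => //; exact: tree_event_shape.
have c1 : 1 <= 2 * Q by have := Q_gt1; lra.
apply: (negl_child (v := 2) _ _ c1 _ IH); try exact: tree_event_shape.
move=> u t b u2 tP r hM hu; have [i it hi] := heavy_child tP r u2 hu.
by exists i; split=> //; exact: leq_trans (height_sub_lt tP it) hM.
Qed.

End Negligible.

(** * Losses along the spine are negligible *)

Section LossySpine.
Context {R : realType}.
Variables (h : nat -> R) (nu : probability (measurableTypeR R) R).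
Context {d : measure_display} {W : measurableType d}.
Variables (P : probability W R) (K : vertex -> W -> nat) (B : vertex -> W -> R).
Hypothesis GW : is_weighted_gw P h nu K B.

Local Notation T := (rand_tree K).
Local Notation pr := (prob P).
Local Notation alive := (alive K B).
Implicit Types (t s : {fset vertex}) (E : {fset vertex} -> (vertex -> R) -> Prop).

Variables (q Q : R).
Hypotheses (q_gt1 : 1 < q) (ltqQ : q < Q).
Hypothesis nu_supp : msupport nu `<=` `[q, Q]%classic.
Hypothesis h_tail : exists2 c : R, 0 < c & forall k : nat, (1 <= k)%N ->
  (\sum_(k <= l <oo) (h l)%:E <= (expR (- (c * k%:R)))%:E)%E.
Hypothesis h0_gt0 : 0 < h 0%N.
Hypothesis h_branch : exists2 k, (0 < k)%N & 0 < h k.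

Let q_gt0 : 0 < q. Proof. exact: lt_trans q_gt1. Qed.
Let Q_gt0 : 0 < Q. Proof. exact: lt_trans ltqQ. Qed.
Let Q_gt1 : 1 < Q. Proof. exact: lt_trans ltqQ. Qed.

Local Notation regular := (regular q Q).
Local Notation mass := (mass P K B q Q).
Local Notation negl := (negl P K B q Q).
Let mreg := @tree_event_regular R q Q.

Let mREH E u : tree_event E -> tree_event (fun t b => (regular t b /\ E t b) /\ heavy u t b).
Proof. by move=> mE; apply: tree_event_and (tree_event_heavy u); exact: tree_event_and. Qed.

(** Only finite trees are counted, so these events decrease to the empty one. *)
Lemma tall_rare (g : R) : 0 < g -> exists M, pr (alive (fun t _ => (M <= height t)%N)) <= g.
Proof.
move=> g0; pose F M := alive (fun t _ => (M <= height t)%N).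
have mF M : measurable (F M).
  exact: (measurable_alive GW (tree_event_shape (fun t => (M <= height t)%N))).
have := @nonincreasing_cvg_mu _ _ _ P F.
have F0 : \bigcap_M F M = set0.
  apply/seteqP; split=> // w H; have [_] := H (height (T w)).+1 I.
  by rewrite ltnn.
rewrite F0 measure0 => /(_ _ mF measurable0 _) H.
have : P \o F @ \oo --> 0%E.
  apply: H.
    by rewrite -ge0_fin_numE// fin_num_measure.
  move=> m n mn; apply/subsetPset => w [T0 nh]; split=> //; exact: leq_trans nh.
move=> /fine_cvgP[_] /cvgrPdist_le /(_ g g0) [N _ /(_ N (leqnn N))] /=.
rewrite sub0r normrN => HN; exists N; apply: le_trans HN; exact: ler_norm.
Qed.

Lemma spine_loss0E t b : is_plane_tree t -> (0 < height t)%N -> regular t b ->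
  spine_loss t b [::] = tree_weight t b -
    b [:: base_child t] * tree_weight (sub_tree (base_child t) t) (b \o cons (base_child t)).
Proof.
move=> tP t0 r; rewrite /spine_loss tree_weightE tree_weight_sub; congr (_ - _).
have := @sum_spine_offspring R t tP 0 (fun w => b w * sub_weight t b w).
rewrite take0 => -> //; last exact: size_base_gt0.
by rewrite {1 2}vbaseE//= take0.
Qed.

Lemma spine_loss0_other t b : is_plane_tree t -> (0 < height t)%N -> regular t b ->
  spine_loss t b [::] = 1 + \sum_(i <- iota 1 (degree t [::]) | i != base_child t)
    b [:: i] * tree_weight (sub_tree i t) (b \o cons i).
Proof.
move=> tP t0 r; rewrite spine_loss0E// tree_weight_rec// (bigD1_seq (base_child t))/= ?iota_uniq//.
  by ring.
by rewrite mem_iota add1n ltnS -child_in// base_child_in.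
Qed.

(** A loss at the root means that a child off the spine has a subtree of
    weight of order [u], while the subtree of the spine child is tall unless
    the whole tree is short. The two subtrees are independent, the second
    event has an arbitrarily small probability, and the first one costs a
    power of the degree times [mass u] by [mass_growth]; sum over the two
    children and the degree. *)
Lemma negl_lossy0 (eps : R) : 0 < eps -> negl (fun t b => lossy eps 0 t b).
Proof.
move=> eps0 eta e0.
have h_ge0 := h_ge0_gw GW.
have [r Hr] := mass_growth GW q_gt1 nu_supp h0_gt0 h_branch.
have eps'0 : 0 < Num.min eps 1 by rewrite lt_min eps0 ltr01.
(* The factor lost between the weight of the tree and that of the child off
   the spine: half of [eps * u], divided by the bias and by the degree. The
   minimum with one makes it at least one, as needed for [mass_growth]. *)
pose c := 2 * Q / Num.min eps 1.
have c1 : 1 <= c.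
  rewrite ler_pdivlMr// mul1r ge_min; apply/orP; right.
  by have := Q_gt1; lra.
have c0 : 0 < c by exact: lt_le_trans c1.
pose A := (q * c) ^+ r; have A0 : 0 < A by rewrite exprn_gt0// mulr_gt0.
have [M M0 HM] := offspring_moment_bound h_ge0 h_tail r.+2.
have g0 : 0 < eta / 2 / A / M by rewrite !divr_gt0.
have [N HN] := tall_rare g0; set g := pr _ in HN.
have g_ge0 : 0 <= g by exact: prob_ge0.
have e2 : 0 < eta / 2 by rewrite divr_gt0.
have [u0 Hu0] := negl_height GW q_gt1 ltqQ nu_supp h_tail h0_gt0 h_branch N.+1 e2.
exists (Num.max u0 (2 / Num.min eps 1)) => u; rewrite ge_max => /andP[/Hu0 Hu u2].
have u_ge0 : 0 <= u by apply: le_trans u2; rewrite divr_ge0// ltW.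
pose I k := [seq p : nat * nat <- allpairs pair (iota 1 k) (iota 1 k) | p.1 != p.2].
have sI k : (size (I k) <= k ^ 2)%N.
  by rewrite size_filter (leq_trans (count_size _ _))// size_allpairs size_iota.
pose mH k : {fset vertex} -> (vertex -> R) -> Prop := fun t b => regular t b /\ heavy (u / (c * k%:R)) t b.
have mmH k : tree_event (mH k) by exact: tree_event_and (tree_event_heavy _).
pose F k (p : nat * nat) t (b : vertex -> R) :=
  ([/\ degree t [::] = k, [:: p.1] \in t & [:: p.2] \in t] /\
     (N <= height (sub_tree p.1 t))%N) /\ mH k (sub_tree p.2 t) (b \o cons p.2).
pose X : {fset vertex} -> (vertex -> R) -> Prop := fun t b => (N < height t)%N /\ lossy eps 0 t b.
have mL := tree_event_lossy (R := R) eps 0.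
have mX : tree_event X.
  by apply: tree_event_and => //; exact: (tree_event_shape (fun t => (N < height t)%N)).
suff HX : pr (alive (fun t b => (regular t b /\ X t b) /\ heavy u t b)) <= eta / 2 * mass u.
  apply: (@le_trans _ _ (eta / 2 * mass u + eta / 2 * mass u)); last by lra.
  apply: le_trans (lerD Hu HX); apply: (alive_or GW).
  - exact: mREH.
  - by apply: mREH; exact: (tree_event_shape (fun t => (height t < N.+1)%N)).
  - exact: mREH.
  move=> t b _ [[rt Lt] hu]; have [hN|hN] := leqP (height t) N; [left|right] => //.
pose a k := h k * k%:R ^+ r * (A * mass u * g).
apply: (alive_sum GW (I := I) (F := F) (a := a)).
- exact: mREH.
- move=> k p; have mF := tree_event_sub p.2 (mmH k).
  have := tree_event_and (tree_event_shape (R := R) (fun t =>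
    [/\ degree t [::] = k, [:: p.1] \in t & [:: p.2] \in t] /\ (N <= height (sub_tree p.1 t))%N)) mF.
  by apply: tree_event_ext => t b _; rewrite /F; split=> [[? []]|[[[]]]].
- move=> t b tP [[rt [hN Lt]] hu].
  have t0 : (0 < height t)%N by exact: leq_ltn_trans hN.
  have bc := base_child_in tP t0.
  have Lt' : eps * tree_weight t b <= spine_loss t b [::].
    by move: Lt; rewrite /lossy take0 -tree_weightE.
  rewrite spine_loss0_other// in Lt'.
  have s2 : Num.min eps 1 * u / 2 < \sum_(i <- iota 1 (degree t [::]))
      (if i != base_child t then b [:: i] * tree_weight (sub_tree i t) (b \o cons i) else 0).
    rewrite -big_mkcond /=.
    have H1 : Num.min eps 1 * u <= eps * u by rewrite ler_wpM2r// ge_min lexx.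
    have H2 : eps * u < eps * tree_weight t b by rewrite ltr_pM2l.
    have H3 : 2 <= Num.min eps 1 * u by rewrite mulrC -ler_pdivrMr.
    by lra.
  have s0 : 0 <= Num.min eps 1 * u / 2 by rewrite divr_ge0// mulr_ge0// ltW.
  have [i ik] := sum_gt_exists s0 s2.
  have k0 : 0 < (degree t [::])%:R :> R.
    by rewrite ltr0n; move: ik; rewrite mem_iota add1n ltnS => /andP[]; exact: leq_trans.
  case: (eqVneq i (base_child t)) => /= [_ H|ib Hi].
    by move: H; rewrite ltNge divr_ge0// ltW.
  have it : [:: i] \in t by rewrite child_in//; move: ik; rewrite mem_iota add1n ltnS.
  exists (base_child t, i).
    rewrite mem_filter /= eq_sym ib; apply/allpairsP; exists (base_child t, i); split => //=.
    by rewrite mem_iota add1n ltnS -child_in.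
  split; first by split=> //=; rewrite height_sub_tree//; case: (height t) hN.
  split; first exact: regular_sub.
  rewrite /heavy /c.
  have E : u / (2 * Q / Num.min eps 1 * (degree t [::])%:R)
      = (Num.min eps 1 * u / 2 / (degree t [::])%:R) / Q.
    by field; rewrite !gt_eqF.
  rewrite E ltr_pdivrMr//; apply: (lt_le_trans Hi).
  rewrite mulrC ler_wpM2l//.
    exact: (regular_weight_ge0 q_gt1 (sub_tree_plane tP it) (regular_sub tP it rt)).
  by have /andP[] := rt _ it isT.
- move=> k [i j]; rewrite mem_filter /= => /andP[ij /allpairsP[[i' j'] /= [ik jk [ei ej]]]].
  subst i' j'.
  apply: (le_trans (two_child_upper GW k (fun t => (N <= height t)%N) (mmH k) ij)).
  rewrite -/g /a -!mulrA ler_wpM2l//.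
  have k1 : (1 <= k)%N.
    by move: ik; rewrite mem_iota add1n ltnS => /andP[]; exact: leq_trans.
  have k1' : 1 <= k%:R :> R by rewrite ler1n.
  have H : mass (u / (c * k%:R)) <= k%:R ^+ r * (A * mass u).
    apply: (le_trans (Hr _ _ _ u_ge0)); first by rewrite mulr_ege1.
    by rewrite mulrA [q * c * _]mulrC exprMn -mulrA.
  rewrite [leRHS](_ : _ = g * (k%:R ^+ r * (A * mass u))); first by rewrite ler_wpM2l.
  by rewrite [RHS]mulrC !mulrA.
- move=> n; apply: (@le_trans _ _ (A * mass u * g * M)).
    apply: (@le_trans _ _ (A * mass u * g * \sum_(0 <= k < n) h k * k%:R ^+ r.+2)); last first.
      by rewrite ler_wpM2l// !mulr_ge0 ?mass_ge0 ?(ltW A0).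
    rewrite mulr_sumr ler_sum// => k _.
    have e : A * mass u * g * (h k * k%:R ^+ r.+2) = (k%:R * k%:R) * a k.
      by rewrite /a !exprS; ring.
    rewrite e ler_wpM2r//.
      rewrite /a mulr_ge0//; first by rewrite mulr_ge0 ?h_ge0 ?exprn_ge0.
      by rewrite !mulr_ge0 ?mass_ge0 ?(ltW A0).
    by rewrite -natrM ler_nat.
  apply: (@le_trans _ _ (A * mass u * (eta / 2 / A / M) * M)).
    by rewrite ler_wpM2r ?(ltW M0)// ler_wpM2l// mulr_ge0 ?mass_ge0 ?(ltW A0).
  rewrite le_eqVlt; apply/orP; left; apply/eqP; field.
  by rewrite !gt_eqF.
move=> k; rewrite /a mulr_ge0//; first by rewrite mulr_ge0 ?h_ge0 ?exprn_ge0.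
by rewrite !mulr_ge0 ?mass_ge0 ?(ltW A0).
Qed.

(** By induction along the spine: if the root is not lossy, then the subtree
    of the spine child carries at least half of the weight, and its own losses
    are those of the tree one step further. *)
Lemma negl_lossy (eps : R) j : 0 < eps -> eps <= 2^-1 -> negl (fun t b => lossy eps j t b).
Proof.
move=> e0 e2; elim: j => [|j IH]; first exact: negl_lossy0.
have mL k := tree_event_lossy (R := R) eps k.
pose X : {fset vertex} -> (vertex -> R) -> Prop :=
  fun t b => ((0 < height t)%N /\ ~ lossy eps 0 t b) /\ lossy eps j.+1 t b.
have mX : tree_event X.
  apply: tree_event_and => //; apply: tree_event_and; last exact: tree_event_not.
  exact: (tree_event_shape (fun t => (0 < height t)%N)).
have c1 : 1 <= 2 * Q by have := Q_gt1; lra.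
have nX : negl X.
  apply: (negl_child GW q_gt1 nu_supp h_tail h0_gt0 h_branch (v := 0) mX (mL j) c1 _ IH).
  move=> u t b u0 tP r [[t0 nL] Lj] hu; exists (base_child t).
  have bc := base_child_in tP t0.
  split=> //; first by rewrite -lossy_sub.
  move: nL; rewrite /lossy take0 -tree_weightE => /negP; rewrite -ltNge spine_loss0E// => nL.
  have k1 : 1 <= (degree t [::])%:R :> R.
    by rewrite ler1n; move: bc; rewrite child_in// => /andP[]; exact: leq_trans.
  have w0 := regular_weight_ge0 q_gt1 (sub_tree_plane tP bc) (regular_sub tP bc r).
  have /andP[_ bQ] := r _ bc isT.
  rewrite /heavy; set w := tree_weight (sub_tree _ _) _ in nL w0 *.
  have H1 : b [:: base_child t] * w <= Q * w by rewrite ler_wpM2r.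
  have H2 : eps * tree_weight t b <= 2^-1 * tree_weight t b.
    by rewrite ler_wpM2r// (regular_weight_ge0 q_gt1 tP r).
  have H3 : u / 2 < Q * w by move: hu; rewrite /heavy; lra.
  apply: (@le_lt_trans _ _ (u / 2 / Q)); last by rewrite ltr_pdivrMr// [w * Q]mulrC.
  have -> : u / 2 / Q = u / (2 * Q) by rewrite invfM mulrA.
  rewrite ler_wpM2l// lef_pV2 ?posrE ?mulr_gt0 ?(lt_le_trans ltr01 k1)//.
  by rewrite ler_peMr// mulr_ge0// ltW.
have mS : tree_event (fun t (b : vertex -> R) => (height t < 1)%N).
  exact: (tree_event_shape (fun t => (height t < 1)%N)).
have nL0 := negl_lossy0 e0.
have nS := negl_height GW q_gt1 ltqQ nu_supp h_tail h0_gt0 h_branch 1.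
have nor := negl_or GW mX (tree_event_or (mL 0%N) mS) nX (negl_or GW (mL 0%N) mS nL0 nS).
apply: (negl_le GW (v := 0) (mL j.+1) (tree_event_or mX (tree_event_or (mL 0%N) mS)) _ nor).
move=> t b tP r _ Lj; have [t0|t0] := leqP 1 (height t); last by right; right.
have [L0|L0] := pselect (lossy eps 0 t b); first by right; left.
by left.
Qed.

Lemma negl_lossy_prefix (eps : R) J : 0 < eps -> eps <= 2^-1 ->
  negl (fun t b => exists j : 'I_J, lossy eps j.+1 t b).
Proof.
move=> e0 e2; have mL k := tree_event_lossy (R := R) eps k.
have mU n : tree_event (fun t b => exists j : 'I_n, lossy eps j.+1 t b).
  by apply: tree_event_exists => j; exact: mL.
elim: J => [|J IH].
  apply: (negl_le GW (v := 0) (mU _) (tree_event_shape (fun=> False)) _ (negl_false _ _ _ _ _)).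
  by move=> t b _ _ _ [[]].
have nJ := negl_lossy J.+1 e0 e2.
have mO : tree_event (fun t b => (exists j : 'I_J, lossy eps j.+1 t b) \/ lossy eps J.+1 t b).
  apply: tree_event_ext (mU J.+1) => t b _; split.
    move=> [j Lj]; have [jJ|jJ] := ltnP j J; first by left; exists (Ordinal jJ).
    by right; have -> : J = j by apply/eqP; rewrite eqn_leq jJ -ltnS ltn_ord.
  by case=> [[j Lj]|LJ]; [exists (widen_ord (leqnSn J) j)|exists ord_max].
apply: (negl_le GW (v := 0) (mU _) mO _ (negl_or GW (mU J) (mL J.+1) IH nJ)).
move=> t b _ _ _ [j Lj]; have [jJ|jJ] := ltnP j J; first by left; exists (Ordinal jJ).
by right; have -> : J = j by apply/eqP; rewrite eqn_leq jJ -ltnS ltn_ord.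
Qed.

End LossySpine.

(** * Conclusion *)

Lemma cvg_ereal_approx {R : realType} (f : R -> \bar R) (l : R) :
  (forall e, 0 < e -> exists u0, forall u, u0 <= u -> ((l - e)%:E <= f u <= (l + e)%:E)%E) ->
  f u @[u --> +oo] --> l%:E.
Proof.
move=> H; have near_u0 u0 (Q : R -> Prop) : (forall u, u0 <= u -> Q u) -> \forall u \near +oo, Q u.
  by move=> QH; exists u0; split=> [|u /ltW /QH//]; exact: num_real.
apply/fine_cvgP; split.
  have [u0 H1] := H 1 ltr01; apply: (near_u0 u0) => u /H1 /andP[fl fr].
  by rewrite fin_numElt (lt_le_trans _ fl) ?ltNyr// (le_lt_trans fr) ?ltry.
apply/cvgrPdist_le => e e0; have [u0 H1] := H e e0; apply: (near_u0 u0) => u /H1 /andP[].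
rewrite /=; case: (f u) => [x| |] //=; rewrite !lee_fin => fl fr.
by rewrite ler_norml; apply/andP; split; lra.
Qed.

Section Sandwich.
Context {R : realType} {d : measure_display} {W : measurableType d}.
Variable P : probability W R.

(** The integral of a nonnegative function is a supremum over the simple
    functions below it, which makes it monotone. This applies to the quenched
    tail probability, which is not known to be a measurable function of the
    tree. *)
Lemma integral_mono (D : set W) (f g : W -> \bar R) :
  (forall w, D w -> 0 <= f w)%E -> (forall w, D w -> f w <= g w)%E ->
  (\int[P]_(w in D) f w <= \int[P]_(w in D) g w)%E.
Proof.
move=> f0 fg; have g0 w : D w -> (0 <= g w)%E by move=> Dw; exact: le_trans (f0 w Dw) (fg w Dw).
rewrite !ge0_integralE//; apply: le_ereal_sup => _ [p pf <-]; exists p => // w.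
apply: le_trans (pf w) _; rewrite !patchE; case: ifPn => // /set_mem; exact: fg.
Qed.

Variables (D N : set W).
Hypotheses (mD : measurable D) (mN : measurable N) (ND : N `<=` D).

Lemma integral_bounds (f : W -> \bar R) (x e : R) : 0 <= x <= 1 -> 0 <= e ->
  (forall w, D w -> 0 <= f w <= 1)%E ->
  (forall w, D w -> ~ N w -> ((x - e)%:E <= f w <= (x + e)%:E)%E) ->
  (((x - e) * prob P D - prob P N)%:E <= \int[P]_(w in D) f w <=
   ((x + e) * prob P D + prob P N)%:E)%E.
Proof.
move=> /andP[x0 x1] e0 f01 fx.
have f0 w : D w -> (0 <= f w)%E by move=> /f01 /andP[].
have mDN : measurable (D `\` N) by exact: measurableD.
apply/andP; split.
  pose y := Num.max 0 (x - e); have y0 : 0 <= y by rewrite le_max lexx.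
  apply: (@le_trans _ _ (\int[P]_(w in D) (y%:E * (\1_(D `\` N) w)%:E))%E).
    rewrite ge0_integralZl_EFin//; last first.
      by apply/measurable_EFinP; exact: measurable_indic.
    rewrite integral_indic// (_ : _ `&` D = D `\` N); last by apply/setIidPl => w [].
    rewrite measureD//; last by rewrite ltey_eq fin_num_measure.
    rewrite (_ : D `&` N = N); last by apply/setIidPr.
    have pE : (y%:E * (P D - P N) = (y * prob P D - y * prob P N)%:E)%E.
      by rewrite (probE P mD) (probE P mN) -EFinB -EFinM mulrBr.
    rewrite [leRHS](_ : _ = (y * prob P D - y * prob P N)%:E); last exact: pE.
    rewrite lee_fin.
    have p0 := prob_ge0 P D; have n0 := prob_ge0 P N.
    have y1 : y <= 1 by rewrite ge_max ler01/=; lra.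
    apply: lerB; first by rewrite ler_wpM2r// le_max lexx orbT.
    by rewrite ler_piMl.
  apply: integral_mono => w Dw.
    by rewrite -EFinM lee_fin mulr_ge0// indicE ler0n.
  rewrite -EFinM indicE; have [Nw|Nw] := pselect (N w).
    rewrite memNset ?mulr0; last by case.
    exact: f0.
  rewrite mem_set// mulr1 /y; have /andP[fl _] := fx w Dw Nw.
  by rewrite EFin_max ge_max fl f0.
apply: (@le_trans _ _ (\int[P]_(w in D) ((x + e)%:E + (\1_N w)%:E))%E).
  apply: integral_mono => // w Dw; rewrite indicE; have [Nw|Nw] := pselect (N w).
    rewrite mem_set//; have /andP[_ f1] := f01 w Dw.
    by apply: (le_trans f1); rewrite -EFinD lee_fin/=; lra.
  by rewrite memNset// adde0; have /andP[] := fx w Dw Nw.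
rewrite ge0_integralD//; first last.
- by apply/measurable_EFinP; exact: measurable_indic.
- by move=> w _; rewrite lee_fin; lra.
rewrite integral_cst// integral_indic// (_ : N `&` D = N); last exact/setIidPl.
have pE : ((x + e)%:E * P D + P N = ((x + e) * prob P D + prob P N)%:E)%E.
  by rewrite (probE P mD) (probE P mN).
by rewrite [leLHS](_ : _ = ((x + e) * prob P D + prob P N)%:E).
Qed.

End Sandwich.

Section DeepTail.
Context {R : realType} {d' : measure_display} {S : measurableType d'}.
Variables (X : nat -> S -> vertex)
  (Pw : {fset vertex} -> (vertex -> R) -> vertex -> probability S R).
Hypothesis walk : is_biased_walk X Pw.
Variables (t : {fset vertex}) (b : vertex -> R).
Hypothesis wt : is_weighted_tree t b.
Hypothesis t_gt1 : (0 < height t)%N.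

Lemma de_tail_bounds (a : R) : 0 <= a -> (0 <= de_tail X Pw a t b <= 1)%E.
Proof.
move=> a0; rewrite (de_tailE walk wt t_gt1 a0) !lee_fin; case: Num.trunc => [|n].
  by rewrite ler01 lexx.
have r0 := resist_gt0 wt t_gt1; rewrite /deep_cond mulr_ge0 ?walk_prob_ge0 ?(ltW r0)//=.
rewrite -ler_pdivlMr// mul1r -(deep_prob_vchild walk wt t_gt1).
exact: (deep_prob_le0 walk).
Qed.

End DeepTail.

Section Conclusion.
Context {R : realType}.
Variables (h : nat -> R) (nu : probability (measurableTypeR R) R).
Context {d : measure_display} {W : measurableType d}.
Variables (P : probability W R) (K : vertex -> W -> nat) (B : vertex -> W -> R).
Hypothesis GW : is_weighted_gw P h nu K B.

Local Notation T := (rand_tree K).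
Local Notation b_ := (rand_bias B).
Local Notation pr := (prob P).
Local Notation alive := (alive K B).
Implicit Types (t s : {fset vertex}) (E : {fset vertex} -> (vertex -> R) -> Prop).

Variables (q Q : R).
Hypotheses (q_gt1 : 1 < q) (ltqQ : q < Q).
Hypothesis nu_supp : msupport nu `<=` `[q, Q]%classic.
Hypothesis h_tail : exists2 c : R, 0 < c & forall k : nat, (1 <= k)%N ->
  (\sum_(k <= l <oo) (h l)%:E <= (expR (- (c * k%:R)))%:E)%E.
Hypothesis h0_gt0 : 0 < h 0%N.
Hypothesis h_branch : exists2 k, (0 < k)%N & 0 < h k.

Local Notation regular := (regular q Q).
Let mreg := @tree_event_regular R q Q.

Lemma heavierE u : 0 <= u -> heavier K B u = alive (heavy u).
Proof.
move=> u0; apply/seteqP; split=> w; last by case.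
rewrite /heavier /= => H; split=> //; apply/eqP => T0; move: H.
by rewrite T0 /tree_weight big_seq_fset0 ltNge u0.
Qed.

Lemma measurable_heavier u : 0 <= u -> measurable (heavier K B u).
Proof. by move=> u0; rewrite heavierE//; exact: (measurable_alive GW (tree_event_heavy u)). Qed.

(** The tree reduced to its root has weight one, so heavier trees have an
    edge. *)
Lemma heavier_tree u w : 1 <= u -> heavier K B u w ->
  is_weighted_tree (T w) (b_ w) /\ (0 < height (T w))%N.
Proof.
move=> u1; rewrite heavierE; last exact: le_trans u1.
move=> [T0 hu]; have TP := rand_tree_plane T0; split.
  by split=> // v vT v0; case: GW => _ _ _ _; apply.
rewrite lt0n; apply/eqP => h0; move: hu.
have -> : T w = [fset [::]]%fset.
  apply/fsetP => v; rewrite inE; apply/idP/eqP => [vT|->]; last exact: root_in.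
  by have := height_geq vT; rewrite h0 leqn0 => /nilP.
by rewrite /heavy /tree_weight big_seq_fset1 path_weightxx ltNge u1.
Qed.

(** The exceptional event is that of a heavy tree which is lossy at one of the
    first [J] vertices of its spine, or has a bias outside of [q, Q]. *)
Lemma small_loss (kappa : R) : 0 < kappa -> exists N : R -> set W, forall eta, 0 < eta ->
  exists2 u0, 1 <= u0 & forall u, u0 <= u ->
  [/\ measurable (N u), N u `<=` heavier K B u,
      pr (N u) <= eta * pr (heavier K B u), 0 < pr (heavier K B u) &
      forall w, heavier K B u w -> ~ N u w -> regular (T w) (b_ w) /\
        total_loss (T w) (b_ w) <= kappa * omega_star (T w) (b_ w)].
Proof.
move=> k0; have q0 : 0 < q by exact: lt_trans q_gt1.
have r1 : 0 < 1 - q^-1 by rewrite subr_gt0 invf_lt1.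
(* Half of [kappa] is for the losses at the first [J] vertices of the spine,
   half for the weight above them. *)
pose eps := Num.min 2^-1 (kappa * (1 - q^-1) / 2).
have k2 : 0 < kappa * (1 - q^-1) / 2 by rewrite divr_gt0 ?mulr_gt0.
have eps0 : 0 < eps by rewrite lt_min k2 andbT invr_gt0.
have [J qJ] := exists_power q_gt1 (kappa * (1 - q^-1) / 2)^-1.
pose Bad t b := exists j : 'I_J, lossy eps j.+1 t b.
have mBad : tree_event Bad by apply: tree_event_exists => j; exact: tree_event_lossy.
have nBad : negl P K B q Q Bad.
  apply: (negl_lossy_prefix GW q_gt1 ltqQ nu_supp h_tail h0_gt0 h_branch) => //.
  by rewrite ge_min lexx.
pose E u t (b : vertex -> R) := ~ (regular t b /\ ~ Bad t b) /\ heavy u t b.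
have mE u : tree_event (E u).
  by apply: tree_event_and (tree_event_heavy u); exact: (tree_event_not (tree_event_and mreg (tree_event_not mBad))).
have mRH u : tree_event (fun t b => regular t b /\ heavy u t b) by exact: tree_event_and (tree_event_heavy u).
exists (fun u => alive (E u)) => eta e0; have [u0 H] := nBad _ e0.
exists (Num.max 1 u0); first by rewrite le_max lexx.
move=> u; rewrite ge_max => /andP[u1 uu0]; have u_ge0 : 0 <= u by exact: le_trans u1.
have mass_heavier : mass P K B q Q u <= pr (heavier K B u).
  rewrite heavierE//; apply: (alive_le GW) => //; first exact: tree_event_heavy.
  by move=> t b _ [].
split.
- exact: (measurable_alive GW (mE u)).
- by rewrite heavierE// => w [T0 [_ ?]].
- apply: (le_trans (almost_regular GW nu_supp (mE u))).
  apply: (@le_trans _ _ (pr (alive (fun t b => (regular t b /\ Bad t b) /\ heavy u t b)))).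
    apply: (alive_le GW).
    + exact: (tree_event_and mreg (mE u)).
    + by apply: tree_event_and (tree_event_heavy u); exact: (tree_event_and mreg mBad).
    move=> t b _ [r [nb hu]]; split=> //; split=> //; apply: contrapT => nB; exact: nb.
  by apply: (le_trans (H u uu0)); rewrite ler_wpM2l// ltW.
- apply: lt_le_trans mass_heavier; exact: (mass_gt0 GW q_gt1 nu_supp h0_gt0 h_branch).
move=> w hw nw; have [[TP _] t0] := heavier_tree u1 hw.
move: hw; rewrite heavierE// => -[T0 hu].
have [r nB] : regular (T w) (b_ w) /\ ~ Bad (T w) (b_ w).
  by apply: contrapT => n; apply: nw.
split=> //; have bq := regular_geq r.
have om0 := omega_gt0 TP q_gt1 bq.
have H1 := total_loss_le (J := J) TP q_gt1 bq t0 (ltW eps0).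
apply: (le_trans (H1 _)).
  by move=> j jJ L; apply: nB; exists (Ordinal jJ).
rewrite ler_wpM2r ?(ltW om0)// ler_pdivrMr//.
have E1 : eps <= kappa * (1 - q^-1) / 2 by rewrite ge_min lexx orbT.
have E2 : q^-1 ^+ J <= kappa * (1 - q^-1) / 2.
  by rewrite exprVn invf_ple ?posrE ?exprn_gt0.
lra.
Qed.

End Conclusion.

Lemma tree_event_ratio {R : realType} (x y : \bar R) :
  tree_event (fun t (b : vertex -> R) => (x < mean_ratio_expr t b < y)%E).
Proof.
move=> t tP; have := measurable_mean_ratio_expr tP measurableT (emeasurable_itv `]x, y[).
rewrite setTI; congr (bias_event t _); apply/seteqP; split=> b /=; by rewrite in_itv.
Qed.

Theorem theorem4 (R : realType)
  (* offspring distribution *)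
  (h : nat -> R)
  (h_ge0 : forall k, 0 <= h k)
  (h_sum1 : (\sum_(0 <= k <oo) (h k)%:E = 1)%E)
  (h_mean_gt0 : (0 < \sum_(1 <= k <oo) (k%:R * h k)%:E)%E)
  (h_mean_lt1 : (\sum_(1 <= k <oo) (k%:R * h k)%:E < 1)%E)
  (h_tail : exists2 c : R, 0 < c &
     forall k : nat, (1 <= k)%N ->
       (\sum_(k <= l <oo) (h l)%:E <= (expR (- (c * k%:R)))%:E)%E)
  (* bias distribution *)
  (nu : probability (measurableTypeR R) R)
  (q Q : R) (q_gt1 : 1 < q) (ltqQ : q < Q)
  (nu_gt1 : nu `]1, +oo[%classic = 1%E)
  (nu_supp : msupport nu `<=` `[q, Q]%classic)
  (* weighted Galton-Watson tree *)
  (d : measure_display) (W : measurableType d) (P : probability W R)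
  (K : vertex -> W -> nat) (B : vertex -> W -> R)
  (GW : is_weighted_gw P h nu K B)
  (* biased walk *)
  (d' : measure_display) (S : measurableType d') (X : nat -> S -> vertex)
  (Pw : {fset vertex} -> (vertex -> R) -> vertex -> probability S R)
  (walk : is_biased_walk X Pw) :
  (forall eps : R, 0 < eps ->
     cond_prob P (heavier K B u)
       [set w | ((1 - eps)%:E < de_mean_ratio X Pw (rand_tree K w) (rand_bias B w)
                   < (1 + eps)%:E)%E]
     @[u --> +oo] --> 1%E) /\
  (forall a : R, 0 < a ->
     cond_expect P (heavier K B u)
       (fun w => de_tail X Pw a (rand_tree K w) (rand_bias B w))
     @[u --> +oo] --> (expR (- a))%:E).
Proof.
have h0_gt0 : 0 < h 0%N by exact: offspring0_gt0 h_ge0 h_sum1 h_mean_lt1.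
have h_branch := offspring_gt0 h_ge0 h_mean_gt0.
split=> [eps eps0|a a0].
  have [kappa k0 lim] := excursion_limits eps0 ltr01 q_gt1.
  have [N HN] := small_loss GW q_gt1 ltqQ nu_supp h_tail h0_gt0 h_branch k0.
  apply: cvg_ereal_approx => e e0; have [u0 u01 Hu0] := HN e e0.
  exists u0 => u uu0; have [mN ND pN pD good] := Hu0 u uu0.
  have u1 : 1 <= u by exact: le_trans uu0.
  have u_ge0 : 0 <= u by exact: le_trans u1.
  set D := heavier K B u in ND pN pD good *.
  have mD : measurable D by exact: (measurable_heavier GW).
  set A := [set w | _]; pose AD := A `&` D.
  have mAD : measurable AD.
    have := measurable_alive GW (tree_event_and (tree_event_heavy u)
      (tree_event_ratio (1 - eps)%:E (1 + eps)%:E)).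
    congr (measurable _); apply/seteqP; split=> w.
      move=> [T0 [hu H]]; have Dw : D w by rewrite /D heavierE.
      have [wt t0] := heavier_tree GW u1 Dw.
      by split=> //; rewrite /A /= (de_mean_ratio_expr walk wt t0).
    move=> [Aw Dw]; have [wt t0] := heavier_tree GW u1 Dw.
    move: (Dw); rewrite /D heavierE// => -[T0 hu]; split=> //; split=> //.
    by rewrite -(de_mean_ratio_expr walk wt t0).
  have DAN : prob P D <= prob P AD + prob P (N u).
    apply: le_trans (prob_setU P mAD mN); apply: prob_le => //; first exact: measurableU.
    move=> w Dw; have [Nw|Nw] := pselect (N u w); [by right|left; split=> //].
    have [wt t0] := heavier_tree GW u1 Dw; have [r loss] := good w Dw Nw.
    by have [] := lim _ _ X Pw _ _ walk wt t0 (regular_geq r) loss.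
  have cE : cond_prob P D A = (prob P AD / prob P D)%:E.
    by rewrite EFinM -(probE P mAD).
  have AD_D : prob P AD <= prob P D by apply: prob_le => // w [].
  rewrite cE !lee_fin ler_pdivlMr// ler_pdivrMr//; apply/andP; split; first lra.
  by apply: le_trans AD_D _; rewrite ler_peMl// ?(ltW pD)//; lra.
apply: cvg_ereal_approx => e e0; have e2 : 0 < e / 2 by rewrite divr_gt0.
have [kappa k0 lim] := excursion_limits e2 a0 q_gt1.
have [N HN] := small_loss GW q_gt1 ltqQ nu_supp h_tail h0_gt0 h_branch k0.
have [u0 u01 Hu0] := HN _ e2.
exists u0 => u uu0; have [mN ND pN pD good] := Hu0 u uu0.
have u1 : 1 <= u by exact: le_trans uu0.
have u_ge0 : 0 <= u by exact: le_trans u1.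
set D := heavier K B u in ND pN pD good *.
have mD : measurable D by exact: (measurable_heavier GW).
set f := fun w => de_tail _ _ _ _ _.
have x01 : 0 <= expR (- a) <= 1 by rewrite expR_ge0/= -expR0 ler_expR oppr_le0 ltW.
have f01 w : D w -> (0 <= f w <= 1)%E.
  move=> Dw; have [wt t0] := heavier_tree GW u1 Dw.
  exact: (de_tail_bounds walk wt t0 (ltW a0)).
have fx w : D w -> ~ N u w -> ((expR (- a) - e / 2)%:E <= f w <= (expR (- a) + e / 2)%:E)%E.
  move=> Dw Nw; have [wt t0] := heavier_tree GW u1 Dw; have [r loss] := good w Dw Nw.
  have [_ [x fE]] := lim _ _ X Pw _ _ walk wt t0 (regular_geq r) loss.
  rewrite /f fE !lee_fin ltr_norml => /andP[xl xr].
  by apply/andP; split; lra.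
have /andP[Il Ir] := integral_bounds P mD mN ND x01 (ltW e2) f01 fx.
rewrite /cond_expect -[fine _]/(prob P D).

move: Il Ir pN; case: (\int[P]_(w in D) f w)%E => [I| |] //=.
rewrite -EFinM !lee_fin ler_pdivlMr// ler_pdivrMr// => Il Ir pN.
by apply/andP; split; lra.
Qed.
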